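(* Let $\mathcal{S}$ be a set of polynomial identities, and suppose there exists a noncommutative ring $R$ that satisfies every identity in $\mathcal{S}$. Then one of the following must hold: (a) there is a prime $p$ such that $U_p$ satisfies the identities in $\mathcal{S}$; (b) there is a prime $p$, an integer $n\ge 2$ and $i\in\{1,\ldots,n-1\}$ such that $B_{p,n,i}$ satisfies the identities in $\mathcal{S}$; (c) there is a prime $p$ and a ring in $\mathcal{A}_p$ that satisfies the identities in $\mathcal{S}$. In particular, if there is a noncommutative ring that satisfies the identities of $\mathcal{S}$, then there is a finite noncommutative ring with nonzero nilpotent commutator ideal that satisfies the identities of $\mathcal{S}$.
   Context: All rings are associative with an identity element $1$. A noncommutative ring is a ring that is not commutative. A polynomial identity here is a polynomial $P\in\mathbb{Z}\{X_1,\ldots,X_s\}$ for some $s$ (an element of the free associative unital ring on noncommuting variables); a ring $R$ satisfies it if $P(r_1,\ldots,r_s)=0$ for all $r_1,\ldots,r_s\in R$. The commutator ideal of a ring is the two-sided ideal generated by all commutators $[a,b]=ab-ba$. For a prime $p$, $U_p$ is the ring of upper-triangular $2\times 2$ matrices with entries in $\mathbb{F}_p$. For a prime $p$, an integer $n\ge 2$ and $i\in\{1,\ldots,n-1\}$, $$B_{p,n,i}=\left\{\begin{pmatrix}x^{p^i}&y\\0&x\end{pmatrix}:x,y\in\mathbb{F}_{p^n}\right\}.$$ For a prime $p$, $\mathcal{A}_p$ is the collection of noncommutative rings that are a homomorphic image of a ring of the form $\mathbb{Z}\{x,y\}/(I+J_n)$ for some $n\ge 3$, where $(p,x,y)$ is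 the two-sided ideal of $\mathbb{Z}\{x,y\}$ generated by $p,x,y$, $I=(p,x,y)[x,y]\mathbb{Z}\{x,y\}+\mathbb{Z}\{x,y\}[x,y](p,x,y)$, and $J_n=(p,x,y)^n$. *)

(* Defs.v *)
From HB Require Import structures.
From mathcomp Require Import all_boot all_order all_algebra all_field.
From mathcomp Require Import generic_quotient ring_quotient.
From mathcomp Require Import boolp.
From mathcomp Require Import monalg.

Set Implicit Arguments.
Unset Strict Implicit.
Unset Printing Implicit Defensive.

Import GRing.Theory.
Local Open Scope ring_scope.

Definition noncommutative (R : pzRingType) : Prop :=
  ~ commutative (@GRing.mul R).

(* The ring Z{X_1, ..., X_s} is the monoid ring over int of the free monoid on
   'I_s. *)
Definition freeRing (s : nat) : nzRingType := {malg int[{fmonom 'I_s}]}.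

Definition freeX (s : nat) (i : 'I_s) : freeRing s := << fmu i >>.

Definition peval (s : nat) (R : nzRingType) (r : 'I_s -> R) (P : freeRing s) : R :=
  mmap (fun z : int => z%:~R) (fun m : {fmonom 'I_s} => \prod_(i <- m) r i) P.

(* Every ring in the statement is noncommutative, hence nonzero, so nothing is
   lost by using nzRingType here. *)
Definition satisfies (R : nzRingType) (S : forall s : nat, freeRing s -> Prop) :
    Prop :=
  forall (s : nat) (P : freeRing s), S s P ->
  forall r : 'I_s -> R, peval r P = 0.

Section RingSubsets.
Variable R : pzRingType.
Implicit Types A B G : R -> Prop.

Record is_ideal A : Prop := IsIdeal {
  ideal0 : A 0;
  idealD : forall a b, A a -> A b -> A (a + b);
  idealMl : forall r a, A a -> A (r * a);
  idealMr : forall a r, A a -> A (a * r)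
}.

Inductive ideal_gen G : R -> Prop :=
| ideal_gen_base a : G a -> ideal_gen G a
| ideal_gen0 : ideal_gen G 0
| ideal_genD a b : ideal_gen G a -> ideal_gen G b -> ideal_gen G (a + b)
| ideal_genMl r a : ideal_gen G a -> ideal_gen G (r * a)
| ideal_genMr a r : ideal_gen G a -> ideal_gen G (a * r).

(* The additive subgroup generated by the products a * b. *)
Inductive set_mul A B : R -> Prop :=
| set_mul_base a b : A a -> B b -> set_mul A B (a * b)
| set_mul0 : set_mul A B 0
| set_mulD x y : set_mul A B x -> set_mul A B y -> set_mul A B (x + y)
| set_mulN x : set_mul A B x -> set_mul A B (- x).

Definition set_add A B (x : R) : Prop :=
  exists a b, [/\ A a, B b & x = a + b].

Definition full : R -> Prop := fun=> True.

(* The 0-th power is the whole ring, so that the first power of an ideal is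
   the ideal itself. *)
Definition ideal_pow A (n : nat) : R -> Prop := iter n (set_mul A) full.

Definition comm (a b : R) : R := a * b - b * a.

Definition commutator_ideal : R -> Prop :=
  ideal_gen (fun c => exists a b, c = comm a b).

Definition ideal_nonzero A : Prop := exists2 x, A x & x <> 0.

Definition ideal_nilpotent A : Prop :=
  exists n, forall x, ideal_pow A n x -> x = 0.

Lemma idealN A : is_ideal A -> forall a, A a -> A (- a).
Proof. by move=> hA a /(idealMl hA (-1)); rewrite mulN1r. Qed.

Lemma ideal_gen_ideal G : is_ideal (ideal_gen G).
Proof.
split; [exact: ideal_gen0|exact: ideal_genD|exact: ideal_genMl|].
exact: ideal_genMr.
Qed.

Lemma full_ideal : is_ideal full.
Proof. by []. Qed.

Lemma set_mul_idealMl A B : (forall r a, A a -> A (r * a)) ->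
  forall r x, set_mul A B x -> set_mul A B (r * x).
Proof.
move=> hA r x; elim=> [a b Aa Bb||y z _ hy _ hz|y _ hy].
- by rewrite mulrA; apply: set_mul_base => //; apply: hA.
- by rewrite mulr0; apply: set_mul0.
- by rewrite mulrDr; apply: set_mulD.
- by rewrite mulrN; apply: set_mulN.
Qed.

Lemma set_mul_ideal A B :
    (forall r a, A a -> A (r * a)) -> (forall b r, B b -> B (b * r)) ->
  is_ideal (set_mul A B).
Proof.
move=> hA hB; split; first exact: set_mul0.
- exact: set_mulD.
- exact: set_mul_idealMl.
- move=> x r; elim=> [a b Aa Bb||y z _ hy _ hz|y _ hy].
  + by rewrite -mulrA; apply: set_mul_base => //; apply: hB.
  + by rewrite mul0r; apply: set_mul0.
  + by rewrite mulrDl; apply: set_mulD.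
  + by rewrite mulNr; apply: set_mulN.
Qed.

Lemma set_add_ideal A B : is_ideal A -> is_ideal B -> is_ideal (set_add A B).
Proof.
move=> hA hB; split.
- by exists 0, 0; split; rewrite ?addr0 //; [case: hA|case: hB].
- move=> _ _ [a [b [Aa Bb ->]]] [c [d [Ac Bd ->]]].
  exists (a + c), (b + d); split; [exact: idealD|exact: idealD|].
  by rewrite addrACA.
- move=> r _ [a [b [Aa Bb ->]]]; exists (r * a), (r * b).
  by split; [exact: idealMl|exact: idealMl|rewrite mulrDr].
- move=> _ r [a [b [Aa Bb ->]]]; exists (a * r), (b * r).
  by split; [exact: idealMr|exact: idealMr|rewrite mulrDl].
Qed.

Lemma ideal_pow_ideal A n : is_ideal A -> is_ideal (ideal_pow A n).
Proof.
move=> hA; elim: n => [|n hn]; first exact: full_ideal.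
by apply: set_mul_ideal; [exact: idealMl|exact: idealMr].
Qed.

End RingSubsets.

(* ring_quotient only has the Z-module quotient, and the ring quotient for a
   commutative ring. *)

Section IdealQuotient.
Variables (R : pzRingType) (I : R -> Prop) (hI : is_ideal I).

Definition in_ideal of is_ideal I : {pred R} := fun x => `[< I x >].

Fact in_ideal_zmod_closed : zmod_closed (in_ideal hI).
Proof.
split; first by apply/asboolP; exact: ideal0.
move=> x y /asboolP Ix /asboolP Iy; apply/asboolP.
by apply: idealD => //; exact: idealN.
Qed.

HB.instance Definition _ :=
  GRing.isZmodClosed.Build R (in_ideal hI) in_ideal_zmod_closed.

Definition ideal_quot : Type := Quotient.quot (in_ideal hI).

HB.instance Definition _ := GRing.Zmodule.on ideal_quot.

Definition quot_pi (x : R) : ideal_quot := (\pi_(Quotient.quot (in_ideal hI)) x)%qT.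

Definition quot_repr (u : ideal_quot) : R :=
  repr (u : Quotient.quot (in_ideal hI)).

Lemma quot_piP x y : quot_pi x = quot_pi y <-> I (x - y).
Proof.
have E := Quotient.idealrBE (in_ideal hI) x y.
split=> [/eqP h|h]; first by apply/asboolP; rewrite -[`[< _ >]]/(_ \in in_ideal hI) E.
by apply/eqP; rewrite -[_ == _]E; apply/asboolP.
Qed.

Lemma quot_pi_surj (u : ideal_quot) : exists x, quot_pi x = u.
Proof. by exists (quot_repr u); apply: reprK. Qed.

Lemma quot_piD : {morph quot_pi : x y / x + y}.
Proof. by move=> x y; rewrite /quot_pi !piE. Qed.

Definition quot_mul (u v : ideal_quot) : ideal_quot :=
  quot_pi (quot_repr u * quot_repr v).

Lemma quot_piM : {morph quot_pi : x y / x * y >-> quot_mul x y}.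
Proof.
have rE x : I (x - quot_repr (quot_pi x)).
  by apply/quot_piP; rewrite /quot_pi /quot_repr reprK.
move=> x y; apply/quot_piP.
rewrite -(subrKA (quot_repr (quot_pi x) * y)) -mulrBl -mulrBr.
by apply: (idealD hI); [apply: (idealMr hI)|apply: (idealMl hI)].
Qed.

Fact quot_mulA : associative quot_mul.
Proof.
move=> u v w; have [x <-] := quot_pi_surj u.
have [y <-] := quot_pi_surj v; have [z <-] := quot_pi_surj w.
by rewrite -!quot_piM mulrA.
Qed.

Fact quot_mul1l : left_id (quot_pi 1) quot_mul.
Proof. by move=> u; have [x <-] := quot_pi_surj u; rewrite -quot_piM mul1r. Qed.

Fact quot_mul1r : right_id (quot_pi 1) quot_mul.
Proof. by move=> u; have [x <-] := quot_pi_surj u; rewrite -quot_piM mulr1. Qed.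

Fact quot_mulDl : left_distributive quot_mul +%R.
Proof.
move=> u v w; have [x <-] := quot_pi_surj u.
have [y <-] := quot_pi_surj v; have [z <-] := quot_pi_surj w.
by rewrite -quot_piD -!quot_piM mulrDl quot_piD.
Qed.

Fact quot_mulDr : right_distributive quot_mul +%R.
Proof.
move=> u v w; have [x <-] := quot_pi_surj u.
have [y <-] := quot_pi_surj v; have [z <-] := quot_pi_surj w.
by rewrite -quot_piD -!quot_piM mulrDr quot_piD.
Qed.

HB.instance Definition _ := GRing.Zmodule_isPzRing.Build ideal_quot
  quot_mulA quot_mul1l quot_mul1r quot_mulDl quot_mulDr.

Fact quot_piB : zmod_morphism quot_pi.
Proof. by move=> x y; rewrite /quot_pi !piE. Qed.

HB.instance Definition _ := GRing.isZmodMorphism.Build R ideal_quot quot_pi quot_piB.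

Fact quot_pi_monoid : monoid_morphism quot_pi.
Proof. by split; last exact: quot_piM. Qed.

HB.instance Definition _ := GRing.isMonoidMorphism.Build R ideal_quot quot_pi quot_pi_monoid.

End IdealQuotient.

Section UpperTriangular.
Variable p : nat.

Definition U_pred : {pred 'M['F_p]_2} := fun M => M 1 0 == 0.

Fact U_subring : subring_closed U_pred.
Proof.
split=> [|M N /eqP hM /eqP hN|M N /eqP hM /eqP hN]; apply/eqP.
- by rewrite !mxE.
- by rewrite !mxE hM hN subr0.
- rewrite mxE !big_ord_recl big_ord0 /= addr0 hM mul0r add0r.
  by rewrite (_ : lift _ _ = 1) ?hN ?mulr0 //; apply/val_inj.
Qed.

HB.instance Definition _ := GRing.isSubringClosed.Build _ U_pred U_subring.

Definition U : Type := {M : 'M['F_p]_2 | U_pred M}.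

HB.instance Definition _ := SubType.on U.
HB.instance Definition _ := Finite.on U.
HB.instance Definition _ := [SubChoice_isSubNzRing of U by <:].

End UpperTriangular.

Section PrimePower.
Variables (p n : nat) (pr_p : prime p) (n_gt0 : (0 < n)%N).

Definition GF : finFieldType := s2val (pPrimePowerField pr_p n_gt0).

Lemma GF_pchar : p \in [pchar GF].
Proof. exact: s2valP (pPrimePowerField pr_p n_gt0). Qed.

Lemma card_GF : #|GF| = (p ^ n)%N.
Proof. exact: s2valP' (pPrimePowerField pr_p n_gt0). Qed.

End PrimePower.

Section FrobeniusTwisted.
Variables (p n : nat) (pr_p : prime p) (n_gt1 : (1 < n)%N) (i : nat).
Let F := GF pr_p (ltnW n_gt1).

Definition B_pred : {pred 'M[F]_2} :=
  fun M => (M 1 0 == 0) && (M 0 0 == M 1 1 ^+ (p ^ i)).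

Fact B_subring : subring_closed B_pred.
Proof.
have chF : p \in [pchar F] := GF_pchar _ _.
have pi : [pchar F].-nat (p ^ i)%N.
  by rewrite (eq_pnat _ (pcharf_eq chF)) pnatX pnat_id ?orbT.
have E01 : lift ord0 ord0 = 1 :> 'I_2 by apply/val_inj.
split=> [|M N /andP[/eqP hM /eqP kM] /andP[/eqP hN /eqP kN]
         |M N /andP[/eqP hM /eqP kM] /andP[/eqP hN /eqP kN]].
- by rewrite unfold_in /B_pred !mxE /= expr1n !eqxx.
- by rewrite unfold_in /B_pred !mxE hM hN subr0 exprDn_pchar // exprNn_pchar // kM kN !eqxx.
- rewrite unfold_in /B_pred !mxE !big_ord_recl !big_ord0 /= !addr0 E01.
  by rewrite hM hN kM kN !(mul0r, mulr0, add0r, addr0) exprMn !eqxx.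
Qed.

HB.instance Definition _ := GRing.isSubringClosed.Build _ B_pred B_subring.

Definition B : Type := {M : 'M[F]_2 | B_pred M}.

HB.instance Definition _ := SubType.on B.
HB.instance Definition _ := Finite.on B.
HB.instance Definition _ := [SubChoice_isSubNzRing of B by <:].

End FrobeniusTwisted.

Section CollectionA.
Variable p : nat.

Definition freeXY : nzRingType := freeRing 2.
Definition varX : freeXY := freeX 0.
Definition varY : freeXY := freeX 1.

Definition pxy : freeXY -> Prop :=
  ideal_gen (fun g => [\/ g = p%:R, g = varX | g = varY]).

Definition commXY : freeXY -> Prop := eq (comm varX varY).

Definition idealI : freeXY -> Prop :=
  set_add (set_mul (set_mul pxy commXY) (@full freeXY))
          (set_mul (set_mul (@full freeXY) commXY) pxy).

Definition idealJ (n : nat) : freeXY -> Prop := ideal_pow pxy n.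

Lemma idealIJ_ideal n : is_ideal (set_add idealI (idealJ n)).
Proof.
have hM : is_ideal pxy := ideal_gen_ideal _.
apply: set_add_ideal; last exact: ideal_pow_ideal.
by apply: set_add_ideal; apply: set_mul_ideal;
  do ?[exact: (idealMl hM)|exact: (idealMr hM)|apply: set_mul_idealMl].
Qed.

Definition in_calA (A : nzRingType) : Prop :=
  noncommutative A /\
  exists2 n : nat, (3 <= n)%N &
    exists f : {rmorphism ideal_quot (idealIJ_ideal n) -> A},
      forall a : A, exists u, f u = a.

End CollectionA.

(* Main.v *)
(* Let R be a noncommutative ring satisfying S.  By Zorn's lemma a ring generated by two
   elements of R has a noncommutative quotient, generated by x and y, in which every
   nonzero ideal contains c = [x, y].  Its smallest ideal D = (c) satisfies D^2 = 0 or
   D^2 = D, and the bimodule endomorphisms of D form a field K.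
   If D^2 = 0, the left and right actions on D are two homomorphisms from the ring to K,
   and K is finite by Zariski's lemma.  Different kernels give U_p, equal kernels but
   different homomorphisms give B_{p,n,i}.  If the homomorphisms coincide, a quotient of
   Z{X,Y}/(I + J_n) satisfies the identities as soon as [X,Y] is not, modulo I and the
   identities, a sum of terms of high order; a Krull intersection argument excludes
   the latter.
   If D^2 = D and no U_p satisfies S, the ring has an identity in X and Y in which the
   coefficients of the words Y X^k do not sum to 0 mod p.  It forces D to be a domain
   (Levitzki).  If K is infinite, the homogeneous parts of the identity hold in D, so
   that D is a division ring satisfying an Engel identity, hence commutative.  If K is
   finite, polarizing the identity at linearly independent monomials shows that D is
   finite, hence commutative by Wedderburn's theorem.  Both contradict c <> 0. *)
From HB Require Import structures.
From mathcomp Require Import all_boot all_order all_algebra all_field.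
From mathcomp Require Import boolp.
From mathcomp Require Import finmap monalg.
From mathcomp Require Import zify ring.
From mathcomp Require classical_sets.
Require Import Defs.

Set Implicit Arguments.
Unset Strict Implicit.
Unset Printing Implicit Defensive.

Import GRing.Theory.
Local Open Scope ring_scope.

(** * Evaluation of noncommutative polynomials in two variables *)

(** Two obstacles shape the proof. When the two homomorphisms coincide, [X, Y] might lie in I + J_n
    plus the identities for every n. Since I and [X, Y] vanish at commuting arguments, the part in
    J_n would then vanish at all pairs of powers of one element. Such one-variable identities kill
    high powers of the squares of the letters, up to a fixed power of p and a factor that fixes c,
    and so all terms of high order vanish near c. When D^2 = D, the ideal D has no unit and no known
    finite dimension over K, so no matrices are at hand. They are replaced by operators x |-> sum
    a_i x b_i on D with the a_i independent over K. Such an operator can be shortened to one nonzero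
    term a x b inside any suitable class, for instance the operators that vanish or those with
    finite image. The words Y X^k matter because at X = e_22, Y = e_12 in U_p they are the only
    words containing Y that survive, and all of them equal e_12. *)

Section Evaluation.
Variables (s : nat) (R : nzRingType) (r : 'I_s -> R).

Definition word_eval (m : {fmonom 'I_s}) : R := \prod_(i <- m) r i.

Fact word_eval_mmorphism : mmorphism word_eval.
Proof.
split=> [m1 m2|]; first by rewrite /word_eval fmM big_cat.
by rewrite /word_eval fm1 big_nil.
Qed.

HB.instance Definition _ := isMultiplicative.Build {fmonom 'I_s} R word_eval
  word_eval_mmorphism.

Fact peval_is_zmod_morphism : zmod_morphism (peval r).
Proof. exact: (mmapB (f := intr) (h := word_eval)). Qed.

Fact peval_is_monoid_morphism : monoid_morphism (peval r).
Proof.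
have [] := @commr_mmap_is_multiplicative _ _ _ intr word_eval _.
  by move=> g m m'; apply: commr_sym; exact: commr_int.
by move=> hM h1; split.
Qed.

HB.instance Definition _ :=
  GRing.isZmodMorphism.Build (freeRing s) R (peval r) peval_is_zmod_morphism.
HB.instance Definition _ :=
  GRing.isMonoidMorphism.Build (freeRing s) R (peval r) peval_is_monoid_morphism.

Lemma pevalE P : peval r P = \sum_(m <- msupp P) (P@_m)%:~R * word_eval m.
Proof. by []. Qed.

Lemma peval_freeX i : peval r (freeX i) = r i.
Proof.
by rewrite /peval /freeX (mmapU (f := intr)) mul1r fmU big_seq1.
Qed.

End Evaluation.

Lemma peval_rmorph (s : nat) (R R' : nzRingType) (f : {rmorphism R -> R'})
    (r : 'I_s -> R) P : f (peval r P) = peval (f \o r) P.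
Proof.
rewrite !pevalE rmorph_sum; apply: eq_bigr => m _.
by rewrite rmorphM rmorph_int /word_eval rmorph_prod.
Qed.

Lemma eq_peval (s : nat) (R : nzRingType) (r r' : 'I_s -> R) P :
  r =1 r' -> peval r P = peval r' P.
Proof. by move=> /funext ->. Qed.

Definition ev2 (R : nzRingType) (a b : R) : freeRing 2 -> R :=
  peval (fun i : 'I_2 => if i == 0 then a else b).

HB.instance Definition _ (R : nzRingType) (a b : R) :=
  GRing.RMorphism.copy (ev2 a b) (peval (fun i : 'I_2 => if i == 0 then a else b)).

Lemma ev2_X (R : nzRingType) (a b : R) : ev2 a b varX = a.
Proof. by rewrite /ev2 peval_freeX. Qed.

Lemma ev2_Y (R : nzRingType) (a b : R) : ev2 a b varY = b.
Proof. by rewrite /ev2 peval_freeX. Qed.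

Lemma ev2_rmorph (R R' : nzRingType) (f : {rmorphism R -> R'}) a b P :
  f (ev2 a b P) = ev2 (f a) (f b) P.
Proof. by rewrite /ev2 peval_rmorph; apply: eq_peval => i /=; case: eqP. Qed.

Lemma rmorph_commutator (R R' : pzRingType) (f : {rmorphism R -> R'}) a b :
  f (comm a b) = comm (f a) (f b).
Proof. by rewrite /comm rmorphB !rmorphM. Qed.

Lemma ev2_comm (R : nzRingType) (a b : R) :
  ev2 a b (comm varX varY) = comm a b.
Proof. by rewrite rmorph_commutator /= ev2_X ev2_Y. Qed.

(* Words in two letters are encoded as bit lists: [false] is X, [true] is Y. *)
Definition wev (R : nzRingType) (a b : R) (w : seq bool) : R :=
  \prod_(t <- w) (if t then b else a).

Definition lsum (R : nzRingType) (a b : R) (l : seq (int * seq bool)) : R :=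
  \sum_(zw <- l) zw.1%:~R * wev a b zw.2.

Lemma wev_nil (R : nzRingType) (a b : R) : wev a b [::] = 1.
Proof. by rewrite /wev big_nil. Qed.

Lemma wev_cons (R : nzRingType) (a b : R) t w :
  wev a b (t :: w) = (if t then b else a) * wev a b w.
Proof. by rewrite /wev big_cons. Qed.

Lemma wev_cat (R : nzRingType) (a b : R) w w' :
  wev a b (w ++ w') = wev a b w * wev a b w'.
Proof. by rewrite /wev big_cat. Qed.

Lemma lsum_nil (R : nzRingType) (a b : R) : lsum a b [::] = 0.
Proof. by rewrite /lsum big_nil. Qed.

Lemma lsum_cons (R : nzRingType) (a b : R) z w l :
  lsum a b ((z, w) :: l) = z%:~R * wev a b w + lsum a b l.
Proof. by rewrite /lsum big_cons. Qed.

Lemma lsum_cat (R : nzRingType) (a b : R) l l' :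
  lsum a b (l ++ l') = lsum a b l + lsum a b l'.
Proof. by rewrite /lsum big_cat. Qed.

(** One list serves all rings at once, which lets an identity travel between rings. Distinctness of
    the words is what later isolates a single coefficient in [finite_ideal]. *)
Lemma ev2_list (P : freeRing 2) : exists2 l : seq (int * seq bool),
  uniq (map snd l) &
  forall (R : nzRingType) (a b : R), ev2 a b P = lsum a b l.
Proof.
exists [seq (P@_m, [seq i != 0 | i <- (m : seq 'I_2)]) | m : {fmonom 'I_2} <- msupp P].
  rewrite -map_comp map_inj_uniq; first exact: fset_uniq.
  have inj0 : injective (fun i : 'I_2 => i != 0).
    by move=> [[|[|//]] ?] [[|[|//]] ?] // _; apply/val_inj.
  by move=> m1 m2 /= /(inj_map inj0) /val_inj.
move=> R a b; rewrite /ev2 pevalE /lsum big_map; apply: eq_bigr => m _ /=.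
rewrite /wev big_map /word_eval; congr (_ * _); apply: eq_bigr => i _.
by case: eqP.
Qed.

Lemma wev_rmorph (R R' : nzRingType) (f : {rmorphism R -> R'}) a b w :
  f (wev a b w) = wev (f a) (f b) w.
Proof. by rewrite /wev rmorph_prod; apply: eq_bigr => -[]. Qed.

Lemma lsum_rmorph (R R' : nzRingType) (f : {rmorphism R -> R'}) a b l :
  f (lsum a b l) = lsum (f a) (f b) l.
Proof.
rewrite /lsum rmorph_sum; apply: eq_bigr => zw _.
by rewrite rmorphM rmorph_int wev_rmorph.
Qed.

Lemma ev2_lsum (R : nzRingType) (a b : R) l :
  ev2 a b (lsum varX varY l) = lsum a b l.
Proof. by rewrite lsum_rmorph /= ev2_X ev2_Y. Qed.

Lemma ev2_id P : ev2 varX varY P = P :> freeRing 2.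
Proof.
rewrite /ev2 pevalE [RHS]monalgE; apply: eq_bigr => m _.
have -> : word_eval (fun i : 'I_2 => if i == 0 then varX else varY) m = << m >>.
  case: m => t; rewrite /word_eval /=; elim: t => [|i t IH].
    by rewrite big_nil; congr << _ >>; apply/val_inj; exact: fm1.
  rewrite big_cons IH.
  have -> : (if i == 0 then varX else varY) = freeX i.
    by case: i => [[|[|//]] ?]; rewrite /varX /varY; congr freeX; apply/val_inj.
  rewrite /freeX malgME !msuppU oner_eq0 !big_seq_fset1 !mcoeffUU mul1r.
  by congr << _ >>; apply/val_inj; rewrite [LHS]fmM fmU.
have -> : (P@_m)%:~R = (P@_m)%:MP :> freeRing 2.
  by rewrite -[in RHS](intz (P@_m)) (rmorph_int (@malgC {fmonom 'I_2} int)).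
rewrite mul_malgC; apply/malgP => k; rewrite mcoeffZ !mcoeffU.
by case: eqP => _; rewrite ?mulr1n ?mulr1 ?mulr0n ?mulr0.
Qed.

Lemma freeXY_lsum (P : freeRing 2) : exists l, P = lsum varX varY l.
Proof.
by have [l _ /(_ (freeRing 2) varX varY)] := ev2_list P; rewrite ev2_id; exists l.
Qed.

(** * Reduction to a ring with a smallest ideal *)

(* A subring of R x A that projects onto A and meets 0 x A trivially presents A
   as a quotient of a subring of R. *)
Lemma satisfies_rel (R A : nzRingType) (S : forall s : nat, freeRing s -> Prop)
    (E : R -> A -> Prop) :
  E 1 1 -> (forall a b u v, E a u -> E b v -> E (a - b) (u - v)) ->
  (forall a b u v, E a u -> E b v -> E (a * b) (u * v)) ->
  (forall u, exists a, E a u) -> (forall u, E 0 u -> u = 0) ->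
  satisfies R S -> satisfies A S.
Proof.
move=> E1 EB EM Esurj E0 hR s P SP u.
have [a Ea] := choice (fun i => Esurj (u i)).
have E00 : E 0 0 by rewrite -(subrr (1 : R)) -(subrr (1 : A)); apply: (EB).
have ED x y v w : E x v -> E y w -> E (x + y) (v + w).
  move=> Ex Ey; rewrite -[y]opprK -[w]opprK; apply: (EB) => //.
  by rewrite -[- y]sub0r -[- w]sub0r; apply: (EB).
have En n : E n%:R n%:R by elim: n => // n IH; rewrite !mulrS; apply: ED.
have Ez (z : int) : E z%:~R z%:~R.
  case: z => n; rewrite ?NegzE ?mulrNz -!pmulrn //.
  by rewrite -[- n.+1%:R in X in E X]sub0r -[X in E _ X]sub0r; apply: EB.
apply: E0; have <- := hR s P SP a; rewrite !pevalE.
elim/big_ind2: _ => // [x v y w|m _]; first exact: ED.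
apply: (EM) => //; rewrite /word_eval; elim/big_ind2: _ => // x v y w.
exact: EM.
Qed.

Lemma satisfies_surj (R A : nzRingType) (S : forall s : nat, freeRing s -> Prop)
    (f : {rmorphism R -> A}) :
  (forall u, exists a, f a = u) -> satisfies R S -> satisfies A S.
Proof.
move=> fsurj; apply: (@satisfies_rel R A S (fun a u => f a = u)) => //.
- exact: rmorph1.
- by move=> a b _ _ <- <-; rewrite rmorphB.
- by move=> a b _ _ <- <-; rewrite rmorphM.
- by move=> _ <-; rewrite rmorph0.
Qed.

Lemma nz_quotient (R : pzRingType) (I : R -> Prop) : is_ideal I -> ~ I 1 ->
  exists (A : nzRingType) (f : {rmorphism R -> A}),
    (forall u, exists a, f a = u) /\ (forall a, f a = 0 <-> I a).
Proof.
move=> hI I1.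
have neq10 : (1 : ideal_quot hI) != 0.
  apply/eqP; rewrite -[1]/(quot_pi hI 1) -(rmorph0 (quot_pi hI)) => /quot_piP.
  by rewrite subr0.
pose A : nzRingType := HB.pack (ideal_quot hI)
  (GRing.PzSemiRing_isNonZero.Build (ideal_quot hI) neq10).
exists A, (quot_pi hI : {rmorphism R -> ideal_quot hI}); split.
  exact: quot_pi_surj.
move=> a; rewrite -[X in _ = X](rmorph0 (quot_pi hI)).
by split=> [/quot_piP|Ia]; [|apply/quot_piP]; rewrite subr0.
Qed.

Lemma maximal_ideal_avoiding (R : pzRingType) (I0 : R -> Prop) (c : R) :
  is_ideal I0 -> ~ I0 c -> exists I : R -> Prop,
  [/\ is_ideal I, forall x, I0 x -> I x, ~ I c &
      forall J, is_ideal J -> (forall x, I x -> J x) -> ~ J c ->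
        forall x, J x -> I x].
Proof.
move=> hI0 I0c.
pose T := {I : R -> Prop | [/\ is_ideal I, forall x, I0 x -> I x & ~ I c]}.
pose le (I J : T) := `[< forall x, sval I x -> sval J x >].
have [|||C totC|M maxM] := @classical_sets.Zorn T le.
- by move=> I; apply/asboolP.
- move=> I J K /asboolP IJ /asboolP JK; apply/asboolP => x /IJ; exact: JK.
- move=> [I PI] [J PJ] /asboolP /= IJ /asboolP /= JI; apply: eq_exist => /=.
  by apply: funext => x; apply: propext; split; [apply: IJ|apply: JI].
(* The empty chain is bounded by [I0]; a nonempty chain is bounded by its union. *)
- have [[I1 C1]|noC] := pselect (exists I, C I); last first.
    exists (exist _ I0 (And3 hI0 (fun _ => id) I0c)) => I CI.
    by case: noC; exists I.
  pose U x := exists2 I, C I & sval I x.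
  have PU : [/\ is_ideal U, forall x, I0 x -> U x & ~ U c].
    split; last by move=> [I _ Ic]; case: (svalP I).
    + split.
      * by exists I1 => //; case: (svalP I1) => -[].
      * move=> a b [I CI Ia] [J CJ Jb].
        have [] := totC _ _ CI CJ => /asboolP le_; [exists J|exists I] => //.
          by case: (svalP J) => hJ _ _; apply: idealD => //; exact: le_.
        by case: (svalP I) => hI _ _; apply: idealD => //; exact: le_.
      * by move=> r a [I CI Ia]; exists I => //; case: (svalP I) => hI _ _; exact: idealMl.
      * by move=> a r [I CI Ia]; exists I => //; case: (svalP I) => hI _ _; exact: idealMr.
    + by move=> x I0x; exists I1 => //; case: (svalP I1) => _ + _; apply.
  exists (exist _ U PU) => I CI; apply/asboolP => x Ix /=; by exists I.
have [hM M0 Mc] := svalP M; exists (sval M); split=> // J hJ MJ Jc x Jx.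
have PJ : [/\ is_ideal J, forall x, I0 x -> J x & ~ J c].
  by split=> // y /M0; exact: MJ.
by rewrite -(maxM (exist _ J PJ)) //; apply/asboolP.
Qed.

Lemma rker_ideal (R A : pzRingType) (f : {rmorphism R -> A}) :
  is_ideal (fun a => f a = 0).
Proof.
split=> [|a b fa fb|r a fa|a r fa]; first exact: rmorph0.
- by rewrite rmorphD fa fb addr0.
- by rewrite rmorphM fa mulr0.
- by rewrite rmorphM fa mul0r.
Qed.

Lemma preim_ideal (R A : pzRingType) (f : {rmorphism R -> A}) (I : A -> Prop) :
  is_ideal I -> is_ideal (fun a => I (f a)).
Proof.
move=> hI; split=> [|a b fa fb|r a fa|a r fa].
- by rewrite rmorph0; exact: ideal0.
- by rewrite rmorphD; exact: idealD.
- by rewrite rmorphM; exact: idealMl.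
- by rewrite rmorphM; exact: idealMr.
Qed.

(** The subring generated by [a] and [b] is never formed: the maximal ideal avoiding [X, Y] is taken
    in the free ring, above the kernel of the evaluation at [(a, b)]. Maximality says that every
    nonzero ideal of the quotient contains the commutator. *)
Lemma two_generated_core (S : forall s : nat, freeRing s -> Prop) (R : nzRingType) :
  noncommutative R -> satisfies R S ->
  exists (A : nzRingType) (x y : A),
  [/\ satisfies A S, forall a, exists P, a = ev2 x y P, comm x y <> 0 &
      forall I : A -> Prop, is_ideal I -> ideal_nonzero I -> I (comm x y)].
Proof.
move=> ncR hR.
have [a [b ab]] : exists a b : R, comm a b <> 0.
  apply: contrapT => h; apply: ncR => a b; apply/eqP; rewrite -subr_eq0.
  by apply/eqP; apply: contrapT => h'; apply: h; exists a, b.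
pose c : freeRing 2 := comm varX varY.
have evc : ev2 a b c = comm a b := ev2_comm a b.
have [|I [hI kerI Ic maxI]] :=
    maximal_ideal_avoiding (rker_ideal (ev2 a b)) (c := c).
  by move=> /=; rewrite evc.
have [|A [f [fsurj kerf]]] := nz_quotient hI.
  by move=> /(idealMr hI c); rewrite mul1r.
exists A, (f varX), (f varY).
have fc : comm (f varX) (f varY) = f c := esym (rmorph_commutator f varX varY).
split.
- move=> s P SP u.
  have [v fv] := choice (fun i => fsurj (u i)).
  rewrite (eq_peval _ (r' := f \o v)); last by move=> i /=; rewrite fv.
  rewrite -peval_rmorph; apply/kerf/kerI => /=.
  by rewrite peval_rmorph; exact: hR.
- by move=> u; have [P <-] := fsurj u; exists P; rewrite -ev2_rmorph ev2_id.
- by rewrite fc => /kerf.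
- move=> J hJ [u Ju u0]; rewrite fc; apply: contrapT => Jc.
  apply: u0; have [P fP] := fsurj u; rewrite -fP; apply/kerf.
  apply: (maxI (fun P => J (f P))); rewrite ?fP //; first exact: preim_ideal.
  by move=> Q /kerf ->; exact: ideal0.
Qed.

(** * Minimal ideals and their centroid *)

Definition minimal_ideal (R : pzRingType) (D : R -> Prop) : Prop :=
  ideal_nonzero D /\
  forall I, is_ideal I -> (forall x, I x -> D x) -> ideal_nonzero I ->
    forall x, D x -> I x.

Section IdealType.
Variables (R : nzRingType) (D : R -> Prop) (hD : is_ideal D).

Definition ideal_type : Type := {x : R | in_ideal hD x}.

HB.instance Definition _ := SubType.on ideal_type.
HB.instance Definition _ := Choice.on ideal_type.
HB.instance Definition _ := [SubChoice_isSubZmodule of ideal_type by <:].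

Lemma ideal_typeP (d : ideal_type) : D (val d).
Proof. exact/asboolP/(valP d). Qed.

Definition to_ideal x (Dx : D x) : ideal_type := exist _ x (asboolT Dx).

Definition lm (r : R) (d : ideal_type) : ideal_type :=
  to_ideal (idealMl hD r (ideal_typeP d)).

Definition rm (d : ideal_type) (r : R) : ideal_type :=
  to_ideal (idealMr hD r (ideal_typeP d)).

Lemma val_lm r d : val (lm r d) = r * val d. Proof. by []. Qed.
Lemma val_rm d r : val (rm d r) = val d * r. Proof. by []. Qed.

Lemma lmDr r : {morph lm r : a b / a + b}.
Proof. by move=> a b; apply/val_inj; rewrite !(val_lm, raddfD) /= mulrDr. Qed.
Lemma lmDl r s d : lm (r + s) d = lm r d + lm s d.
Proof. by apply/val_inj; rewrite !(val_lm, raddfD) /= mulrDl. Qed.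
Lemma lmA r s d : lm (r * s) d = lm r (lm s d).
Proof. by apply/val_inj; rewrite !val_lm mulrA. Qed.
Lemma lm1 d : lm 1 d = d.
Proof. by apply/val_inj; rewrite val_lm mul1r. Qed.
Lemma rmDl r : {morph rm^~ r : a b / a + b}.
Proof. by move=> a b; apply/val_inj; rewrite !(val_rm, raddfD) /= mulrDl. Qed.
Lemma rmDr r s d : rm d (r + s) = rm d r + rm d s.
Proof. by apply/val_inj; rewrite !(val_rm, raddfD) /= mulrDr. Qed.
Lemma rmA r s d : rm d (r * s) = rm (rm d r) s.
Proof. by apply/val_inj; rewrite !val_rm mulrA. Qed.
Lemma rm1 d : rm d 1 = d.
Proof. by apply/val_inj; rewrite val_rm mulr1. Qed.
Lemma lm_rm r d s : lm r (rm d s) = rm (lm r d) s.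
Proof. by apply/val_inj; rewrite !(val_rm, val_lm) mulrA. Qed.

Definition bimodule_map (f : ideal_type -> ideal_type) : Prop :=
  [/\ {morph f : a b / a + b}, forall r d, f (lm r d) = lm r (f d) &
      forall d r, f (rm d r) = rm (f d) r].

End IdealType.

(** Commutation of the bimodule maps is bundled because it holds for different reasons when D^2 = 0
    and when D^2 = D, while the field structure of the centroid needs only the fact. *)
Record minIdeal (R : nzRingType) := MinIdeal {
  mi_set :> R -> Prop;
  mi_ideal : is_ideal mi_set;
  mi_min : minimal_ideal mi_set;
  mi_comm : forall f g : ideal_type mi_ideal -> ideal_type mi_ideal,
    bimodule_map f -> bimodule_map g -> forall d, f (g d) = g (f d)
}.

Section Centroid.
Variables (R : nzRingType) (D : minIdeal R).
Local Notation hD := (mi_ideal D).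
Local Notation dT := (ideal_type hD).

Definition centroid : Type := {f : dT -> dT | `[< bimodule_map f >]}.

HB.instance Definition _ := SubType.on centroid.
HB.instance Definition _ := Choice.on centroid.

Definition cact (k : centroid) : dT -> dT := val k.

Lemma cactP (k : centroid) : bimodule_map (cact k).
Proof. exact/asboolP/(valP k). Qed.

Definition to_centroid f (hf : bimodule_map f) : centroid :=
  exist _ f (asboolT hf).

Lemma centroid_eq (k l : centroid) : (forall d, cact k d = cact l d) -> k = l.
Proof. by move=> kl; apply/val_inj/funext. Qed.

Lemma cactD k : {morph cact k : a b / a + b}. Proof. by case: (cactP k). Qed.
Lemma cact_lm k r d : cact k (lm r d) = lm r (cact k d).
Proof. by case: (cactP k). Qed.
Lemma cact_rm k d r : cact k (rm d r) = rm (cact k d) r.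
Proof. by case: (cactP k). Qed.
Lemma cact0 k : cact k 0 = 0.
Proof. by apply: (addrI (cact k 0)); rewrite -cactD !addr0. Qed.
Lemma cactN k d : cact k (- d) = - cact k d.
Proof. by apply: (addrI (cact k d)); rewrite -cactD !subrr cact0. Qed.

Fact bimodule_map0 : bimodule_map (fun=> 0 : dT).
Proof.
by split=> [a b|r d|d r]; apply/val_inj; rewrite ?addr0 //= ?mulr0 ?mul0r.
Qed.

Fact bimodule_mapD k l : bimodule_map (fun d => cact k d + cact l d).
Proof.
split=> [a b|r d|d r]; first by rewrite !cactD addrACA.
  by rewrite !cact_lm lmDr.
by rewrite !cact_rm rmDl.
Qed.

Fact bimodule_mapN k : bimodule_map (fun d => - cact k d).
Proof.
split=> [a b|r d|d r]; first by rewrite !cactD opprD.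
  by rewrite !cact_lm; apply/val_inj; rewrite /= mulrN.
by rewrite !cact_rm; apply/val_inj; rewrite /= mulNr.
Qed.

Fact bimodule_map1 : bimodule_map (fun d : dT => d).
Proof. by []. Qed.

Fact bimodule_mapM k l : bimodule_map (fun d => cact k (cact l d)).
Proof.
by split=> [a b|r d|d r]; rewrite ?cactD ?cact_lm ?cact_rm.
Qed.

Definition caddition k l := to_centroid (bimodule_mapD k l).
Definition copposite k := to_centroid (bimodule_mapN k).
Definition czero := to_centroid bimodule_map0.
Definition cone := to_centroid bimodule_map1.
Definition cmul k l := to_centroid (bimodule_mapM k l).

Fact caddA : associative caddition.
Proof. by move=> k l m; apply: centroid_eq => d; exact: addrA. Qed.
Fact caddC : commutative caddition.
Proof. by move=> k l; apply: centroid_eq => d; exact: addrC. Qed.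
Fact cadd0 : left_id czero caddition.
Proof. by move=> k; apply: centroid_eq => d; exact: add0r. Qed.
Fact caddN : left_inverse czero copposite caddition.
Proof. by move=> k; apply: centroid_eq => d; exact: addNr. Qed.

HB.instance Definition _ := GRing.isZmodule.Build centroid caddA caddC cadd0 caddN.

Fact cmulA : associative cmul.
Proof. by move=> k l m; apply: centroid_eq. Qed.
Fact cmulC : commutative cmul.
Proof.
move=> k l; apply: centroid_eq => d; exact: mi_comm (cactP k) (cactP l) d.
Qed.
Fact cmul1 : left_id cone cmul.
Proof. by move=> k; apply: centroid_eq. Qed.
Fact cmulDl : left_distributive cmul +%R.
Proof. by move=> k l m; apply: centroid_eq. Qed.
Fact cone_neq0 : cone != 0.
Proof.
apply/eqP => c10; have [[d Dd d0] _] := mi_min D; apply: d0.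
exact: (congr1 (fun k => val (cact k (to_ideal hD Dd))) c10).
Qed.

HB.instance Definition _ := GRing.Zmodule_isComNzRing.Build centroid
  cmulA cmulC cmul1 cmulDl cone_neq0.

(** Schur's lemma: kernel and image of a bimodule map are ideals of the ring inside [D], so
    minimality leaves only the trivial ones. *)
Lemma cact_bij (k : centroid) : k != 0 -> injective (cact k) /\
  forall d, exists e, cact k e = d.
Proof.
move=> k0; have [d0 kd0] : exists d, cact k d <> 0.
  apply: contrapT => h; case/eqP: k0; apply: centroid_eq => d.
  by apply: contrapT => kd; apply: h; exists d.
pose I x := exists2 d : dT, x = val d & cact k d = 0.
have hI : is_ideal I.
  split; first by exists 0; rewrite ?cact0.
  - move=> _ _ [a -> ka] [b -> kb]; exists (a + b) => //.
    by rewrite cactD ka kb addr0.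
  - move=> r _ [a -> ka]; exists (lm r a) => //; rewrite cact_lm ka.
    by apply/val_inj; rewrite /= mulr0.
  - move=> _ r [a -> ka]; exists (rm a r) => //; rewrite cact_rm ka.
    by apply/val_inj; rewrite /= mul0r.
have ID x : I x -> D x by move=> [d -> _]; exact: ideal_typeP.
have inj0 d : cact k d = 0 -> d = 0.
  move=> kd; apply: contrapT => nd; apply: kd0.
  have [|e de ke] := (mi_min D).2 I hI ID _ _ (ideal_typeP d0).
    by exists (val d); [exists d|move=> d00; apply: nd; exact: val_inj].
  by rewrite (val_inj de).
split=> [a b kab|].
  by apply/subr0_eq/inj0; rewrite cactD cactN kab subrr.
pose J x := exists d : dT, x = val (cact k d).
have hJ : is_ideal J.
  split; first by exists 0; rewrite cact0.
  - by move=> _ _ [a ->] [b ->]; exists (a + b); rewrite cactD.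
  - by move=> r _ [a ->]; exists (lm r a); rewrite cact_lm.
  - by move=> _ r [a ->]; exists (rm a r); rewrite cact_rm.
have JD x : J x -> D x by move=> [d ->]; exact: ideal_typeP.
move=> d; have [|e de] := (mi_min D).2 J hJ JD _ _ (ideal_typeP d).
  by exists (val (cact k d0)); [exists d0|move=> h; apply: kd0; exact: val_inj].
by exists e; apply/val_inj.
Qed.

Lemma centroid_inverse (k : centroid) : exists l, k != 0 -> l * k = 1.
Proof.
have [->|k0] := eqVneq k 0; first by exists 0.
have [kinj ksurj] := cact_bij k0; have [g gK] := choice ksurj.
have hg : bimodule_map g.
  by split=> [a b|r d|d r]; apply: kinj; rewrite ?cactD ?cact_lm ?cact_rm !gK.
exists (to_centroid hg) => _; rewrite mulrC; apply: centroid_eq => d.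
exact: gK.
Qed.

Definition cinv (k : centroid) : centroid :=
  if k == 0 then 0 else sval (cid (centroid_inverse k)).

Fact cmulVf k : k != 0 -> cinv k * k = 1.
Proof. by rewrite /cinv; case: cid => l /= h k0; rewrite ifN ?h. Qed.
Fact cinv0 : cinv 0 = 0.
Proof. by rewrite /cinv; case: cid => l /= _; rewrite eqxx. Qed.

HB.instance Definition _ := GRing.ComNzRing_isField.Build centroid cmulVf cinv0.

Fact cactA a b (v : dT) : cact a (cact b v) = cact (a * b) v.
Proof. by []. Qed.
Fact cact1 : left_id 1 cact. Proof. by []. Qed.
Fact cactDl v : {morph cact^~ v : a b / a + b}. Proof. by []. Qed.
Fact cactDr : right_distributive cact +%R. Proof. exact: cactD. Qed.

HB.instance Definition _ := GRing.Zmodule_isLmodule.Build centroid dT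
  cactA cact1 cactDr cactDl.

Lemma scale_lm (k : centroid) r (d : dT) : k *: lm r d = lm r (k *: d).
Proof. exact: cact_lm. Qed.

Lemma scale_rm (k : centroid) (d : dT) r : k *: rm d r = rm (k *: d) r.
Proof. exact: cact_rm. Qed.

(** A product of two elements of [D] is both a left action on the second and a right action on the
    first, so a scalar can pass between the factors. *)
Lemma scale_val (k : centroid) (a b : dT) :
  val (k *: a) * val b = val a * val (k *: b).
Proof.
have -> : val a * val (k *: b) = val (k *: lm (val a) b) by rewrite scale_lm.
have -> : lm (val a) b = rm a (val b) by apply/val_inj.
by rewrite scale_rm.
Qed.

Lemma scaler_intl (z : int) (d : dT) : (z%:~R : centroid) *: d = d *~ z.
Proof. by rewrite scaler_int. Qed.

Lemma val_int (z : int) (d : dT) : val (d *~ z) = z%:~R * val d.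
Proof. by rewrite raddfMz mulrzl. Qed.

End Centroid.

(** * Zariski's lemma over the integers *)

(* The image of [f] becomes a field after inverting one element [f s]. *)
Definition goldman (A : comNzRingType) (K : fieldType) (f : {rmorphism A -> K}) :=
  exists s, f s != 0 /\
    forall u, f u != 0 -> exists v k, f u * f v = f s ^+ k.

Section Adjoin.
Variables (A : comNzRingType) (K : fieldType) (f : {rmorphism A -> K}).

Definition adjoin_morph (x : K) : {poly A} -> K :=
  horner_morph (fun a => mulrC x (f a)).

HB.instance Definition _ x := GRing.RMorphism.copy (adjoin_morph x)
  (horner_morph (fun a => mulrC x (f a))).

Lemma adjoin_morphE x P : adjoin_morph x P = (map_poly f P).[x].
Proof. by []. Qed.

Lemma adjoin_morphC x a : adjoin_morph x a%:P = f a.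
Proof. exact: horner_morphC. Qed.

Lemma adjoin_morphX x : adjoin_morph x 'X = x.
Proof. exact: horner_morphX. Qed.

(** Euclid's trick: [U = 1 + 'X * S] is coprime to [S]. If [U] does not vanish at [x], it divides a
    power of [S] there and is therefore invertible at [x], with inverse the value of a polynomial
    [W]. Then [U * W - 1] vanishes at [x], and it is not zero because [U] has positive degree. *)
Lemma goldman_algebraic x : goldman (adjoin_morph x) ->
  exists2 P : {poly A}, map_poly f P != 0 & root (map_poly f P) x.
Proof.
move=> [S [S0 hS]]; pose U := 1 + 'X * S.
have fU : map_poly f U = 1 + 'X * map_poly f S.
  by rewrite rmorphD rmorph1 rmorphM /= map_polyX.
have [Ux0|/hS [V [k UV]]] := eqVneq (adjoin_morph x U) 0.
  exists U; last by rewrite rootE -adjoin_morphE Ux0.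
  apply/eqP => /(congr1 (fun P : {poly K} => P.[0])).
  by rewrite fU !hornerE ?mul0r ?addr0 => /eqP; rewrite oner_eq0.
(* The geometric sum contributes [1 - (- 'X * S) ^+ k] to the product with [U]; the second summand
   restores the missing power, since [U * V] equals [S ^+ k] at [x]. *)
pose W := \sum_(i < k) (- ('X * S)) ^+ i + (- 'X) ^+ k * V.
exists (U * W - 1).
  rewrite rmorphB rmorph1 rmorphM /= fU subr_eq0.
  apply/eqP => /(congr1 (fun P : {poly K} => size P)).
  have fS0 : map_poly f S != 0.
    by apply: contraNneq S0 => fS0; rewrite /= adjoin_morphE fS0 horner0.
  have sU : size (1 + 'X * map_poly f S) = (size (map_poly f S)).+1.
    rewrite addrC size_polyDl mulrC size_mulX // size_poly1.
    by rewrite ltnS size_poly_gt0.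
  have [->|W0] := eqVneq (map_poly f W) 0.
    by rewrite mulr0 size_poly0 size_poly1.
  rewrite size_mul // -?size_poly_gt0 ?sU // size_poly1 /=.
  move: fS0 W0; rewrite -!size_poly_gt0.
  by case: (size _) (size _) => [//|m] [//|n]; rewrite addnS.
rewrite rootE -adjoin_morphE rmorphB rmorph1 rmorphM /=.
have -> : adjoin_morph x W =
    \sum_(i < k) (- (x * adjoin_morph x S)) ^+ i + (- x) ^+ k * adjoin_morph x V.
  rewrite rmorphD rmorph_sum rmorphM rmorphXn rmorphN /= adjoin_morphX.
  congr (_ + _); apply: eq_bigr => i _.
  by rewrite rmorphXn rmorphN rmorphM /= adjoin_morphX.
have xU : adjoin_morph x U = 1 - - (x * adjoin_morph x S).
  by rewrite /U rmorphD rmorph1 rmorphM /= adjoin_morphX opprK.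
rewrite mulrDr {1}xU.
have geo (a : K) : (1 - a) * \sum_(i < k) a ^+ i = 1 - a ^+ k.
  by rewrite -opprB mulNr -subrX1 opprB.
rewrite geo mulrCA UV -[- (x * _)]mulNr exprMn.
by rewrite subrK subrr.
Qed.

Lemma clear_denominator (a1 : A) (g := adjoin_morph (f a1)^-1) :
  f a1 != 0 -> forall q : {poly A}, exists z M, g q * f a1 ^+ M = f z.
Proof.
move=> a1n; elim/poly_ind => [|q c [z [M qz]]].
  by exists 0, 0%N; rewrite /g !rmorph0 mul0r.
exists (z + c * a1 ^+ M.+1), M.+1.
have -> : g (q * 'X + c%:P) = g q * (f a1)^-1 + f c.
  by rewrite /g rmorphD rmorphM /= adjoin_morphX adjoin_morphC.
rewrite rmorphD rmorphM rmorphXn -qz exprS; field.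
by [].
Qed.

(** Factors 'X are stripped from a monic equation of [s] until its constant term is nonzero in [K];
    that term is then a multiple of [s]. *)
Lemma integral_nonzero_constant (B : comNzRingType) (g : {rmorphism B -> K}) s :
  s != 0 -> integralOver g s ->
  exists (c : B) (w : K), [/\ g c != 0, integralOver g w & s * w = g c].
Proof.
move=> s0 [q]; elim/poly_ind: q => [|q c IH].
  by move=> /monic_neq0; rewrite eqxx.
have [-> |q0] := eqVneq q 0.
  rewrite mul0r add0r monicE lead_coefC => /eqP ->.
  by rewrite map_polyC /= rmorph1 rootE hornerC oner_eq0.
rewrite monicE lead_coefDl ?lead_coefMX; last first.
  by rewrite size_mulX // size_polyC; case: (c != 0); rewrite // ltnS size_poly_gt0.
rewrite -monicE => mq.
rewrite rmorphD rmorphM /= map_polyX map_polyC rootE !hornerE -[X in _ + X]/(g c).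
have [->|gc] := eqVneq (g c) 0.
  by rewrite addr0 mulf_eq0 (negPf s0) orbF => /(IH mq).
move=> qs; exists c, (- (map_poly g q).[s]); split=> //.
  apply/integral_opp/integral_horner; last first.
    exists (q * 'X + c%:P).
      rewrite monicE lead_coefDl ?lead_coefMX -?monicE //.
      by rewrite size_mulX // size_polyC; case: (c != 0); rewrite // ltnS size_poly_gt0.
    by rewrite rootE rmorphD rmorphM /= map_polyX map_polyC !hornerE.
  by move=> _ /(nthP 0) [i _ <-]; rewrite coef_map; exact: integral_id.
by rewrite mulrN mulrC; apply/eqP; rewrite eq_sym -subr_eq0 opprK addrC.
Qed.

(** Once the leading coefficient [a1] of a relation for [x] is inverted, all of A[x] is integral. A
    multiple of S(x) by an integral element is then some [c] in the localization, with numerator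
    [b]. An element [u] of [A] that divides a power of S(x) divides a power of [c] with an integral
    cofactor, and the monic equation of the cofactor replaces it by one from the localization. Hence
    inverting [b * a1] suffices. *)
Lemma goldman_descent x : goldman (adjoin_morph x) -> goldman f.
Proof.
move=> gx; have [P P0 Px] := goldman_algebraic gx.
have [S [S0 hS]] := gx.
pose a1 := P`_(size (map_poly f P)).-1.
have a1E : f a1 = lead_coef (map_poly f P) by rewrite lead_coefE coef_map.
have a1n : f a1 != 0 by rewrite a1E lead_coef_eq0.
pose g : {rmorphism {poly A} -> K} := adjoin_morph (f a1)^-1.
have gC a : g a%:P = f a by exact: adjoin_morphC.
have int_f a : integralOver g (f a) by rewrite -gC; exact: integral_id.
have int_x : integralOver g x.
  apply: (integral_root_monic (p := (f a1)^-1 *: map_poly f P)).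
  - by rewrite monicE lead_coefZ -a1E mulVf.
  - by rewrite rootE hornerZ (rootP Px) mulr0.
  - move=> _ /(nthP 0) [i _ <-]; rewrite coefZ coef_map.
    apply: integral_mul; last exact: int_f.
    by rewrite -(adjoin_morphX (f a1)^-1); exact: (integral_id g).
have int_fx Q : integralOver g (adjoin_morph x Q).
  have coef_int : {in map_poly f Q : seq K, integralRange g}.
    by move=> _ /(nthP 0) [i _ <-]; rewrite coef_map; exact: int_f.
  exact: integral_horner coef_int int_x.
have [c [w [gc int_w sw]]] := integral_nonzero_constant S0 (int_fx S).
have [b [L bL]] := clear_denominator a1n c.
have b0 : f b != 0 by rewrite -bL mulf_neq0 // expf_neq0.
exists (b * a1); split=> [|u u0]; first by rewrite rmorphM mulf_neq0.
have [|V [k uV]] := hS u%:P; first by rewrite /= adjoin_morphC.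
rewrite /= adjoin_morphC in uV.
have [T mT] : integralOver g (adjoin_morph x V * w ^+ k).
  apply: integral_mul => //.
  by elim: k {uV} => [|k IH]; rewrite ?exprS; [exact: integral1|exact: integral_mul].
have u_eta : f u * (adjoin_morph x V * w ^+ k) = g c ^+ k.
  by rewrite mulrA uV -exprMn sw.
set eta := _ * w ^+ k in u_eta *; move=> Teta.
move: eta u_eta Teta => eta u_eta Teta.
pose n := (size T).-1.
have sT : size T = n.+1 by rewrite prednK // size_poly_gt0 monic_neq0.
have Tn : T`_n = 1 by move: mT; rewrite monicE lead_coefE => /eqP.
(* Multiply the equation of [eta] by the n-th power of [u] and replace each [u * eta] by [c ^+ k]:
   every lower term keeps at least one factor [u], and [zeta] collects the rest. *)
pose zeta := - \sum_(i < n) T`_i * c ^+ (k * i) * u%:P ^+ (n.-1 - i).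
have zetaE : g c ^+ (k * n) = f u * g zeta.
  move: Teta; rewrite rootE horner_coef size_map_poly_id0; last first.
    by rewrite (eqP mT) rmorph1 oner_eq0.
  rewrite sT big_ord_recr /= !coef_map /= Tn rmorph1 mul1r addrC addr_eq0.
  move=> /eqP eta_n.
  rewrite exprM -u_eta exprMn eta_n mulrN rmorphN mulrN; congr (- _).
  rewrite rmorph_sum !mulr_sumr; apply: eq_bigr => i _.
  rewrite coef_map !rmorphM !rmorphXn /= gC exprM -u_eta exprMn.
  have -> : f u ^+ n = f u * (f u ^+ i * f u ^+ (n.-1 - i)).
    rewrite -exprD -exprS; congr (_ ^+ _).
    by rewrite subnKC; [case: (n) i => [[]|]|rewrite -ltnS prednK //; case: (n) i => [[]|]].
  by ring.
have [z [M zM]] := clear_denominator a1n zeta.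
exists (z * a1 ^+ (L * (k * n)) * b ^+ M * a1 ^+ (k * n)), (k * n + M)%N.
rewrite !rmorphM !rmorphXn /= -zM.
have gcE : f b ^+ (k * n) = g c ^+ (k * n) * f a1 ^+ (L * (k * n)).
  by rewrite -bL exprMn -exprM.
rewrite exprMn !exprD gcE zetaE; ring.
Qed.

End Adjoin.

(** In characteristic 0 a prime larger than |s| would have to divide a power of [s]. *)
Lemma goldman_int (K : fieldType) : goldman (intr : {rmorphism int -> K}) ->
  exists p, p \in [pchar K].
Proof.
move=> [s [s0 hs]]; apply: contrapT => noch.
have inj (z : int) : z%:~R = 0 :> K -> z = 0.
  move=> z0; apply/eqP; rewrite -absz_eq0 -leqn0 leqNgt; apply/negP => zpos.
  have [||p chp] := @natf0_pchar K `|z|%N => //; last by apply: noch; exists p.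
  by case: z z0 {zpos} => n; rewrite ?NegzE ?mulrNz -?pmulrn => /eqP; rewrite ?oppr_eq0.
have [p sp pr_p] := prime_above `|s|%N.
have [|v [k pv]] := hs p%:Z.
  by apply/eqP => /inj /eqP; rewrite eqz_nat; case: (p) pr_p.
have /eqP : p%:Z * v - s ^+ k = 0.
  by apply: inj; rewrite rmorphB rmorphM rmorphXn /= pv subrr.
rewrite subr_eq0 => /eqP /(congr1 absz); rewrite abszM abszX absz_nat => psk.
have : (p %| `|s| ^ k)%N by rewrite -psk dvdn_mulr.
rewrite Euclid_dvdX // => /andP[/dvdn_leq p_le _].
have : (p <= `|s|)%N.
  by apply: p_le; rewrite absz_gt0; apply: contraNneq s0 => ->.
by rewrite leqNgt sp.
Qed.

Section FinitelyGenerated.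
Variable K : fieldType.

Definition subring_pred (S : K -> Prop) : Prop :=
  [/\ S 1, forall a b, S a -> S b -> S (a - b) & forall a b, S a -> S b -> S (a * b)].

(** Generation is expressed through all subrings of [K], so no subring has to be built. With no
    generator left, [f] is onto the field and [s = 1] works. *)
Lemma goldman_fg (xs : seq K) (A : comNzRingType) (f : {rmorphism A -> K}) :
  (forall S, subring_pred S -> (forall a, S (f a)) ->
     (forall x, x \in xs -> S x) -> forall z, S z) -> goldman f.
Proof.
elim: xs A f => [|x xs IH] A f gen.
  have fsurj z : exists a, f a = z.
    apply: (gen (fun z => exists a, f a = z)) => // [|a]; last by exists a.
    split; first by exists 1; rewrite rmorph1.
      by move=> _ _ [a <-] [b <-]; exists (a - b); rewrite rmorphB.
    by move=> _ _ [a <-] [b <-]; exists (a * b); rewrite rmorphM.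
  exists 1; split=> [|u u0]; first by rewrite rmorph1 oner_eq0.
  have [v fv] := fsurj (f u)^-1; exists v, 0%N.
  by rewrite fv divff // expr0.
apply: (@goldman_descent _ _ f x); apply: IH => S hS Sf Sx; apply: gen => // [a|y].
  by rewrite -(adjoin_morphC f x); exact: Sf.
rewrite inE => /predU1P[->|]; last exact: Sx.
by rewrite -(adjoin_morphX f x); exact: Sf.
Qed.

(** The coefficients are fixed by Frobenius, so all [z ^+ (p ^ i)] are roots. Two of them coincide,
    and injectivity of Frobenius cancels the common power. *)
Lemma frobenius_root p (P : {poly int}) (z : K) (PK := map_poly (intr : int -> K) P) : p \in [pchar K] ->
  PK != 0 -> root PK z ->
  exists2 N, (0 < N)%N & z ^+ (p ^ N) = z.
Proof.
move=> chp P0 Pz; pose fr i := z ^+ (p ^ i).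
have root_fr i : root PK (fr i).
  elim: i => [|i /rootP IH]; first by rewrite /fr expn0 expr1.
  apply/rootP; rewrite /fr expnSr exprM -/(fr i).
  have -> : PK.[fr i ^+ p] = PK.[fr i] ^+ p.
    rewrite -[RHS](pFrobenius_autE chp) -horner_map /= pFrobenius_autE.
    congr _.[_]; apply/polyP => k; rewrite !coef_map /=.
    by rewrite rmorph_int.
  by rewrite IH expr0n; case: (p) (pcharf_prime chp).
have := max_poly_roots P0 (rs := [seq fr i | i <- iota 0 (size (PK))]).
rewrite size_map size_iota ltnn => nuniq.
have /(uniqPn 0) [i [j [ij]]] : ~~ uniq [seq fr i | i <- iota 0 (size (PK))].
  apply/negP => un; suff: false by []; apply: nuniq un.
  by apply/allP => _ /mapP[i _ ->].
rewrite size_map size_iota => jn.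
rewrite !(nth_map 0%N) ?size_iota ?(ltn_trans ij) // !nth_iota ?(ltn_trans ij) // !add0n.
move=> frij; exists (j - i)%N; first by rewrite subn_gt0.
have : fr i ^+ 1 = (z ^+ (p ^ (j - i))) ^+ (p ^ i).
  by rewrite expr1 frij /fr -exprM -expnD subnK // ltnW.
rewrite expr1 /fr; move: (z ^+ (p ^ (j - i))) => w; elim: (i) => [|k IHk]; first by rewrite expn0 !expr1.
rewrite !expnSr !exprM => /eqP; rewrite -!(pFrobenius_autE chp) -subr_eq0 -rmorphB /=.
by rewrite fmorph_eq0 subr_eq0 => /eqP /IHk.
Qed.

Lemma pchar_pnat p N : p \in [pchar K] -> [pchar K].-nat (p ^ N)%N.
Proof.
by move=> chp; rewrite (eq_pnat _ (pcharf_eq chp)) pnatX pnat_id ?orbT // (pcharf_prime chp).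
Qed.

(** Finiteness appears in the form used later, one exponent for all elements. It suffices to find an
    exponent for the generators, because the elements fixed by a power of Frobenius form a
    subring. *)
Lemma fg_field_finite (xs : seq K) :
  (forall S, subring_pred S -> (forall x, x \in xs -> S x) -> forall z, S z) ->
  exists p N, [/\ p \in [pchar K], (0 < N)%N & forall z : K, z ^+ (p ^ N) = z].
Proof.
move=> gen.
have gz z : goldman (adjoin_morph (intr : {rmorphism int -> K}) z).
  by apply: (@goldman_fg xs) => S hS _ Sx; exact: gen.
have [p chp] := goldman_int (goldman_descent (gz 0)).
have frN (z : K) : exists2 N, (0 < N)%N & z ^+ (p ^ N) = z.
  have [P P0 Pz] := goldman_algebraic (gz z).
  exact: frobenius_root chp P0 Pz.
have iterN (z : K) N m : z ^+ (p ^ N) = z -> z ^+ (p ^ (N * m)) = z.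
  by move=> zN; elim: m => [|m IH]; rewrite ?muln0 ?expr1 // mulnS expnD exprM zN.
have [N N0 xsN] : exists2 N, (0 < N)%N & forall x, x \in xs -> x ^+ (p ^ N) = x.
  elim: xs {gen gz} => [|x xs [N N0 IH]]; first by exists 1%N.
  have [M M0 xM] := frN x; exists (M * N)%N; first by rewrite muln_gt0 M0.
  move=> y; rewrite inE => /predU1P[->|/IH yN]; first exact: iterN.
  by rewrite mulnC; exact: iterN.
exists p, N; split=> //; apply: gen => //; split; first by rewrite expr1n.
  by move=> a b aN bN; rewrite exprDn_pchar ?pchar_pnat // exprNn_pchar ?pchar_pnat // aN bN.
by move=> a b aN bN; rewrite exprMn aN bN.
Qed.

End FinitelyGenerated.

(** * A smallest ideal of square zero *)

Lemma ev2_ind (R : nzRingType) (x y : R) (E : R -> Prop) :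
  (forall a, exists P, a = ev2 x y P) ->
  E 1 -> (forall a b, E a -> E b -> E (a - b)) ->
  (forall a b, E a -> E b -> E (a * b)) -> E x -> E y -> forall a, E a.
Proof.
move=> gen E1 EB EM Ex Ey a; have [P ->] := gen a.
have E0 : E 0 by rewrite -(subrr 1); exact: EB.
have EN b : E b -> E (- b) by rewrite -[- b]sub0r; exact: EB.
have ED b d : E b -> E d -> E (b + d).
  by move=> Eb Ed; rewrite -[d]opprK; apply: (EB) => //; exact: EN.
have En n : E n%:R by elim: n => // n IH; rewrite mulrS; exact: ED.
have Ez (z : int) : E z%:~R.
  by case: z => n; rewrite ?NegzE ?mulrNz -!pmulrn //; exact: EN.
have [l _ ->] := ev2_list P; rewrite /lsum.
elim/big_ind: _ => // -[z w] _; apply: (EM) => //.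
by rewrite /wev; elim/big_ind: _ => // -[].
Qed.

Lemma comm_derl (R : nzRingType) (a b s : R) :
  comm (a * b) s = a * comm b s + comm a s * b.
Proof. by rewrite /comm mulrBr mulrBl !mulrA addrA subrK. Qed.

Lemma commN (R : nzRingType) (a b : R) : comm a b = - comm b a.
Proof. by rewrite /comm opprB. Qed.

Lemma comm_subl (R : nzRingType) (a b s : R) : comm (a - b) s = comm a s - comm b s.
Proof.
rewrite /comm mulrBl mulrBr !opprB -!addrA; congr (_ + _).
by rewrite addrCA [RHS]addrCA [- _ - _]addrC.
Qed.

Section Core.
Variables (R : nzRingType) (x y : R).
Hypothesis gen : forall a, exists P, a = ev2 x y P.
Local Notation c := (comm x y).
Hypothesis c_neq0 : c <> 0.
Hypothesis heart : forall I : R -> Prop, is_ideal I -> ideal_nonzero I -> I c.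

Definition core_ideal : R -> Prop := ideal_gen (eq c).

Lemma core_idealP : is_ideal core_ideal. Proof. exact: ideal_gen_ideal. Qed.

Lemma core_ideal_c : core_ideal c. Proof. exact: ideal_gen_base. Qed.

Lemma core_ideal_sub (I : R -> Prop) : is_ideal I -> I c ->
  forall a, core_ideal a -> I a.
Proof.
move=> hI Ic a; elim=> [_ <- //||b d _ Ib _ Id|r b _ Ib|b r _ Ib].
- exact: ideal0.
- exact: idealD.
- exact: idealMl.
- exact: idealMr.
Qed.

Lemma core_ideal_min : minimal_ideal core_ideal.
Proof.
split; first by exists c => //; exact: core_ideal_c.
by move=> I hI _ I0; apply: core_ideal_sub => //; exact: heart.
Qed.

(** For fixed [t] the map [comm _ t] is a derivation, so the elements that it sends into [D] form a
    subring; this is used once for each argument. *)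
Lemma comm_core_ideal r s : core_ideal (comm r s).
Proof.
have hD := core_idealP.
have der t : core_ideal (comm x t) -> core_ideal (comm y t) ->
    forall a, core_ideal (comm a t).
  move=> xt yt; apply: (ev2_ind gen) => //.
  - by rewrite /comm mul1r mulr1 subrr; exact: ideal0.
  - move=> a b at_ bt; rewrite comm_subl; apply: (idealD hD) => //.
    exact: idealN.
  - move=> a b at_ bt; rewrite comm_derl.
    by apply: (idealD hD); [exact: idealMl|exact: idealMr].
have comm0 t : core_ideal (comm t t) by rewrite /comm subrr; exact: ideal0.
apply: (der); rewrite commN; apply: (idealN hD); move: s; apply: (der) => //.
  by rewrite commN; apply: idealN => //; exact: core_ideal_c.
exact: core_ideal_c.
Qed.

Section SquareZero.
Hypothesis sqz : forall a b, core_ideal a -> core_ideal b -> a * b = 0.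
Local Notation hD := core_idealP.
Local Notation dT := (ideal_type hD).

(** Two left multiplications on [D] differ in the order by a commutator, which lies in [D] and so
    kills [D]. *)
Lemma lm_bimodule r : bimodule_map (@lm _ _ hD r).
Proof.
split=> [|s d|d s]; [exact: lmDr| |exact: lm_rm].
apply/val_inj; rewrite !val_lm; apply/eqP; rewrite -subr_eq0 !mulrA -mulrBl.
by apply/eqP/sqz; [exact: comm_core_ideal|exact: ideal_typeP].
Qed.

Lemma rm_bimodule r : bimodule_map (fun d : dT => rm d r).
Proof.
split=> [|s d|d s]; [exact: rmDl|by rewrite lm_rm|].
apply/val_inj; rewrite !val_rm; apply/eqP; rewrite -subr_eq0 -!mulrA -mulrBr.
by apply/eqP/sqz; [exact: ideal_typeP|exact: comm_core_ideal].
Qed.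

Let c_ : dT := to_ideal hD core_ideal_c.

Lemma bimodule_map_eq (f g : dT -> dT) : bimodule_map f -> bimodule_map g ->
  f c_ = g c_ -> forall d, f d = g d.
Proof.
move=> [fD fl fr] [gD gl gr] fgc d.
pose I a := exists2 e : dT, a = val e & f e = g e.
have f0 (h : dT -> dT) : {morph h : a b / a + b} -> h 0 = 0.
  by move=> hD; apply: (addrI (h 0)); rewrite -hD !addr0.
have hI : is_ideal I.
  split; first by exists 0; rewrite ?f0.
  - by move=> _ _ [a -> fa] [b -> fb]; exists (a + b); rewrite ?raddfD // fD gD fa fb.
  - by move=> r _ [a -> fa]; exists (lm r a); rewrite // fl gl fa.
  - by move=> _ r [a -> fa]; exists (rm a r); rewrite // fr gr fa.
have Ic : I c by exists c_.
by have [e /val_inj <-] := core_ideal_sub hI Ic (ideal_typeP d).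
Qed.

Definition inner_map (l : seq (R * R)) (d : dT) : dT :=
  \sum_(rs <- l) lm rs.1 (rm d rs.2).

Lemma inner_map_comm l (f : dT -> dT) : bimodule_map f ->
  forall d, f (inner_map l d) = inner_map l (f d).
Proof.
move=> [fD fl fr] d; rewrite /inner_map.
have f0 : f 0 = 0 by apply: (addrI (f 0)); rewrite -fD !addr0.
elim: l => [|rs l IH]; first by rewrite !big_nil.
by rewrite !big_cons fD IH fl fr.
Qed.

Lemma inner_map_bimodule l : bimodule_map (inner_map l).
Proof.
split=> [a b|r d|d r].
- rewrite /inner_map -big_split; apply: eq_bigr => rs _ /=.
  by rewrite rmDl lmDr.
- by rewrite -(inner_map_comm l (lm_bimodule r)).
- by rewrite -(inner_map_comm l (rm_bimodule r)).
Qed.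

Lemma inner_map_onto (d : dT) : exists l, inner_map l c_ = d.
Proof.
pose I a := exists l, a = val (inner_map l c_).
have hI : is_ideal I.
  split; first by exists [::]; rewrite /inner_map ?big_nil.
  - move=> _ _ [l ->] [m ->]; exists (l ++ m).
    by rewrite /inner_map big_cat raddfD.
  - move=> r _ [l ->]; exists [seq (r * rs.1, rs.2) | rs <- l].
    rewrite -val_lm /inner_map big_map; congr val.
    elim: l => [|rs l IH]; first by rewrite !big_nil; apply/val_inj; rewrite /= mulr0.
    by rewrite !big_cons lmDr IH lmA.
  - move=> _ r [l ->]; exists [seq (rs.1, rs.2 * r) | rs <- l].
    rewrite -val_rm /inner_map big_map; congr val.
    elim: l => [|rs l IH]; first by rewrite !big_nil; apply/val_inj; rewrite /= mul0r.
    by rewrite !big_cons rmDl IH rmA !lm_rm.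
have Ic : I c.
  by exists [:: (1, 1)]; rewrite /inner_map big_seq1 lm1 rm1.
by have [l /val_inj ->] := core_ideal_sub hI Ic (ideal_typeP d); exists l.
Qed.

(** Every bimodule map is inner: it agrees at the generator [c_] with some [inner_map l], hence
    everywhere, and inner maps commute with all bimodule maps. *)
Lemma square_zero_comm (f g : dT -> dT) : bimodule_map f -> bimodule_map g ->
  forall d, f (g d) = g (f d).
Proof.
move=> hf hg d; have [l fl] := inner_map_onto (f c_).
have fE := bimodule_map_eq hf (inner_map_bimodule l) (esym fl).
by rewrite !fE (inner_map_comm l hg).
Qed.

(** Here [tau k] is [k *: c], so [D] becomes a copy of [K] on which the ring acts through [lam] from
    the left and [rho] from the right. As all endomorphisms are inner, the images of [x] and [y]
    under [lam] and [rho] generate [K] as a ring, which makes Zariski's lemma applicable. *)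
Lemma square_zero_structure :
  exists (K : fieldType) (lam rho : {rmorphism R -> K}) (tau : {additive K -> R}),
  [/\ tau 1 = c /\ forall k, core_ideal (tau k), injective tau,
      forall r k, r * tau k = tau (lam r * k),
      forall r k, tau k * r = tau (k * rho r) &
      exists p N, [/\ p \in [pchar K], (0 < N)%N & forall z : K, z ^+ (p ^ N) = z]].
Proof.
pose M := MinIdeal core_ideal_min square_zero_comm.
pose K : fieldType := centroid M.
pose lam0 (r : R) : K := @to_centroid _ M _ (lm_bimodule r).
pose rho0 (r : R) : K := @to_centroid _ M _ (rm_bimodule r).
have lamE r (d : dT) : lam0 r *: d = lm r d by [].
have rhoE r (d : dT) : rho0 r *: d = rm d r by [].
have Keq (k l : K) : k *: c_ = l *: c_ -> k = l.
  by move=> klc; apply: centroid_eq => d; exact: (bimodule_map_eq (@cactP _ M k) (@cactP _ M l) klc).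
have lamB : zmod_morphism lam0.
  move=> a b; apply: Keq; rewrite scalerBl !lamE; apply/val_inj.
  by rewrite raddfB /= mulrBl.
have lamM : monoid_morphism lam0.
  split=> [|a b]; apply: Keq; first by rewrite scale1r lamE lm1.
  by rewrite -scalerA !lamE lmA.
have rhoB : zmod_morphism rho0.
  move=> a b; apply: Keq; rewrite scalerBl !rhoE; apply/val_inj.
  by rewrite raddfB /= mulrBr.
have rhoM : monoid_morphism rho0.
  split=> [|a b]; apply: Keq; first by rewrite scale1r rhoE rm1.
  by rewrite mulrC -scalerA !rhoE rmA.
pose lam : {rmorphism R -> K} := HB.pack lam0
  (GRing.isZmodMorphism.Build R K lam0 lamB) (GRing.isMonoidMorphism.Build R K lam0 lamM).
pose rho : {rmorphism R -> K} := HB.pack rho0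
  (GRing.isZmodMorphism.Build R K rho0 rhoB) (GRing.isMonoidMorphism.Build R K rho0 rhoM).
pose tau0 (k : K) : R := val (k *: c_).
have tauB : zmod_morphism tau0 by move=> k l; rewrite /tau0 scalerBl raddfB.
pose tau : {additive K -> R} := HB.pack tau0 (GRing.isZmodMorphism.Build K R tau0 tauB).
exists K, lam, rho, tau; split.
- by split=> [|k]; [rewrite /tau /= /tau0 scale1r|exact: ideal_typeP].
- by move=> k l /val_inj /Keq.
- by move=> r k; rewrite /tau /= /tau0 -scalerA lamE.
- by move=> r k; rewrite /tau /= /tau0 mulrC -scalerA rhoE.
have Kgen (k : K) : exists l, k = \sum_(rs <- l) lam rs.1 * rho rs.2.
  have [l kl] := inner_map_onto (k *: c_); exists l; apply: Keq.
  rewrite -kl scaler_suml; apply: eq_bigr => rs _.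
  by rewrite -scalerA lamE rhoE.
apply: (@fg_field_finite K [:: lam x; lam y; rho x; rho y]) => T [T1 TB TM] Txy z.
have T0 : T 0 by rewrite -(subrr 1); exact: TB.
have TD a b : T a -> T b -> T (a + b).
  move=> Ta Tb; rewrite -[b]opprK -[- b]sub0r; apply: (TB) => //.
  by apply: (TB).
have Tlam r : T (lam r).
  by apply: (ev2_ind gen (E := fun r => T (lam r))) => [|a b|a b||];
    rewrite ?rmorph1 ?rmorphB ?rmorphM; [|exact: TB|exact: TM|apply: Txy..];
    rewrite // !inE eqxx ?orbT.
have Trho r : T (rho r).
  by apply: (ev2_ind gen (E := fun r => T (rho r))) => [|a b|a b||];
    rewrite ?rmorph1 ?rmorphB ?rmorphM; [|exact: TB|exact: TM|apply: Txy..];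
    rewrite // !inE eqxx ?orbT.
have [l ->] := Kgen z; elim/big_ind: _ => // rs _; exact: TM.
Qed.

End SquareZero.
End Core.

(** * Upper triangular matrices *)

Section IntPolyEval.
Variables (R : nzRingType) (e : R).

Fact commr_intr : commr_rmorph (intr : int -> R) e.
Proof. by move=> z; exact: commr_int. Qed.

Definition polyev : {poly int} -> R := horner_morph commr_intr.

HB.instance Definition _ := GRing.RMorphism.copy polyev (horner_morph commr_intr).

Lemma polyevC z : polyev z%:P = z%:~R. Proof. exact: horner_morphC. Qed.
Lemma polyevX : polyev 'X = e. Proof. exact: horner_morphX. Qed.

Lemma polyev_MXD f z : polyev (f * 'X + z%:P) = polyev f * e + z%:~R.
Proof. by rewrite rmorphD rmorphM /= polyevX polyevC. Qed.

Lemma polyev_mull f h z : e * h = z%:~R * h -> polyev f * h = (f.[z])%:~R * h.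
Proof.
move=> eh; elim/poly_ind: f => [|f t IH]; first by rewrite rmorph0 horner0.
rewrite polyev_MXD mulrDl -mulrA eh mulrA (commr_int _ z) -mulrA IH mulrA -mulrDl.
by rewrite !hornerE mulrC -intrM -intrD.
Qed.

Lemma polyev_mulr f h z : h * e = h * z%:~R -> h * polyev f = h * (f.[z])%:~R.
Proof.
move=> eh; elim/poly_ind: f => [|f t IH]; first by rewrite rmorph0 horner0.
rewrite polyev_MXD mulrDr mulrA IH -mulrA -(commr_int e) mulrA eh -mulrA -mulrDr.
by rewrite !hornerE mulrC -intrM -intrD.
Qed.

Lemma polyev_comm f : e * polyev f = polyev f * e.
Proof.
have : polyev 'X * polyev f = polyev f * polyev 'X by rewrite -!rmorphM mulrC.
by rewrite polyevX.
Qed.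

End IntPolyEval.

Lemma polyev_rmorph (R R' : nzRingType) (h : {rmorphism R -> R'}) e f :
  h (polyev e f) = polyev (h e) f.
Proof.
elim/poly_ind: f => [|f t IH]; first by rewrite !rmorph0.
by rewrite !polyev_MXD rmorphD rmorphM rmorph_int IH.
Qed.

Lemma pchar_int_mul (R : nzRingType) (F : fieldType) (p : nat) (h : R) (z : int) :
  p \in [pchar F] -> h <> 0 -> p%:R * h = 0 -> z%:~R * h = 0 -> z%:~R = 0 :> F.
Proof.
move=> chp h0 ph zh; apply/eqP; rewrite -(dvdz_pcharf chp); apply: contrapT => npz.
apply: h0; have /coprimezP [[u v] /= uv] : coprimez p z.
  by rewrite coprimezE absz_nat prime_coprime ?(pcharf_prime chp) //; apply/negP.
rewrite -[h]mul1r -[1]/(1%:~R) -uv intrD !intrM mulrDl -!mulrA zh.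
by rewrite -pmulrn ph !mulr0 addr0.
Qed.

(** The elements f(e) + m h form a subring, and f(e) acts on [h] as f(0) from the left and as f(1)
    from the right. Sending f(e) + m h to the matrix with diagonal f(0), f(1) and corner m maps this
    subring onto U_p. *)
Lemma satisfies_U (R : nzRingType) (S : forall s : nat, freeRing s -> Prop)
    (p : nat) (e h : R) :
  satisfies R S -> prime p -> h <> 0 -> p%:R * h = 0 -> e * h = 0 -> h * e = h ->
  satisfies (U p) S.
Proof.
move=> hR pr_p h0 ph eh he.
have chp : p \in [pchar 'F_p] by exact: pchar_Fp.
have zF z : z%:~R * h = 0 -> z%:~R = 0 :> 'F_p by exact: (pchar_int_mul chp h0 ph).
have hh : h * h = 0 by rewrite -{1}he -mulrA eh mulr0.
have feh f : polyev e f * h = (f.[0])%:~R * h.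
  by apply: polyev_mull; rewrite eh mul0r.
have hfe f : h * polyev e f = h * (f.[1])%:~R.
  by apply: polyev_mulr; rewrite he mulr1.
pose E (a : R) (M : U p) := exists f m,
  [/\ a = polyev e f + m%:~R * h, val M 0 0 = (f.[0])%:~R,
      val M 1 1 = (f.[1])%:~R & val M 0 1 = m%:~R].
have M10 (M : U p) : val M 1 0 = 0 by exact/eqP/(valP M).
apply: (satisfies_rel (E := E)) hR.
- exists 1, 0; split; rewrite ?rmorph1 ?mul0r ?addr0 ?hornerE //=; by rewrite !mxE.
- move=> a b M N [f [m [-> M0 M1 M01]]] [g [k [-> N0 N1 N01]]].
  exists (f - g), (m - k); split; rewrite ?hornerE ?rmorphB /= ?mxE ?M0 ?M1 ?M01 ?N0 ?N1 ?N01 //.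
  by rewrite mulrBl addrACA opprD.
- move=> a b M N [f [m [-> M0 M1 M01]]] [g [k [-> N0 N1 N01]]].
  exists (f * g), (f.[0] * k + m * g.[1]).
  have E01 : lift ord0 ord0 = 1 :> 'I_2 by apply/val_inj.
  split; rewrite ?hornerE ?rmorphM ?rmorphD /= ?mxE ?big_ord_recl ?big_ord0 ?E01
    ?M10 ?M0 ?M1 ?M01 ?N0 ?N1 ?N01 ?mulr0 ?mul0r ?addr0 ?add0r ?rmorphM //.
  have t1 : polyev e f * (k%:~R * h) = (f.[0] * k)%:~R * h.
    by rewrite mulrA (commr_int _ k) -mulrA feh mulrA -intrM mulrC.
  have t2 : m%:~R * h * polyev e g = (m * g.[1])%:~R * h.
    by rewrite -mulrA hfe (commr_int h) mulrA -intrM.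
  have t3 : m%:~R * h * (k%:~R * h) = 0.
    by rewrite -mulrA [h * (_ * _)]mulrA (commr_int h) -mulrA hh !mulr0.
  by rewrite mulrDl !mulrDr t1 t2 t3 addr0 -addrA -mulrDl !intrM.
- move=> M; exists (polyev e ((val M 0 0 : nat)%:Z%:P +
    ((val M 1 1 : nat)%:Z - (val M 0 0 : nat)%:Z)%:P * 'X) + (val M 0 1 : nat)%:Z%:~R * h).
  have FpE (t : 'F_p) : (t : nat)%:Z%:~R = t by rewrite -pmulrn natr_Zp.
  eexists; eexists; split; first by [].
  + by rewrite !hornerE /= ?mulr0 ?addr0 FpE.
  + by rewrite !hornerE /= ?mulr1 addrAC subrr add0r FpE.
  + by rewrite FpE.
- move=> M [f [m [fm M0 M1 M01]]].
  (* The commutator with [e] removes the polynomial part and keeps [m * h]. *)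
  have mh : m%:~R * h = 0.
    have /(congr1 (fun a => a * e - e * a)) := esym fm.
    rewrite mul0r mulr0 subrr mulrDl mulrDr polyev_comm opprD addrACA subrr add0r.
    by rewrite -mulrA he mulrA (commr_int e) -mulrA eh mulr0 subr0.
  move: fm; rewrite mh addr0 => f0.
  apply/val_inj/matrixP => i j.
  have i01 (k : 'I_2) : k = 0 \/ k = 1 by case: k => [[|[|//]] ?]; [left|right]; apply/val_inj.
  rewrite (_ : val (0 : U p) i j = 0); last by rewrite raddf0 mxE.
  case: (i01 i) => ->; case: (i01 j) => ->; rewrite ?M10 ?M0 ?M1 ?M01 //.
  + by apply: zF; rewrite -feh -f0 mul0r.
  + exact: zF.
  + by apply: zF; rewrite -(commr_int h) -hfe -f0 mulr0.
Qed.

(** * Twisted matrices *)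

Lemma polyev_horner (K : fieldType) (t : K) f : polyev t f = (map_poly intr f).[t].
Proof. by []. Qed.

Section FrobeniusOrbit.
Variables (K : fieldType) (p : nat) (theta : K).
Hypotheses (chp : p \in [pchar K]) (pr_p : prime p).

(** The polynomial 'X^p - 'X already has the p residues of integers as roots and has no room for
    another one. *)
Lemma prime_subfield (k : K) : k ^+ p = k -> exists z : int, z%:~R = k.
Proof.
move=> kp; apply: contrapT => nz.
have P0 : 'X^p - 'X != 0 :> {poly K}.
  rewrite -size_poly_gt0 size_polyDl ?size_polyXn // size_polyN size_polyX.
  by rewrite ltnS prime_gt1.
have := max_poly_roots P0 (rs := k :: [seq i%:R | i <- iota 0 p]).
rewrite size_polyDl ?size_polyXn ?size_polyN ?size_polyX ?ltnS ?prime_gt1 //.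
rewrite /= size_map size_iota ltnn => nuniq; suff: false by []; apply: nuniq.
  apply/andP; split; first by rewrite rootE !hornerE kp subrr.
  apply/allP => _ /mapP[i _ ->]; rewrite rootE !hornerE.
  by rewrite -(pFrobenius_autE chp) pFrobenius_aut_nat subrr.
apply/andP; split.
  by apply/mapP => -[i _ ki]; apply: nz; exists i%:Z; rewrite -pmulrn.
rewrite map_inj_in_uniq ?iota_uniq // => i j; rewrite !mem_iota !add0n /= => ip jp.
wlog ij : i j ip jp / (i <= j)%N.
  by move=> h eij; case/orP: (leq_total i j) => ij; [exact: h|apply/esym/h].
move=> eij; apply/eqP; rewrite eqn_leq ij /= -subn_eq0; apply: contraTT isT.
rewrite -lt0n => ji0; have : (p %| j - i)%N.
  by rewrite (dvdn_pcharf chp) natrB // eij subrr.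
by move/(dvdn_leq ji0); rewrite leqNgt (leq_ltn_trans (leq_subr i j) jp).
Qed.

Lemma int_of_pfixed_poly (P : {poly K}) : (forall i, P`_i ^+ p = P`_i) ->
  exists f : {poly int}, map_poly intr f = P /\ (size f <= size P)%N.
Proof.
move=> Pp; have [z zP] := choice (fun i => prime_subfield (Pp i)).
exists (\poly_(i < size P) z i); split; last exact: size_poly.
apply/polyP => i; rewrite coef_map /= coef_poly; case: ltnP => [_|Pi]; first exact: zP.
by rewrite nth_default.
Qed.

Variable n : nat.
Hypotheses (n_gt0 : (0 < n)%N) (theta_n : theta ^+ (p ^ n) = theta).
Hypothesis n_min : forall m, (0 < m < n)%N -> theta ^+ (p ^ m) != theta.

Lemma frobenius_inj i : injective (fun t : K => t ^+ (p ^ i)).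
Proof.
elim: i => [|i IH] s t; first by rewrite expn0 !expr1.
rewrite !expnSr !exprM -!(pFrobenius_autE chp) => /(fmorph_inj (pFrobenius_aut chp)).
exact: IH.
Qed.

Lemma orbit_uniq : uniq [seq theta ^+ (p ^ i) | i <- iota 0 n].
Proof.
rewrite map_inj_in_uniq ?iota_uniq // => i j; rewrite !mem_iota !add0n /= => ip jp.
wlog ij : i j ip jp / (i <= j)%N.
  by move=> h eij; case/orP: (leq_total i j) => ij; [exact: h|apply/esym/h].
move=> eij; apply/eqP; rewrite eqn_leq ij /= -subn_eq0; apply: contraTT isT.
rewrite -lt0n => ji0; have /n_min/negP : (0 < j - i < n)%N.
  by rewrite ji0 (leq_ltn_trans (leq_subr i j)).
by case; apply/eqP/(@frobenius_inj i); rewrite -exprM -expnD subnK.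
Qed.

Lemma orbit_root (f : {poly int}) i : polyev theta f = 0 ->
  polyev (theta ^+ (p ^ i)) f = 0.
Proof.
move=> f0; elim: i => [|i IH]; first by rewrite expn0 expr1.
rewrite expnSr exprM -[X in polyev X](pFrobenius_autE chp) -polyev_rmorph IH.
exact: rmorph0.
Qed.

(** Modulo p such an [f] has the n distinct conjugates of [theta] as roots, more than its degree
    allows. *)
Lemma small_root_pdvd (f : {poly int}) : (size f <= n)%N -> polyev theta f = 0 ->
  forall i, (p %| f`_i)%Z.
Proof.
move=> fn f0 i; rewrite (dvdz_pcharf chp) -[X in X == _](coef_map (intr : int -> K)).
suff -> : map_poly (intr : int -> K) f = 0 by rewrite coef0.
apply: contrapT => /eqP fn0.
have := max_poly_roots fn0 (rs := [seq theta ^+ (p ^ i) | i <- iota 0 n]).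
rewrite size_map size_iota => /(_ _ orbit_uniq) h.
have: (n < size (map_poly (intr : int -> K) f))%N.
  by apply: h; apply/allP => _ /mapP[j _ ->]; rewrite rootE -polyev_horner orbit_root.
by rewrite ltnNge (leq_trans (size_poly _ _)).
Qed.

(** The product over the Frobenius orbit is fixed by Frobenius, so its coefficients lie in the prime
    field and lift to integers. *)
Lemma orbit_poly : exists psi : {poly int},
  [/\ psi \is monic, size psi = n.+1 &
      map_poly intr psi = \prod_(i < n) ('X - (theta ^+ (p ^ i))%:P)].
Proof.
pose Psi : {poly K} := \prod_(i < n) ('X - (theta ^+ (p ^ i))%:P).
have monPsi : Psi \is monic by apply: monic_prod => i _; exact: monicXsubC.
have sPsi : size Psi = n.+1.
  by rewrite /Psi -big_enum size_prod_XsubC -cardE card_ord.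
have fixPsi : map_poly (pFrobenius_aut chp) Psi = Psi.
  rewrite rmorph_prod /Psi; move: theta_n; case: (n) n_gt0 => // m _ theta_m.
  rewrite big_ord_recr big_ord_recl /= mulrC; congr (_ * _).
    by rewrite map_polyXsubC /= pFrobenius_autE -exprM -expnSr theta_m expn0 expr1.
  apply: eq_bigr => i _; rewrite map_polyXsubC /= pFrobenius_autE -exprM -expnSr.
  by [].
have [i|f [fPsi sf]] := int_of_pfixed_poly (P := Psi).
  by rewrite -{2}fixPsi coef_map /= pFrobenius_autE.
(* The leading coefficient of the lift [f] is known only modulo p; it is replaced by 1 to make
   division over the integers possible. *)
pose psi := 'X^n + take_poly n f.
have mpsi : map_poly intr psi = Psi.
  apply/polyP => i; rewrite coef_map coefD coefXn coef_take_poly /=.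
  rewrite -fPsi coef_map /= intrD.
  have [->|ni] := eqVneq i n.
    rewrite ltnn addr0 -(coef_map intr) fPsi.
    by have := monPsi; rewrite monicE lead_coefE sPsi => /eqP ->.
  case: ltnP => [_|ni']; first by rewrite add0r.
  rewrite addr0 nth_default // (leq_trans sf) // sPsi.
  by rewrite ltn_neqAle eq_sym ni.
have spsi : size psi = n.+1.
  rewrite /psi size_polyDl size_polyXn // ltnS; exact: size_take_poly.
exists psi; split=> //.
rewrite monicE lead_coefE spsi coefD coefXn eqxx coef_take_poly ltnn addr0.
by [].
Qed.

End FrobeniusOrbit.

(** This identifies the subfield generated by [theta] with a standard finite field: [g] satisfies
    the same integer polynomials as [theta]. The element [eta] is a root of the minimal polynomial
    of [theta], hence one of its Frobenius conjugates. *)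
Lemma finite_subfield_model (K : fieldType) (p : nat) (theta eta : K)
    (pr_p : prime p) : p \in [pchar K] ->
  (exists2 N, (0 < N)%N & theta ^+ (p ^ N) = theta) ->
  (forall f : {poly int}, polyev theta f = 0 -> polyev eta f = 0) ->
  exists (n : nat) (n_gt0 : (0 < n)%N) (i : nat) (g : GF pr_p n_gt0),
  [/\ (i < n)%N, eta = theta ^+ (p ^ i),
      forall f : {poly int}, polyev g f = 0 <-> polyev theta f = 0 &
      forall u, exists f : {poly int}, u = polyev g f].
Proof.
move=> chp [N N0 thetaN] ker_eta.
have exn : exists n, (0 < n)%N && (theta ^+ (p ^ n) == theta).
  by exists N; rewrite N0 thetaN eqxx.
case: (ex_minnP exn) => n /andP[n_gt0 /eqP theta_n] minn.
have n_min m : (0 < m < n)%N -> theta ^+ (p ^ m) != theta.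
  move=> /andP[m0 mn]; apply/negP => thm.
  by have := minn m; rewrite m0 thm leqNgt mn => /(_ isT).
have [psi [mon_psi s_psi psiK]] := orbit_poly chp pr_p n_gt0 theta_n.
pose F := GF pr_p n_gt0; have chF : p \in [pchar F] by exact: GF_pchar.
have pdvd_F (f : {poly int}) : (forall i, (p %| f`_i)%Z) -> map_poly (intr : int -> F) f = 0.
  move=> pf; apply/polyP => i; rewrite coef_map coef0; apply/eqP.
  by rewrite -(dvdz_pcharf chF).
pose qo (f : {poly int}) := Pdiv.Ring.rdivp f psi.
pose re (f : {poly int}) := Pdiv.Ring.rmodp f psi.
have divE f : f = qo f * psi + re f := Pdiv.RingMonic.rdivp_eq mon_psi f.
have s_re f : (size (re f) <= n)%N.
  by rewrite -ltnS -s_psi Pdiv.Ring.ltn_rmodp monic_neq0.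
have psi_theta : polyev theta psi = 0.
  rewrite polyev_horner psiK (bigD1 (Ordinal n_gt0)) //= expn0 expr1.
  by rewrite hornerM hornerXsubC subrr mul0r.
have re0 f : polyev theta f = 0 -> forall i, (p %| (re f)`_i)%Z.
  move=> f0; apply: (small_root_pdvd chp n_min) => //.
  by move: f0; rewrite {1}(divE f) rmorphD rmorphM /= psi_theta mulr0 add0r.
have pn_gt1 : (1 < p ^ n)%N by rewrite -(exp1n n) ltn_exp2r ?prime_gt1.
(* Modulo p, [psi] divides 'X^(p^n) - 'X. If it had no root, all p^n elements of [F] would be roots
   of the quotient, whose degree is only p^n - n. *)
have [g psi_g] : exists g : F, polyev g psi = 0.
  apply: contrapT => noroot.
  pose f : {poly int} := 'X^(p ^ n) - 'X.
  have f0 : polyev theta f = 0.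
    by rewrite rmorphB rmorphXn /= polyevX theta_n subrr.
  have s_f : size f = (p ^ n).+1.
    by rewrite size_polyDl ?size_polyXn // size_polyN size_polyX ltnS.
  have fF : map_poly (intr : int -> F) f =
      map_poly intr (qo f) * map_poly intr psi.
    by rewrite {1}(divE f) rmorphD rmorphM /= (pdvd_F (re f)) ?addr0 //; exact: re0.
  have s_fF : size (map_poly (intr : int -> F) f) = (p ^ n).+1.
    rewrite rmorphB rmorphXn /= map_polyX size_polyDl ?size_polyXn //.
    by rewrite size_polyN size_polyX ltnS.
  have q0 : map_poly (intr : int -> F) (qo f) != 0.
    by apply/eqP => q0; move: s_fF; rewrite fF q0 mul0r size_poly0.
  have s_psiF : size (map_poly (intr : int -> F) psi) = n.+1.
    rewrite size_map_poly_id0 // (monicP mon_psi) rmorph1; exact: oner_neq0.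
  have := max_poly_roots q0 (rs := enum F).
  rewrite enum_uniq -cardE card_GF => /(_ _ isT) h.
  have : (p ^ n < size (map_poly (intr : int -> F) (qo f)))%N.
    apply: h; apply/allP => a _; have : polyev a f = 0.
      by rewrite rmorphB rmorphXn /= polyevX -(card_GF pr_p n_gt0) expf_card subrr.
    rewrite polyev_horner fF hornerM => /eqP; rewrite mulf_eq0 => /orP[//|/eqP pa].
    by case: noroot; exists a.
  have psiF0 : map_poly (intr : int -> F) psi != 0 by rewrite -size_poly_gt0 s_psiF.
  have := s_fF; rewrite fF size_mul // s_psiF addnS /=.
  move=> e; rewrite -e -{2}[size (map_poly _ (qo f))]addn0 leq_add2l leqNgt n_gt0.
  by [].
have g_ker f : polyev theta f = 0 -> polyev g f = 0.
  move=> f0; rewrite (divE f) rmorphD rmorphM /= psi_g mulr0 add0r.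
  by rewrite polyev_horner pdvd_F ?horner0 //; exact: re0.
(* If f(theta) were not 0, then [f ^+ (p ^ N).-1 - 1] would vanish at [theta], hence at [g], where
   its value is -1. *)
have theta_ker f : polyev g f = 0 -> polyev theta f = 0.
  move=> gf; apply: contrapT => /eqP tf.
  pose h := f ^+ (p ^ N) - f.
  pose h1 := f ^+ (p ^ N).-1 - 1.
  have pN : (p ^ N)%N = (p ^ N).-1.+1 by rewrite prednK // expn_gt0 prime_gt0.
  have frob : polyev theta f ^+ (p ^ N) = polyev theta f.
    elim/poly_ind: (f) => [|q z IH]; first by rewrite rmorph0 expr0n pN.
    rewrite polyev_MXD exprDn_pchar ?pchar_pnat // exprMn IH thetaN.
    congr (_ + _); elim: (N) => [|M IHM]; first by rewrite expr1.
    by rewrite expnSr exprM IHM -(pFrobenius_autE chp) rmorph_int.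
  have : polyev g h1 = 0.
    apply: g_ker; rewrite rmorphB rmorphXn rmorph1 /=; apply: (mulfI tf).
    by rewrite mulr0 mulrBr mulr1 -exprS -pN frob subrr.
  rewrite rmorphB rmorphXn rmorph1 /= gf expr0n.
  have -> : ((p ^ N).-1 == 0)%N = false.
    have := ltn_exp2l 0 N (prime_gt1 pr_p); rewrite N0 expn0 pN ltnS.
    by case: (_.-1).
  by rewrite sub0r => /eqP; rewrite oppr_eq0 oner_eq0.
have eta_root : \prod_(i < n) (eta - theta ^+ (p ^ i)) = 0.
  have := ker_eta _ psi_theta; rewrite polyev_horner psiK horner_prod => <-.
  by apply: eq_bigr => i _; rewrite hornerXsubC.
have /prodf_eq0 [i _] : \prod_(i < n) (eta - theta ^+ (p ^ i)) == 0 by apply/eqP.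
rewrite subr_eq0 => /eqP etaE.
exists n, n_gt0, i, g; split=> // [f|u]; first by split; [exact: theta_ker|exact: g_ker].
(* The p^n polynomials of degree below n with coefficients in 0..p-1 take distinct values at [g], so
   they exhaust [F] by counting. *)
pose ph (t : {ffun 'I_n -> 'F_p}) : F := polyev g (\poly_(j < n) odflt 0 (omap (fun j' => (t j' : nat)%:Z) (insub j))).
have ph_inj : injective ph.
  move=> s t /eqP; rewrite -subr_eq0 -rmorphB /= => /eqP/theta_ker st.
  apply/ffunP => j.
  have := small_root_pdvd chp n_min _ st j; rewrite coefB !coef_poly ltn_ord.
  rewrite insubT //= ?ltn_ord // => jn; rewrite (_ : Sub _ _ = j); last exact/val_inj.
  have -> : (size (\poly_(j0 < n) odflt 0 (omap (fun j' => (s j' : nat)%:Z) (insub j0)) -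
    \poly_(j0 < n) odflt 0 (omap (fun j' => (t j' : nat)%:Z) (insub j0)))%R <= n)%N = true.
    by rewrite (leq_trans (size_polyD _ _)) // geq_max size_polyN !size_poly.
  move=> /(_ isT); rewrite (dvdz_pcharf (pchar_Fp pr_p)) rmorphB /= -!pmulrn !natr_Zp.
  by rewrite subr_eq0 => /eqP.
have [|h _ hK] := inj_card_bij ph_inj.
  by rewrite card_GF card_ffun card_Fp // card_ord.
by rewrite -(hK u); eexists.
Qed.

(** The elements f(r) + tau(k(rho r)) form a subring that maps onto B_{p,n,i}: [g] replaces [rho r],
    and [lam r] is the i-th Frobenius power of [rho r]. The index [i] is positive because [lam r]
    and [rho r] differ. *)
Lemma satisfies_B (R : nzRingType) (S : forall s : nat, freeRing s -> Prop)
    (K : fieldType) (lam rho : {rmorphism R -> K}) (tau : {additive K -> R})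
    (p N : nat) (pr_p : prime p) (r : R) :
  satisfies R S -> p \in [pchar K] -> (0 < N)%N -> (forall z : K, z ^+ (p ^ N) = z) ->
  injective tau -> (forall a k, a * tau k = tau (lam a * k)) ->
  (forall a k, tau k * a = tau (k * rho a)) -> (forall k l, tau k * tau l = 0) ->
  (forall a, rho a = 0 -> lam a = 0) -> lam r != rho r ->
  exists (n i : nat) (n_gt1 : (1 < n)%N),
    (0 < i <= n - 1)%N /\ satisfies (B pr_p n_gt1 i) S.
Proof.
move=> hR chp N0 zN tau_inj tau_l tau_r tau2 ker_le lam_rho.
have [||n [n_gt0 [i [g [i_n lamE g_ker g_onto]]]]] :=
    @finite_subfield_model K p (rho r) (lam r) pr_p chp.
- by exists N.
- by move=> f; rewrite -!polyev_rmorph; exact: ker_le.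
have i_gt0 : (0 < i)%N.
  by rewrite lt0n; apply: contraNneq lam_rho => i0; rewrite lamE i0 expn0 expr1.
have n_gt1 : (1 < n)%N by exact: leq_ltn_trans i_n.
exists n, i, n_gt1; split.
  by rewrite i_gt0 subn1 -ltnS prednK.
rewrite (bool_irrelevance n_gt0 (ltnW n_gt1)) in g g_ker g_onto *.
pose th := rho r.
pose E (a : R) (M : B pr_p n_gt1 i) := exists f k : {poly int},
  [/\ a = polyev r f + tau (polyev th k), val M 1 1 = polyev g f &
      val M 0 1 = polyev g k].
have M10 (M : B pr_p n_gt1 i) : val M 1 0 = 0 by case/andP: (valP M) => /eqP.
have M00 (M : B pr_p n_gt1 i) : val M 0 0 = val M 1 1 ^+ (p ^ i).
  by case/andP: (valP M) => _ /eqP.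
have lam_f f : lam (polyev r f) = polyev th f ^+ (p ^ i).
  rewrite polyev_rmorph lamE -/th.
  elim/poly_ind: f => [|q z IH]; first by rewrite !rmorph0 expr0n expn_eq0 -leqn0 leqNgt prime_gt0.
  rewrite !polyev_MXD exprDn_pchar ?pchar_pnat // exprMn IH.
  congr (_ + _); elim: (i) => [|M IHM]; first by rewrite expr1.
  by rewrite expnSr exprM -IHM -(pFrobenius_autE chp) rmorph_int.
apply: (satisfies_rel (E := E)) hR.
- exists 1, 0; split; rewrite ?rmorph1 ?rmorph0 ?raddf0 ?addr0 //=; by rewrite !mxE.
- move=> a b M M' [f [k [-> M1 M01]]] [f' [k' [-> M1' M01']]].
  exists (f - f'), (k - k'); split; rewrite ?rmorphB /= ?mxE ?M1 ?M01 ?M1' ?M01' //.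
  by rewrite raddfB addrACA opprD.
- move=> a b M M' [f [k [-> M1 M01]]] [f' [k' [-> M1' M01']]].
  exists (f * f'), (f ^+ (p ^ i) * k' + k * f').
  have E01 : lift ord0 ord0 = 1 :> 'I_2 by apply/val_inj.
  split; rewrite ?rmorphD ?rmorphM ?rmorphXn /= ?mxE ?big_ord_recl ?big_ord0 ?E01
    ?M10 ?M00 ?M1 ?M01 ?M1' ?M01' ?mulr0 ?mul0r ?addr0 ?add0r //.
  rewrite mulrDl !mulrDr tau_l tau_r tau2 addr0 lam_f polyev_rmorph -/th.
  by rewrite raddfD addrA.
- move=> M; have [f fM] := g_onto (val M 1 1); have [k kM] := g_onto (val M 0 1).
  by exists (polyev r f + tau (polyev th k)), f, k.
- move=> M [f [k [fk M1 M01]]].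
  have k0 : polyev th k = 0.
    (* The commutator with [r] kills the polynomial part and multiplies the argument of [tau] by the
       nonzero scalar [lam r - rho r]. *)
    have /(congr1 (fun a => r * a - a * r)) := esym fk.
    rewrite mul0r mulr0 subrr mulrDl mulrDr polyev_comm opprD addrACA subrr add0r.
    rewrite tau_l tau_r -raddfB mulrC -mulrBr -[RHS](raddf0 tau) => /tau_inj /eqP.
    by rewrite mulf_eq0 subr_eq0 (negPf lam_rho) orbF => /eqP.
  have f0 : polyev th f = 0.
    by rewrite /th -polyev_rmorph; move: fk; rewrite k0 raddf0 addr0 => <-; rewrite rmorph0.
  have {}M01 : val M 0 1 = 0 by rewrite M01; apply/g_ker.
  have {}M1 : val M 1 1 = 0 by rewrite M1; apply/g_ker.
  apply/val_inj/matrixP => a b.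
  rewrite (_ : val (0 : B pr_p n_gt1 i) a b = 0); last by rewrite raddf0 mxE.
  have i01 (j : 'I_2) : j = 0 \/ j = 1 by case: j => [[|[|//]] ?]; [left|right]; apply/val_inj.
  case: (i01 a) => ->; case: (i01 b) => ->; rewrite ?M10 ?M00 ?M1 ?M01 //.
  by rewrite expr0n expn_eq0 -leqn0 leqNgt prime_gt0.
Qed.

(** * Central smallest ideal *)

Lemma intr_mulACA (R : nzRingType) (z z' : int) (u v : R) :
  z%:~R * u * (z'%:~R * v) = (z * z')%:~R * (u * v).
Proof. by rewrite intrM -!mulrA; congr (_ * _); rewrite mulrA commr_int -mulrA. Qed.

Section WeightedLists.
Variable p : nat.

(* p, X and Y have weight 1. *)
Definition weight_ge (n : nat) (P : freeXY) : Prop :=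
  exists2 l, P = lsum varX varY l &
    forall zw, zw \in l -> ((p ^ (n - size zw.2))%N %| zw.1)%Z.

Lemma weight_ge0 P : weight_ge 0 P.
Proof.
have [l ->] := freeXY_lsum P; exists l => // zw _; exact: dvd1z.
Qed.

Lemma weight_geD n P Q : weight_ge n P -> weight_ge n Q -> weight_ge n (P + Q).
Proof.
move=> [l -> hl] [m -> hm]; exists (l ++ m); first by rewrite lsum_cat.
by move=> zw; rewrite mem_cat => /orP[/hl|/hm].
Qed.

Lemma weight_geM m n P Q :
  weight_ge m P -> weight_ge n Q -> weight_ge (m + n) (P * Q).
Proof.
move=> [l -> hl] [k -> hk].
exists [seq (zw.1 * zv.1, zw.2 ++ zv.2) | zw <- l, zv <- k].
  rewrite /lsum mulr_suml big_allpairs_dep; apply: eq_bigr => zw _.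
  rewrite mulr_sumr; apply: eq_bigr => zv _ /=.
  by rewrite intr_mulACA wev_cat.
move=> _ /allpairsP[[zw zv] [/= /hl zl /hk zk ->]] /=.
apply: dvdz_trans (dvdz_mul zl zk); rewrite -PoszM -expnD.
rewrite dvdzE !absz_nat dvdn_exp2l // size_cat.
by move: (size zw.2) (size zv.2) => i j; clear; lia.
Qed.

Lemma weight_ge_mulr n P Q : weight_ge n P -> weight_ge n (P * Q).
Proof. by move=> hP; rewrite -[n]addn0; apply: weight_geM => //; exact: weight_ge0. Qed.

Lemma weight_ge_mull n P Q : weight_ge n Q -> weight_ge n (P * Q).
Proof. by move=> hQ; rewrite -[n]add0n; apply: weight_geM => //; exact: weight_ge0. Qed.

Lemma weight_ge_zero n : weight_ge n 0.
Proof. by exists [::]; rewrite ?lsum_nil. Qed.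

Lemma pxy_weight P : pxy p P -> weight_ge 1 P.
Proof.
elim=> [Q [->|->|->]||Q T _ hQ _ hT|Q T _ hT|Q T _ hQ].
- exists [:: (p%:Z, [::])]; first by rewrite lsum_cons lsum_nil addr0 wev_nil mulr1 -pmulrn.
  by move=> zw; rewrite inE => /eqP -> /=; rewrite subn0 expn1 dvdzz.
- exists [:: (1, [:: false])].
    by rewrite lsum_cons lsum_nil addr0 wev_cons wev_nil mulr1 mul1r.
  by move=> zw; rewrite inE => /eqP -> /=; rewrite subnn expn0 dvd1z.
- exists [:: (1, [:: true])].
    by rewrite lsum_cons lsum_nil addr0 wev_cons wev_nil mulr1 mul1r.
  by move=> zw; rewrite inE => /eqP -> /=; rewrite subnn expn0 dvd1z.
- exact: weight_ge_zero.
- exact: weight_geD.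
- exact: weight_ge_mull.
- exact: weight_ge_mulr.
Qed.

Lemma idealJ_weight n P : idealJ p n P -> weight_ge n P.
Proof.
elim: n P => [|n IH] P; first by move=> _; exact: weight_ge0.
elim=> [Q T /pxy_weight hQ /IH hT||Q T _ hQ _ hT|Q _ hQ].
- by rewrite -add1n; exact: weight_geM.
- exact: weight_ge_zero.
- exact: weight_geD.
- by rewrite -mulN1r; exact: weight_ge_mull.
Qed.

End WeightedLists.

Section CentralCommutator.
Variables (R : nzRingType) (a b : R) (p : nat).
Local Notation c := (comm a b).
Hypotheses (pr_p : prime p) (c_neq0 : c <> 0) (pc : p%:R * c = 0).
Hypotheses (ac : a * c = 0) (ca : c * a = 0) (bc : b * c = 0) (cb : c * b = 0).

Let xs w := count negb w.
Let ys w := count id w.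

Lemma ba_expand : b * a = a * b - c.
Proof. by rewrite /comm opprB addrC subrK. Qed.

Lemma aba i : a * (b * a ^+ i) = a * (a ^+ i * b).
Proof.
elim: i => [|i IH]; first by rewrite mulr1 mul1r.
rewrite exprS [b * _]mulrA ba_expand mulrBl mulrBr [a * (c * _)]mulrA ac mul0r subr0.
by rewrite -!mulrA IH !mulrA.
Qed.

Lemma bab i : b * a ^+ i * b = a ^+ i * b * b.
Proof.
elim: i => [|i IH]; first by rewrite mulr1 mul1r.
have cab : c * a ^+ i * b = 0.
  by case: i {IH} => [|i]; [rewrite mulr1 cb|rewrite exprS mulrA ca !mul0r].
rewrite exprS [b * _]mulrA ba_expand mulrBl mulrBl cab subr0 -!mulrA.
by congr (_ * _); rewrite !mulrA.
Qed.

Lemma b_monomial i j : (1 < i + j)%N -> b * (a ^+ i * b ^+ j) = a ^+ i * b ^+ j.+1.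
Proof.
case: j => [|j] ij; last first.
  have -> : b * (a ^+ i * b ^+ j.+1) = b * a ^+ i * b * b ^+ j by rewrite exprS !mulrA.
  by rewrite bab -!mulrA; congr (_ * _); rewrite !exprS.
case: i ij => [|[|i]] // _; rewrite mulr1 expr1 exprS mulrA ba_expand mulrBl.
by rewrite exprS [c * _]mulrA ca mul0r subr0 -exprS -!mulrA aba.
Qed.

(** Exchanging two neighbours changes a word by one in which they are replaced by [c] or its
    opposite. In a word of length at least 3 another letter stands next to [c] and kills it. *)
Lemma word_normal_form w : (2 < size w)%N -> wev a b w = a ^+ xs w * b ^+ ys w.
Proof.
have [n] := ubnP (size w); elim: n w => // n IH [|t w] //=; rewrite ltnS => sn sw.
have xy : (xs w + ys w)%N = size w by rewrite addnC; elim: (w) => //= -[] v; rewrite /xs /ys /= => <-; lia.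
have tw : wev a b (t :: w) = (if t then b else a) * (a ^+ xs w * b ^+ ys w).
  rewrite wev_cons; have [sw2|] := ltnP 2 (size w); first by rewrite (IH w sn sw2).
  move=> {}sw2; have {sw sw2} : size w = 2 by apply/eqP; rewrite eqn_leq sw2 -ltnS.
  case: w sn xy => [|t1 [|t2 []]] // _ _ _; rewrite !wev_cons wev_nil mulr1.
  case: t1; case: t2; rewrite /= ?expr0 ?mul1r ?mulr1 ?expr1 ?expr2 //.
  by rewrite ba_expand mulrBr; case: t; rewrite ?ac ?bc subr0.
rewrite tw; case: t {tw}; rewrite ?add0n ?add1n; last by rewrite mulrA -exprS.
by rewrite b_monomial // xy.
Qed.

Lemma int_mul_c z : (p %| z)%Z -> z%:~R * c = 0.
Proof. by move=> /dvdzP[q ->]; rewrite intrM -mulrA -pmulrn pc mulr0. Qed.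

Lemma weighted_normal_form n (l : seq (int * seq bool)) : (2 < n)%N ->
  (forall zw, zw \in l -> ((p ^ (n - size zw.2))%N %| zw.1)%Z) ->
  lsum a b l = \sum_(zw <- l) zw.1%:~R * (a ^+ xs zw.2 * b ^+ ys zw.2).
Proof.
move=> n3 hl; apply: eq_big_seq => -[z w] /hl /= zw.
have [/word_normal_form -> //|sw] := ltnP 2 (size w).
(* In a short word the missing weight is made up by powers of p, and p kills the [c] produced by
   reordering. *)
have pz : (p %| z)%Z.
  by apply: dvdz_trans zw; rewrite dvdzE !absz_nat dvdn_exp // subn_gt0 (leq_ltn_trans sw).
case: w sw {zw} => [|t [|t' [|//]]] _.
- by rewrite wev_nil /xs /ys /= !expr0 mulr1.
- by rewrite wev_cons wev_nil mulr1 /xs /ys; case: t; rewrite /= ?mul1r ?mulr1.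
- rewrite !wev_cons wev_nil mulr1 /xs /ys.
  case: t; case: t' => /=; rewrite ?mul1r ?mulr1 ?expr2 //.
  by rewrite ba_expand mulrBr int_mul_c // subr0.
Qed.

Let cc (u : R) := u * a = a * u /\ u * b = b * u.

(* In a commutative ring: z vanishes in the localisation at 1 + Ann(c). *)
Definition away_from_c (z : R) :=
  (forall u, cc u -> u * z = z * u) /\
  exists u, [/\ cc u, u * c = c & u * z = 0].

Lemma away_from_c0 : away_from_c 0.
Proof.
split=> [u _|]; first by rewrite mulr0 mul0r.
by exists 1; split; rewrite ?mulr0 ?mul1r //; split; rewrite mul1r mulr1.
Qed.

Lemma ccM u v : cc u -> cc v -> cc (u * v).
Proof.
move=> [ua ub] [va vb]; split; first by rewrite -mulrA va mulrA ua mulrA.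
by rewrite -mulrA vb mulrA ub mulrA.
Qed.

Lemma away_from_cD z t : away_from_c z -> away_from_c t -> away_from_c (z + t).
Proof.
move=> [zcc [u [ccu uc uz]]] [tcc [v [ccv vc vt]]]; split.
  by move=> w ccw; rewrite mulrDr mulrDl zcc ?tcc.
exists (u * v); split; first exact: ccM.
  by rewrite -mulrA vc uc.
by rewrite mulrDr -[X in _ + X]mulrA vt mulr0 addr0 -mulrA (zcc v ccv) mulrA uz mul0r.
Qed.

Lemma away_from_c_comm : ~ away_from_c c.
Proof. by move=> [_ [u [_ uc]]]; rewrite uc. Qed.

Lemma cc_int z : cc z%:~R.
Proof. by split; rewrite commr_int. Qed.

Lemma cc_exp u i : cc u -> cc (u ^+ i).
Proof.
move=> ccu; elim: i => [|i IH]; first exact: (cc_int 1).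
by rewrite exprS; exact: ccM.
Qed.

Lemma cc_polyev s (f : {poly int}) : cc s -> cc (polyev s f).
Proof.
move=> ccs; elim/poly_ind: f => [|q z [IHa IHb]].
  by rewrite rmorph0; exact: (cc_int 0).
have [qsa qsb] := ccM (conj IHa IHb) ccs; have [za zb] := cc_int z.
by rewrite polyev_MXD; split; rewrite mulrDl mulrDr ?qsa ?qsb ?za ?zb.
Qed.

(** Moving [a] past [b] costs a [c], which the second factor [a] annihilates. *)
Lemma cc_a2 : cc (a ^+ 2).
Proof.
split; first by rewrite -exprS -exprSr.
rewrite expr2 -mulrA; have ab : a * b = b * a + c by rewrite ba_expand subrK.
by rewrite ab mulrDr ac addr0 mulrA ab mulrDl ca addr0 -mulrA.
Qed.

Lemma cc_b2 : cc (b ^+ 2).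
Proof.
split; last by rewrite -exprS -exprSr.
rewrite expr2 -[b * b * a]mulrA.
rewrite ba_expand mulrBr bc subr0 [b * (a * b)]mulrA ba_expand mulrBl cb subr0.
by rewrite -mulrA.
Qed.

(** This replaces the Krull intersection argument. Let m be the first index whose coefficient is
    prime to p and write f = p v + d X^m. With y = d(s) s^m the identity gives p^j y = - p p^j v(s),
    so p^j y^k is a multiple of p^k, which [L] kills. On [c] the factor L d(s)^k acts as an integer
    prime to p, and it can be normalized to act as 1. *)
Lemma power_away (f : {poly int}) (j k : nat) (L : int) :
  (forall r : R, polyev r ((p ^ j)%N%:Z *: f) = 0) ->
  (exists i, ~~ (p %| f`_i)%Z) -> ~~ (p %| L)%Z -> (p ^ k)%N%:~R * L%:~R = 0 :> R ->
  exists m, forall s, cc s -> s * c = 0 ->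
    exists u, [/\ cc u, u * c = c & u * ((p ^ j)%N%:~R * s ^+ m) = 0].
Proof.
move=> f_id exf pL pkL; have [m pfm minm] := ex_minnP exf.
exists (m * k)%N => s ccs sc.
have lowdvd i : (i < m)%N -> (p %| f`_i)%Z.
  by move=> im; apply: contraLR im => /minm; rewrite -leqNgt.
have [v vE] : exists v : {poly int}, take_poly m f = p%:Z *: v.
  exists (\poly_(i < m) (f`_i %/ p)%Z); apply/polyP => i.
  rewrite coefZ !coef_poly; case: ifP => [/lowdvd pf|_]; last by rewrite mulr0.
  by rewrite mulrC divzK.
pose d := drop_poly m f.
have fE : f = p%:Z *: v + d * 'X^m by rewrite -vE poly_take_drop.
pose y := polyev s d * s ^+ m.
pose P := (p ^ j)%N%:~R : R.
have evZ z (q : {poly int}) : polyev s (z *: q) = z%:~R * polyev s q.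
  by rewrite -mul_polyC rmorphM /= polyevC.
have yE : y = polyev s (d * 'X^m) by rewrite rmorphM rmorphXn /= polyevX.
have Py : P * y = - (p%:~R * (P * polyev s v)).
  apply/eqP; rewrite -addr_eq0 addrC; apply/eqP; rewrite -[RHS](f_id s) evZ fE.
  rewrite rmorphD /= evZ -yE mulrDr -/P.
  by congr (_ + _); rewrite !mulrA; congr (_ * _); exact/esym/commr_int.
have yv : y * polyev s v = polyev s v * y.
  by rewrite yE -!rmorphM mulrC.
have Pyt t : P * y ^+ t = (p ^ t)%N%:~R * (P * (- polyev s v) ^+ t).
  elim: t => [|t IH]; first by rewrite expn0 !expr0 mul1r.
  rewrite exprSr mulrA IH -!mulrA.
  have comm_vy : (- polyev s v) ^+ t * y = y * (- polyev s v) ^+ t.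
    by apply/commr_sym/commrX; rewrite /GRing.comm mulrN mulNr yv.
  rewrite comm_vy [P * (y * _)]mulrA Py expnSr PoszM intrM -!mulrA; congr (_ * _).
  by rewrite mulNr -!mulrA exprS mulNr !mulrN.
have Lk : L%:~R * (P * y ^+ k) = 0.
  by rewrite Pyt mulrA (commr_int L%:~R) pkL mul0r.
(* The integer by which [L * d(s)^k] acts on [c], as [s] kills [c]. The Bezout coefficient [t]
   inverts it modulo p. *)
pose e := L * d`_0 ^+ k.
have d0 : d`_0 = f`_m by rewrite /d coef_drop_poly ?add0n ?addn0.
have pe : ~~ (p %| e)%Z.
  move: pL pfm; rewrite !dvdzE /e d0 abszM abszX !absz_nat => pL pfm.
  by rewrite Euclid_dvdM // Euclid_dvdX // negb_or negb_and pL pfm.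
have [[z t] /= zt] : {zt | zt.1 * p%:Z + zt.2 * e = 1}.
  have /coprimezP : coprimez p e by rewrite coprimezE absz_nat prime_coprime.
  by move=> /cid [zt ztE]; exists zt.
have dsc : polyev s d * c = (d`_0)%:~R * c.
  by rewrite -horner_coef0; apply: polyev_mull; rewrite sc mul0r.
have dskc i : polyev s d ^+ i * c = (d`_0 ^+ i)%:~R * c.
  elim: i => [|i IH]; first by rewrite !expr0 !mul1r.
  by rewrite exprSr -mulrA dsc mulrA (commr_int _ d`_0) -mulrA IH mulrA -intrM -exprS.
have ccd := cc_polyev d ccs.
exists (t%:~R * (L%:~R * polyev s d ^+ k)); split.
- by apply: ccM (cc_int t) _; apply: ccM (cc_int L) _; exact: cc_exp.
- rewrite -!mulrA dskc [L%:~R * _]mulrA -intrM mulrA -intrM -/e.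
  have -> : t * e = 1 - z * p%:Z by rewrite -zt addrAC subrr add0r.
  by rewrite intrB mulrBl mul1r intrM -mulrA -pmulrn pc mulr0 subr0.
- rewrite -!mulrA; have -> : L%:~R * (polyev s d ^+ k * (P * s ^+ (m * k))) = 0.
    rewrite -[RHS]Lk; congr (_ * _); rewrite mulrA commr_int -mulrA; congr (_ * _).
    rewrite /y exprM exprMn_comm //; apply: commrX.
    exact/esym/polyev_comm.
  by rewrite mulr0.
Qed.

(** This reads the exponent i = k + E k' of a one-variable polynomial back as the ordered monomial
    a^k b^k', which undoes the substitution of (t, t^E). *)
Let ordv (E B : nat) (H : {poly int}) : R :=
  \sum_(i < B) (H`_i)%:~R * (a ^+ (i %% E) * b ^+ (i %/ E)).

Lemma cc_monomial i j u : cc u -> u * (a ^+ i * b ^+ j) = a ^+ i * b ^+ j * u.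
Proof.
move=> [ua ub]; have uai : u * a ^+ i = a ^+ i * u by apply: commrX.
have ubj : u * b ^+ j = b ^+ j * u by apply: commrX.
by rewrite mulrA uai -!mulrA ubj.
Qed.

Lemma monomial_comm_a2 i j m : a ^+ (i + 2 * m) * b ^+ j = (a ^+ 2) ^+ m * (a ^+ i * b ^+ j).
Proof. by rewrite addnC exprD exprM mulrA. Qed.

Lemma monomial_comm_b2 i j m : a ^+ i * b ^+ (j + 2 * m) = (b ^+ 2) ^+ m * (a ^+ i * b ^+ j).
Proof.
rewrite (cc_monomial _ _ (cc_exp m cc_b2)) -mulrA -exprM -exprD; congr (_ * _ ^+ _).
Qed.

(* Evaluating h at (t, t^E) with E large gives an identity in one variable which still
   separates the coefficients of h up to the order of the letters. *)
Lemma no_high_order_commutator :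
  ~ forall n, (2 < n)%N -> exists h : freeXY,
      [/\ idealJ p n h, comm a b = ev2 a b h &
          forall (r : R) i j, ev2 (r ^+ i) (r ^+ j) h = 0].
Proof.
move=> high.
pose id1 (f : {poly int}) := forall r : R, polyev r f = 0.
have ordered n : (2 < n)%N -> exists (E B : nat) (H : {poly int}),
    [/\ id1 H, c = ordv E B H &
       forall i, (i < B)%N -> ((p ^ (n - (i %% E + i %/ E)))%N %| H`_i)%Z].
  move=> n3; have [h [/idealJ_weight [l -> hl] ch h_id]] := high n n3.
  (* Larger than the length of every word, so both degrees of a word can be recovered from [pos]. *)
  pose E := (\sum_(zw <- l) size zw.2).+1.
  have wE zw : zw \in l -> (size zw.2 < E)%N.
    by move=> zwl; rewrite ltnS /E (big_rem zw) //= leq_addr.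
  have xysz w : (xs w + ys w)%N = size w.
    by rewrite /xs /ys; elim: w => //= -[] w /= <-; lia.
  pose pos (w : seq bool) := (xs w + E * ys w)%N.
  have xsE zw : zw \in l -> (pos zw.2 %% E)%N = xs zw.2 /\ (pos zw.2 %/ E)%N = ys zw.2.
    move=> /wE; rewrite -xysz => sE; have xE : (xs zw.2 < E)%N by lia.
    rewrite /pos mulnC addnC; split; first by rewrite modnMDl modn_small.
    by rewrite divnMDl // divn_small ?addn0.
  pose H : {poly int} := \sum_(zw <- l) zw.1 *: 'X^(pos zw.2).
  have Hcoef i : H`_i = \sum_(zw <- l | pos zw.2 == i) zw.1.
    rewrite /H coef_sum [RHS]big_mkcond; apply: eq_bigr => zw _.
    by rewrite coefZ coefXn eq_sym; case: eqP; rewrite ?mulr1 ?mulr0.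
  exists E, (E * E)%N, H; split.
  - move=> r; rewrite -[RHS](h_id r 1%N E) lsum_rmorph /= ev2_X ev2_Y /H rmorph_sum.
    rewrite /lsum; apply: eq_bigr => -[z w] _ /=.
    rewrite -mul_polyC rmorphM rmorphXn /= polyevC polyevX; congr (_ * _).
    rewrite /pos /xs /ys; elim: w => [|t w IH]; first by rewrite muln0 wev_nil.
    rewrite wev_cons -IH; case: t => /=; rewrite ?expr1.
      by rewrite -exprD add0n; congr (_ ^+ _); lia.
    by rewrite -exprS add0n add1n addSn.
  - rewrite ch lsum_rmorph /= ev2_X ev2_Y (weighted_normal_form n3 hl) /ordv.
    under [RHS]eq_bigr => i _ do rewrite Hcoef rmorph_sum mulr_suml.
    rewrite (exchange_big_dep xpredT) //= big_seq [RHS]big_seq; apply: eq_bigr => zw zwl.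
    have [e1 e2] := xsE _ zwl.
    have posB : (pos zw.2 < E * E)%N.
      have := wE _ zwl; rewrite -xysz /pos; nia.
    by rewrite (big_pred1 (Ordinal posB)) /= ?e1 ?e2.
  - move=> i _; rewrite Hcoef big_seq_cond.
    apply: rpred_sum => zw /andP[zwl /eqP <-].
    by have [-> ->] := xsE _ zwl; rewrite xysz; exact: hl.
(* If all one-variable identities were 0, the expression of [c] at order 3 would be 0. *)
have [f0 [f0_id f00]] : exists f, id1 f /\ f != 0.
  apply: contrapT => no_id; have [E [B [H [H_id cH _]]]] := ordered 3 isT.
  have H0 : H = 0 by apply: contrapT => /eqP H0; apply: no_id; exists H.
  apply: c_neq0; rewrite cH H0 /ordv big1 // => i _.
  by rewrite coef0 mul0r.
(* The least such [j] makes p^j the exact power of p that divides every one-variable identity;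
   dividing a suitable one by p^j leaves a polynomial that is not 0 modulo p. *)
have exj : exists j, `[< exists2 f, id1 f & exists i, ~~ ((p ^ j.+1)%N %| f`_i)%Z >].
  have lc0 : lead_coef f0 != 0 by rewrite lead_coef_eq0.
  exists `|lead_coef f0|%N; apply/asboolP; exists f0 => //.
  exists (size f0).-1; rewrite -lead_coefE dvdzE absz_nat.
  apply/negP => /dvdn_leq; rewrite absz_gt0 lc0 => /(_ isT).
  rewrite leqNgt => /negP; apply; apply: leq_trans (ltn_expl _ (prime_gt1 pr_p)).
  by rewrite ltnS ltnW.
have [j /asboolP [f f_id [i0 fi0]] minj] := ex_minnP exj.
have jdvd g : id1 g -> forall i, ((p ^ j)%N %| g`_i)%Z.
  move=> g_id i; case: j minj {fi0} => [|j] minj; first exact: dvd1z.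
  apply: contrapT => /negP ng; suff : (j.+1 <= j)%N by rewrite ltnn.
  by apply: minj; apply/asboolP; exists g => //; exists i.
have [f' fE] : exists f', f = (p ^ j)%N%:Z *: f'.
  exists (\poly_(i < size f) (f`_i %/ (p ^ j)%N)%Z); apply/polyP => i.
  rewrite coefZ coef_poly; case: ltnP => [_|si]; last by rewrite nth_default ?mulr0.
  by rewrite mulrC divzK //; exact: jdvd.
have exf' : exists i, ~~ (p %| f'`_i)%Z.
  exists i0; apply: contra fi0; rewrite fE coefZ expnSr PoszM => pf.
  exact: dvdz_mul.
(* The nonzero integer f0(z) vanishes in the ring; its p-part and its remaining factor become p^k
   and [L]. *)
have [z fz] : exists z : int, f0.[z] != 0.
  apply: contrapT => allz.
  have := max_poly_roots f00 (rs := [seq i%:Z | i <- iota 0 (size f0)]).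
  rewrite size_map size_iota ltnn => h; suff : false by []; apply: h.
    apply/allP => _ /mapP[i _ ->]; apply: contrapT => nr; apply: allz.
    by exists i; apply/negP.
  by rewrite map_inj_uniq ?iota_uniq // => u v [].
have [k [L [pL kL]]] : exists k L, ~~ (p %| L)%Z /\ (p ^ k)%N%:~R * L%:~R = 0 :> R.
  have w0 : (0 < `|f0.[z]|)%N by rewrite absz_gt0.
  have [q pq wq] := pfactor_coprime pr_p w0.
  exists (logn p `|f0.[z]|), q%:Z; split.
    by rewrite dvdzE !absz_nat -prime_coprime.
  rewrite -intrM -PoszM mulnC -wq.
  have : (f0.[z])%:~R = 0 :> R.
    rewrite -[RHS](f0_id z%:~R) -[LHS]mulr1 -[RHS]mulr1.
    by apply/esym/polyev_mull; rewrite !mulr1.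
  rewrite {1}[f0.[z]]intEsign rmorphM /= rmorph_sign => /eqP; rewrite mulr_sign.
  by case: ifP => _; rewrite ?oppr_eq0 => /eqP.
have f'_id r : polyev r ((p ^ j)%N%:Z *: f') = 0 := eq_trans (congr1 _ (esym fE)) (f_id r).
have [M awayM] := power_away f'_id exf' pL kL.
(* A monomial with both exponents below 2M has length below 4M, so p^k divides its coefficient. Any
   other one contains the M-th power of a square of a letter and falls under [awayM]. The 3 keeps
   the order above 2. *)
have [E [B [H [H_id cH pH]]]] := ordered (4 * M + k + 3)%N (ltac:(lia)).
apply: away_from_c_comm; rewrite cH /ordv.
have s2 (t : R) : t * c = 0 -> t ^+ 2 * c = 0 by move=> tc; rewrite expr2 -mulrA tc mulr0.
have away_pow (s : R) i j' : cc s -> s * c = 0 -> (forall u, cc u -> u * s = s * u) ->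
    forall z', ((p ^ j)%N %| z')%Z ->
    away_from_c (z'%:~R * (s ^+ M * (a ^+ i * b ^+ j'))).
  move=> ccs sc us' z' /dvdzP[q ->]; split.
    move=> u ccu; have us : u * s ^+ M = s ^+ M * u by apply: commrX; exact: us'.
    rewrite [LHS]mulrA (commr_int u) -mulrA -[RHS]mulrA; congr (_ * _).
    by rewrite [LHS]mulrA us -[LHS]mulrA (cc_monomial i j' ccu) !mulrA.
  have [u [ccu uc us]] := awayM s ccs sc; exists u; split=> //.
  rewrite intrM -[_ * _ * (_ * _)]mulrA [(p ^ j)%N%:~R * _]mulrA.
  by rewrite [LHS]mulrA (commr_int u) -[LHS]mulrA [u * _]mulrA us mul0r mulr0.
have jH := jdvd H H_id.
elim/big_ind: _ => [||i _]; [exact: away_from_c0|exact: away_from_cD|].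
have := pH i (ltn_ord i); set i1 := (i %% E)%N; set i2 := (i %/ E)%N => pHi.
have [Mi1|i1M] := leqP (2 * M) i1.
  rewrite -(subnK Mi1) monomial_comm_a2; apply: away_pow (jH i).
  - exact: cc_a2.
  - by rewrite expr2 -mulrA ac mulr0.
  - by move=> u [ua _]; apply: commrX.
have [Mi2|i2M] := leqP (2 * M) i2.
  rewrite -(subnK Mi2) monomial_comm_b2; apply: away_pow (jH i).
  - exact: cc_b2.
  - by rewrite expr2 -mulrA bc mulr0.
  - by move=> u [_ ub]; apply: commrX.
have /dvdzP[q ->] : ((p ^ k)%N %| H`_i)%Z.
  apply: dvdz_trans pHi; rewrite dvdzE !absz_nat dvdn_exp2l //.
  by move: (i1) (i2) i1M i2M => n1 n2; lia.
split.
  by move=> u ccu; rewrite [LHS]mulrA (commr_int u) -[LHS]mulrA cc_monomial // !mulrA.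
have [[t t'] /= tt] : {tt | tt.1 * p%:Z + tt.2 * L = 1}.
  have /coprimezP : coprimez p L.
    by rewrite coprimezE absz_nat prime_coprime // -(absz_nat p) -dvdzE.
  by move=> /cid [tt ttE]; exists tt.
exists (t' * L)%:~R; split; first exact: cc_int.
  have -> : t' * L = 1 - t * p%:Z by rewrite -tt addrAC subrr add0r.
  by rewrite intrB mulrBl mul1r intrM -mulrA -pmulrn pc mulr0 subr0.
have -> : (t' * L)%:~R * ((q * (p ^ k)%N)%:~R * (a ^+ i1 * b ^+ i2)) =
    (t' * q)%:~R * ((p ^ k)%N%:~R * L%:~R) * (a ^+ i1 * b ^+ i2) :> R.
  by rewrite mulrA -!intrM mulrACA [L * _]mulrC.
by rewrite kL mulr0 mul0r.
Qed.

End CentralCommutator.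

Lemma quot_lift (R A : pzRingType) (I : R -> Prop) (hI : is_ideal I)
    (f : {rmorphism R -> A}) : (forall a, I a -> f a = 0) ->
  exists g : {rmorphism ideal_quot hI -> A}, forall a, g (quot_pi hI a) = f a.
Proof.
move=> fI; pose g0 (u : ideal_quot hI) := f (quot_repr u).
have g0E a : g0 (quot_pi hI a) = f a.
  apply/eqP; rewrite -subr_eq0 -rmorphB; apply/eqP/fI/quot_piP.
  by rewrite /quot_pi /quot_repr generic_quotient.reprK.
have gB : zmod_morphism g0.
  move=> u v; have [a <-] := quot_pi_surj u; have [b <-] := quot_pi_surj v.
  by rewrite -rmorphB !g0E rmorphB.
have gM : monoid_morphism g0.
  split=> [|u v]; first by rewrite -(rmorph1 (quot_pi hI)) g0E rmorph1.
  have [a <-] := quot_pi_surj u; have [b <-] := quot_pi_surj v.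
  by rewrite -rmorphM !g0E rmorphM.
pose g : {rmorphism ideal_quot hI -> A} := HB.pack g0
  (GRing.isZmodMorphism.Build _ A g0 gB) (GRing.isMonoidMorphism.Build _ A g0 gM).
by exists g.
Qed.

(** Every nonempty word kills [c], so only the constant term acts. *)
Lemma absorb_int (R : nzRingType) (a b c : R) P : a * c = 0 -> b * c = 0 ->
  exists z : int, ev2 a b P * c = z%:~R * c.
Proof.
move=> ac bc; have [l _ ->] := ev2_list P; elim: l => [|[z w] l [t IH]].
  by exists 0; rewrite lsum_nil.
have [u uE] : exists u : int, wev a b w * c = u%:~R * c.
  elim: w => [|s w [u IHw]]; first by exists 1; rewrite wev_nil.
  exists 0; rewrite wev_cons -mulrA IHw mulrA (commr_int _ u) -mulrA.
  by case: s; rewrite ?ac ?bc mulr0 mul0r.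
exists (z * u + t); rewrite lsum_cons mulrDl IH -mulrA uE mulrA -intrM -mulrDl.
by rewrite -intrD.
Qed.

Lemma absorb_intr (R : nzRingType) (a b c : R) P : c * a = 0 -> c * b = 0 ->
  exists z : int, c * ev2 a b P = z%:~R * c.
Proof.
move=> ca cb; have [l _ ->] := ev2_list P; elim: l => [|[z w] l [t IH]].
  by exists 0; rewrite lsum_nil mulr0 mul0r.
have [u uE] : exists u : int, c * wev a b w = u%:~R * c.
  case: w => [|s w]; first by exists 1; rewrite wev_nil mulr1 mul1r.
  by exists 0; rewrite wev_cons mulrA; case: s; rewrite ?ca ?cb !mul0r.
exists (z * u + t); rewrite lsum_cons mulrDr IH mulrA (commr_int c) -mulrA uE.
by rewrite mulrA -intrM -mulrDl -intrD.
Qed.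

(** * The ideal I at letters that annihilate their commutator *)

Section IdealIEval.
Variables (p : nat) (R : nzRingType) (a b : R).
Local Notation c := (comm a b).
Hypotheses (pc : p%:R * c = 0).
Hypotheses (ac : a * c = 0) (ca : c * a = 0) (bc : b * c = 0) (cb : c * b = 0).

Lemma pxy_kills P : pxy p P -> ev2 a b P * c = 0 /\ c * ev2 a b P = 0.
Proof.
elim=> [Q [->|->|->]||Q T _ [h1 h2] _ [h3 h4]|Q T _ [h1 h2]|Q T _ [h1 h2]].
- by rewrite rmorph_nat pc; split=> //; rewrite (commr_nat c).
- by rewrite ev2_X.
- by rewrite ev2_Y.
- by rewrite rmorph0 mul0r mulr0.
- by rewrite rmorphD /=; split; [rewrite mulrDl h1 h3|rewrite mulrDr h2 h4]; rewrite addr0.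
- have [z zE] := absorb_intr Q ca cb.
  by rewrite rmorphM /= -mulrA h1 mulr0 mulrA zE -mulrA h2 mulr0.
- have [z zE] := absorb_int T ac bc.
  by rewrite rmorphM /= -mulrA zE mulrA (commr_int _ z) -!mulrA h1 mulr0 mulrA h2 mul0r.
Qed.

Lemma idealI_ev P : idealI p P -> ev2 a b P = 0.
Proof.
have cE := ev2_comm a b.
move=> [P1 [P2 [h1 h2 ->]]]; rewrite rmorphD /=.
have -> : ev2 a b P1 = 0.
  elim: h1 => [Q T hQ _||Q T _ IQ _ IT|Q _ IQ].
  - rewrite rmorphM /=; suff -> : ev2 a b Q = 0 by rewrite mul0r.
    elim: hQ => [Q1 _ /pxy_kills [q1 _] <-||Q1 Q2 _ I1 _ I2|Q1 _ I1].
    + by rewrite rmorphM /= cE q1.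
    + exact: rmorph0.
    + by rewrite rmorphD /= I1 I2 addr0.
    + by rewrite rmorphN /= I1 oppr0.
  - exact: rmorph0.
  - by rewrite rmorphD /= IQ IT addr0.
  - by rewrite rmorphN /= IQ oppr0.
rewrite add0r; elim: h2 => [Q T hQ /pxy_kills [_ hT]||Q T _ IQ _ IT|Q _ IQ].
- suff [z zE] : exists z : int, ev2 a b Q = z%:~R * c.
    by rewrite rmorphM /= zE -mulrA hT mulr0.
  elim: hQ => [Q1 _ _ <-||Q1 Q2 _ [z1 I1] _ [z2 I2]|Q1 _ [z1 I1]].
  + by have [z zE] := absorb_int Q1 ac bc; exists z; rewrite rmorphM /= cE.
  + by exists 0; rewrite rmorph0 mul0r.
  + by exists (z1 + z2); rewrite rmorphD /= I1 I2 intrD mulrDl.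
  + by exists (- z1); rewrite rmorphN /= I1 intrN mulNr.
- exact: rmorph0.
- by rewrite rmorphD /= IQ IT addr0.
- by rewrite rmorphN /= IQ oppr0.
Qed.

End IdealIEval.

Lemma ident_ideal (R : nzRingType) :
  is_ideal (fun P : freeXY => forall u v : R, ev2 u v P = 0).
Proof.
split=> [u v|P Q hP hQ u v|P Q hQ u v|P Q hP u v].
- exact: rmorph0.
- by rewrite rmorphD /= hP hQ addr0.
- by rewrite rmorphM /= hQ mulr0.
- by rewrite rmorphM /= hP mul0r.
Qed.

(** Let T be the ideal of polynomials that vanish on R. If [X, Y] is outside I + J_n + T for some n
    >= 3, the quotient by this sum is the required ring. Otherwise the component [h] of [X, Y] in
    J_n contradicts [no_high_order_commutator]: I and T vanish at [(a, b)], and together with [X, Y]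
    they vanish at any two powers of one element. *)
Lemma calA_of_commutator (R : nzRingType) (S : forall s : nat, freeRing s -> Prop)
    (p : nat) (a b : R) (c := comm a b) :
  satisfies R S -> prime p -> c <> 0 -> p%:R * c = 0 ->
  a * c = 0 -> c * a = 0 -> b * c = 0 -> c * b = 0 ->
  exists A : nzRingType, in_calA p A /\ satisfies A S.
Proof.
move=> hR pr_p c0 pc ac ca bc cb; apply: contrapT => noA.
apply: (no_high_order_commutator pr_p c0 pc ac ca bc cb) => n n3.
pose T (P : freeXY) := forall u v : R, ev2 u v P = 0.
pose I := set_add (set_add (idealI p) (idealJ p n)) T.
have hI : is_ideal I.
  by apply: set_add_ideal; [exact: idealIJ_ideal|exact: ident_ideal].
have cI : I (comm varX varY).
  apply: contrapT => cI; apply: noA.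
  have [|A [f [fsurj kerf]]] := nz_quotient hI.
    by move=> /(idealMr hI (comm varX varY)); rewrite mul1r.
  exists A; split.
    split.
      move=> commA; apply: cI; apply/kerf; apply: (etrans (rmorph_commutator f varX varY)).
      by rewrite /comm commA subrr.
    exists n => //; have [|g gE] := @quot_lift _ _ _ (idealIJ_ideal p n) f.
      move=> P hP; apply/kerf; exists P, 0; split; rewrite ?addr0 //.
      by move=> u v; rewrite rmorph0.
    by exists g => u; have [P <-] := fsurj u; exists (quot_pi (idealIJ_ideal p n) P).
  move=> s P SP u; have [v fv] := choice (fun i => fsurj (u i)).
  rewrite (eq_peval _ (r' := f \o v)); last by move=> i /=; rewrite fv.
  rewrite -peval_rmorph; apply/kerf; exists 0, (peval v P); split; rewrite ?add0r //.
    exact: (ideal0 (idealIJ_ideal p n)).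
  by move=> u1 v1; rewrite peval_rmorph; exact: hR.
have evc (u v : R) : ev2 u v (comm varX varY) = comm u v := ev2_comm u v.
move: cI => [_ [t [[g [h [gI hJ ->]] tT ch]]]]; exists h; split=> //.
  rewrite -evc ch !rmorphD /= (tT a b) addr0 (@idealI_ev p) ?add0r //.
move=> r i j; have cij : comm (r ^+ i) (r ^+ j) = 0.
  by rewrite /comm -!exprD addnC subrr.
have := evc (r ^+ i) (r ^+ j); rewrite ch !rmorphD /= (tT _ _) addr0 cij.
by rewrite (@idealI_ev p) ?add0r ?cij ?mulr0 ?mul0r.
Qed.

Lemma comm_expl (R : nzRingType) (x s : R) k : x * comm x s = comm x s * x ->
  comm (x ^+ k.+1) s = x ^+ k * comm x s *+ k.+1.
Proof.
move=> xd; elim: k => [|k IH]; first by rewrite expr1 mul1r.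
rewrite exprS comm_derl IH mulrnAr mulrA -exprS [RHS]mulrSr; congr (_ + _).
by apply: commrX; rewrite /GRing.comm -xd.
Qed.

Lemma square_zero_case (R : nzRingType) (S : forall s : nat, freeRing s -> Prop)
    (x y : R) :
  satisfies R S -> (forall a, exists P, a = ev2 x y P) -> comm x y <> 0 ->
  (forall I : R -> Prop, is_ideal I -> ideal_nonzero I -> I (comm x y)) ->
  (forall a b, core_ideal x y a -> core_ideal x y b -> a * b = 0) ->
  (exists2 p : nat, prime p & satisfies (U p) S)
  \/ (exists (p n i : nat) (pr_p : prime p) (n_gt1 : (1 < n)%N),
        (0 < i <= n - 1)%N /\ satisfies (B pr_p n_gt1 i) S)
  \/ (exists2 p : nat, prime p &
        exists A : nzRingType, in_calA p A /\ satisfies A S).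
Proof.
move=> hR gen c0 heart sqz.
have [K [lam [rho [tau [[tau1 tauD] tau_inj tau_l tau_r [p [N [chp N0 zN]]]]]]]] :=
  square_zero_structure gen c0 heart sqz.
have pr_p := pcharf_prime chp.
have ph : p%:R * comm x y = 0.
  by rewrite -tau1 tau_l rmorph_nat (pcharf0 chp) mul0r raddf0.
have q1 : (0 < (p ^ N).-1)%N.
  by rewrite -subn1 subn_gt0 -(exp1n N) ltn_exp2r ?prime_gt1.
have pow1 (z : K) : z != 0 -> z ^+ (p ^ N).-1 = 1.
  move=> z0; apply: (mulfI z0); rewrite -exprS prednK ?zN ?mulr1 //.
  by rewrite expn_gt0 prime_gt0.
have pow0 : (0 : K) ^+ (p ^ N).-1 = 0 by rewrite expr0n gtn_eqF.
(* The power p^N - 1 sends every nonzero element of [K] to 1, so an element in exactly one of the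
   two kernels yields such an [e], after passing to the complement if needed. *)
have U_of e : lam e = 0 -> rho e = 1 -> satisfies (U p) S.
  move=> le re; apply: (satisfies_U hR pr_p c0 ph (e := e)); rewrite -tau1.
    by rewrite tau_l le mul0r raddf0.
  by rewrite tau_r re mulr1.
have [[a [la ra]]|nlr] := pselect (exists a, lam a = 0 /\ rho a <> 0).
  left; exists p => //; apply: (U_of (a ^+ (p ^ N).-1)); rewrite rmorphXn /=.
    by rewrite la pow0.
  by rewrite pow1 //; apply/eqP.
have [[a [ra la]]|nrl] := pselect (exists a, rho a = 0 /\ lam a <> 0).
  left; exists p => //; apply: (U_of (1 - a ^+ (p ^ N).-1));
    rewrite rmorphB rmorph1 rmorphXn /=.
    by rewrite pow1 ?subrr //; apply/eqP.
  by rewrite ra pow0 subr0.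
have [[r lr]|lamE] := pselect (exists r, lam r != rho r).
  right; left; exists p.
  have [||n [i [n_gt1 [i_n hB]]]] := satisfies_B pr_p hR chp N0 zN tau_inj tau_l tau_r _ _ lr.
  - by move=> k l; exact: sqz.
  - by move=> a ra; apply: contrapT => la; apply: nrl; exists a.
  by exists n, i, pr_p, n_gt1.
right; right; exists p => //.
have {}lamE r : lam r = rho r.
  by apply/eqP; apply: contrapT => /negP lr; apply: lamE; exists r.
have DE d : core_ideal x y d -> exists k, d = tau k.
  elim=> [_ <-||u v _ [k ->] _ [l ->]|r u _ [k ->]|u r _ [k ->]].
  - by exists 1; rewrite tau1.
  - by exists 0; rewrite raddf0.
  - by exists (k + l); rewrite raddfD.
  - by exists (lam r * k); rewrite tau_l.
  - by exists (k * rho r); rewrite tau_r.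
have Dcen d r : core_ideal x y d -> r * d = d * r.
  by move=> /DE[k ->]; rewrite tau_l tau_r lamE mulrC.
have Dp d : core_ideal x y d -> d *+ p = 0.
  by move=> /DE[k ->]; rewrite -raddfMn -mulr_natr (pcharf0 chp) mulr0 raddf0.
(* Commutators are central and killed by p, so the derivation rule yields a factor p^N. *)
have comm_q (u s : R) : comm (u ^+ (p ^ N)) s = 0.
  have Dus : core_ideal x y (comm u s) by exact: comm_core_ideal.
  rewrite -(prednK (_ : 0 < p ^ N)%N) ?expn_gt0 ?prime_gt0 // comm_expl; last exact: Dcen.
  rewrite prednK ?expn_gt0 ?prime_gt0 // -mulrnAr -(prednK N0) expnS mulrnA Dp //.
  by rewrite mul0rn mulr0.
(* Subtracting a central power keeps the commutator and moves the letters into the kernel of [lam],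
   so that they annihilate it. *)
pose a := x - x ^+ (p ^ N); pose b := y - y ^+ (p ^ N).
have cab : comm a b = comm x y.
  rewrite comm_subl comm_q subr0 commN comm_subl comm_q subr0 -commN.
  by [].
have lama : lam a = 0 by rewrite rmorphB rmorphXn /= zN subrr.
have lamb : lam b = 0 by rewrite rmorphB rmorphXn /= zN subrr.
apply: (calA_of_commutator (a := a) (b := b) hR pr_p); rewrite cab // -tau1.
- by rewrite tau_l lama mul0r raddf0.
- by rewrite tau_r -lamE lama mulr0 raddf0.
- by rewrite tau_l lamb mul0r raddf0.
- by rewrite tau_r -lamE lamb mulr0 raddf0.
Qed.

(** * Rings with finitely many elements *)

Lemma span_finite (A : zmodType) (I : eqType) (W : seq I) (F : I -> A) (q : nat) :
  (0 < q)%N -> (forall w, F w *+ q = 0) ->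
  exists s : seq A, forall z : I -> int, \sum_(w <- W) F w *~ z w \in s.
Proof.
move=> q0 Fq; elim: W => [|w W [s IH]].
  by exists [:: 0] => z; rewrite big_nil mem_head.
exists [seq F w *+ i + t | i <- iota 0 q, t <- s] => z; rewrite big_cons.
apply/allpairsP; exists (`|(z w %% q)%Z|%N, \sum_(w <- W) F w *~ z w); split=> //=.
  have zq : (0 <= (z w %% q%:Z)%Z)%R by rewrite modz_ge0 // eqz_nat -lt0n.
  by rewrite mem_iota add0n /= -ltz_nat gez0_abs // ltz_pmod.
congr (_ + _); rewrite {1}(divz_eq (z w) q) mulrzDr.
rewrite mulrC mulrzA -pmulrn Fq mul0rz add0r pmulrn gez0_abs //.
by rewrite modz_ge0 // eqz_nat -lt0n.
Qed.

Lemma nz_finite (A : nzRingType) (s : seq A) : (forall a, a \in s) ->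
  exists (A' : finNzRingType) (f : {rmorphism A -> A'}) (g : A' -> A), cancel f g /\ cancel g f.
Proof.
move=> sA; pose e := undup s.
have eP : Finite.axiom e.
  by move=> a; rewrite count_uniq_mem ?undup_uniq // mem_undup sA.
have idxK : pcancel (fun a => index a e) (fun n => nth None [seq Some b | b <- e] n).
  move=> a; have ae : (index a e < size e)%N by rewrite index_mem mem_undup.
  by rewrite (nth_map 0) // nth_index // mem_undup.
pose A' : finNzRingType := HB.pack (GRing.NzRing.sort A) (PCanIsCountable idxK)
  (isFinite.Build A eP).
exists A', (idfun : {rmorphism A -> A}), id.
by [].
Qed.

(** * Finite witnesses *)

Lemma idealJ_int p n : idealJ p n ((p ^ n)%:R).
Proof.
elim: n => [|n IH]; first by [].
rewrite expnS natrM; apply: set_mul_base => //.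
by apply: ideal_gen_base; apply: Or31.
Qed.

Lemma idealJ_word p n w : (n <= size w)%N -> idealJ p n (wev varX varY w).
Proof.
elim: n w => [|n IH] [|t w] //= nw; rewrite wev_cons; apply: set_mul_base; last exact: IH.
by apply: ideal_gen_base; case: t; [apply: Or33|apply: Or32].
Qed.

Definition short_words n : seq (seq bool) :=
  [seq val t | k <- iota 0 n, t <- enum {: k.-tuple bool}].

Lemma mem_short_words n w : (size w < n)%N -> w \in short_words n.
Proof.
move=> wn; apply/allpairsPdep; exists (size w), (in_tuple w).
by rewrite mem_iota mem_enum.
Qed.

Lemma delta_sum (A : zmodType) (I : eqType) (W : seq I) (F : I -> A) w z :
  uniq W -> w \in W -> F w *~ z = \sum_(v <- W) F v *~ (if v == w then z else 0).
Proof.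
move=> uW wW; rewrite (bigD1_seq w) //= eqxx big1 ?addr0 // => v /negPf ->.
by rewrite mulr0z.
Qed.

(** Modulo J_n all words of length at least n vanish and so does p^n, so the short words with
    coefficients modulo p^n give every element. *)
Lemma calA_finite p (A : nzRingType) : prime p -> in_calA p A ->
  exists s : seq A, forall a, a \in s.
Proof.
move=> pr_p [_ [n n3 [f fsurj]]].
pose hI := idealIJ_ideal p n.
have kills P : idealJ p n P -> f (quot_pi hI P) = 0.
  move=> hP; rewrite -(rmorph0 f); congr (f _).
  rewrite -(rmorph0 (quot_pi hI)); apply/quot_piP; rewrite subr0.
  exists 0, P; split; rewrite ?add0r //.
  by exists 0, 0; split; [exact: set_mul0|exact: set_mul0|rewrite addr0].
have [F FE] : exists F : seq bool -> A, forall w, F w = f (quot_pi hI (wev varX varY w)).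
  by eexists.
pose W := undup (short_words n).
have Fq w : F w *+ p ^ n = 0.
  have fn : f (quot_pi hI ((p ^ n)%:R)) = 0 by exact/kills/idealJ_int.
  by rewrite -mulr_natr -(rmorph_nat f) -(rmorph_nat (quot_pi hI)) fn mulr0.
have [|s sP] := span_finite W _ Fq; first by rewrite expn_gt0 prime_gt0.
exists s => a; have [u <-] := fsurj a; have [P <-] := quot_pi_surj u.
suff [z ->] : exists z : seq bool -> int, f (quot_pi hI P) = \sum_(w <- W) F w *~ z w.
  exact: sP.
have [l ->] := freeXY_lsum P; elim: l => [|[z w] l [zl IH]].
  exists (fun=> 0); rewrite lsum_nil !rmorph0 big1 // => w _; exact: mulr0z.
have fzw : f (quot_pi hI (z%:~R * wev varX varY w)) = F w *~ z.
  by rewrite !rmorphM !rmorph_int FE mulrzl.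
rewrite lsum_cons !rmorphD IH /= fzw.
have [wn|nw] := ltnP (size w) n.
  exists (fun v => (if v == w then z else 0) + zl v).
  rewrite (delta_sum F z (undup_uniq _) (_ : w \in W)).
    by rewrite -big_split; apply: eq_bigr => v _; rewrite mulrzDr.
  by rewrite mem_undup mem_short_words.
by exists zl; rewrite FE kills ?mul0rz ?add0r //; exact: idealJ_word.
Qed.

(** The hypothesis on commutators spreads to the ideal they generate, one factor at a time; its
    square is therefore 0. All three families satisfy it. *)
Lemma finite_witness (A : finNzRingType) (S : forall s : nat, freeRing s -> Prop) :
  noncommutative A -> satisfies A S ->
  (forall a b r c d : A, comm a b * r * comm c d = 0) ->
  exists A : finNzRingType,
     [/\ noncommutative A, satisfies A S,
         ideal_nonzero (commutator_ideal (R := A)) &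
         ideal_nilpotent (commutator_ideal (R := A))].
Proof.
move=> ncA hA sq0; exists A; split=> //.
  apply: contrapT => z; apply: ncA => a b; apply/eqP; rewrite -subr_eq0; apply/eqP.
  apply: contrapT => ab; apply: z; exists (comm a b) => //.
  by apply: ideal_gen_base; exists a, b.
have sq1 (a : A) : commutator_ideal a -> forall r c d, a * r * comm c d = 0.
  elim=> {a} [_ [a [b ->]]||a b _ ha _ hb|r a _ ha|a r _ ha] t c d //.
  - by rewrite !mul0r.
  - by rewrite !mulrDl ha hb addr0.
  - by rewrite -!mulrA [a * _]mulrA ha mulr0.
  - by rewrite -[a * r * t]mulrA ha.
have sq2 (b : A) : commutator_ideal b ->
    forall a r, commutator_ideal a -> a * r * b = 0.
  elim=> {b} [_ [c [d ->]]||b c _ hb _ hc|r b _ hb|b r _ hb] a t ha.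
  - exact: sq1.
  - by rewrite mulr0.
  - by rewrite mulrDr hb ?hc ?addr0.
  - by rewrite mulrA -[a * t * r]mulrA hb.
  - by rewrite mulrA hb ?mul0r.
have hD : is_ideal (commutator_ideal (R := A)) := ideal_gen_ideal _.
exists 2%N => x /=; elim=> {x} [a b ha hb||a b _ -> _ ->|a _ ->].
- rewrite -[a]mulr1; apply: sq2 => //.
  elim: hb => {b} [b r hb _||b c _ hb _ hc|b _ hb].
  + exact: idealMr.
  + exact: ideal0.
  + exact: idealD.
  + exact: idealN.
- by [].
- by rewrite addr0.
- by rewrite oppr0.
Qed.

(** The images of X and Y annihilate [c] on both sides, so the integer multiples of [c] form an
    ideal, which contains all commutators and has square zero. *)
Lemma calA_square_zero p (A : nzRingType) : in_calA p A ->
  forall a b r c d : A, comm a b * r * comm c d = 0.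
Proof.
move=> [_ [n n3 [f fsurj]]].
pose hI := idealIJ_ideal p n.
have fI P : idealI p P -> f (quot_pi hI P) = 0.
  move=> hP; rewrite -(rmorph0 f); congr (f _).
  rewrite -(rmorph0 (quot_pi hI)); apply/quot_piP; rewrite subr0.
  by exists P, 0; split; rewrite ?addr0 //; apply: (ideal0 (ideal_pow_ideal n (ideal_gen_ideal _))).
pose phi : {rmorphism freeXY -> A} := f \o quot_pi hI.
have phiM P Q : phi (P * Q) = phi P * phi Q by rewrite rmorphM.
pose X := phi varX; pose Y := phi varY; pose c := comm X Y.
have cE : c = phi (comm varX varY).
  by rewrite (rmorph_commutator phi).
have i1 P : pxy p P -> phi P * c = 0 /\ c * phi P = 0.
  move=> hP; rewrite cE -!phiM; split; apply: fI.
    exists (P * comm varX varY), 0; split; rewrite ?addr0 //; last exact: set_mul0.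
    by rewrite -[P * _]mulr1; apply: set_mul_base => //; apply: set_mul_base.
  exists 0, (comm varX varY * P); split; rewrite ?add0r //; first exact: set_mul0.
  apply: set_mul_base => //; rewrite -[comm _ _]mul1r; exact: set_mul_base.
have [Xc cX] : X * c = 0 /\ c * X = 0 by apply: i1; apply: ideal_gen_base; apply: Or32.
have [Yc cY] : Y * c = 0 /\ c * Y = 0 by apply: i1; apply: ideal_gen_base; apply: Or33.
have gen (a : A) : exists P, a = ev2 X Y P.
  have [u <-] := fsurj a; have [P <-] := quot_pi_surj u; exists P.
  by rewrite -[in LHS](ev2_id P); exact: (ev2_rmorph phi varX varY P).
pose Zc (d : A) := exists z : int, d = z%:~R * c.
have hZ : is_ideal Zc.
  split; first by exists 0; rewrite mul0r.
  - by move=> _ _ [z ->] [t ->]; exists (z + t); rewrite intrD mulrDl.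
  - move=> r _ [z ->]; have [P ->] := gen r; have [t tE] := absorb_int P Xc Yc.
    by exists (z * t); rewrite mulrA (commr_int _ z) -mulrA tE mulrA -intrM.
  - move=> _ r [z ->]; have [P ->] := gen r; have [t tE] := absorb_intr P cX cY.
    by exists (z * t); rewrite -mulrA tE mulrA -intrM.
have Zcomm a b : Zc (comm a b).
  apply: (core_ideal_sub hZ) (comm_core_ideal gen a b).
  by exists 1; rewrite mul1r.
have cc : c * c = 0.
  by rewrite {1}/c mulrBl -[X * Y * c]mulrA -[Y * X * c]mulrA Xc Yc !mulr0 subr0.
move=> a b r d e; have [z ->] := Zcomm a b; have [t ->] := Zcomm d e.
have [u uE] : Zc (r * (t%:~R * c)) by apply: (idealMl hZ); exists t.
by rewrite -mulrA uE -mulrA [c * _]mulrA (commr_int c) -mulrA cc !mulr0.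
Qed.

Lemma strictly_upper_zero (F : fieldType) (M N L : 'M[F]_2) :
  M 0 0 = 0 -> M 1 0 = 0 -> M 1 1 = 0 -> L 1 0 = 0 ->
  N 0 0 = 0 -> N 1 0 = 0 -> N 1 1 = 0 -> M *m L *m N = 0.
Proof.
move=> M00 M10 M11 L10 N00 N10 N11.
have E01 : lift ord0 ord0 = 1 :> 'I_2 by apply/val_inj.
have i01 (k : 'I_2) : k = 0 \/ k = 1.
  by case: k => [[|[|//]] ?]; [left|right]; apply/val_inj.
apply/matrixP => i j; rewrite [RHS]mxE !mxE !big_ord_recl !big_ord0 !mxE.
rewrite !big_ord_recl !big_ord0 !E01.
by case: (i01 i) => ->; case: (i01 j) => ->;
  rewrite ?M00 ?M10 ?M11 ?L10 ?N00 ?N10 ?N11 ?(mul0r, mulr0, add0r, addr0).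
Qed.

Lemma comm_upper (F : fieldType) (M N : 'M[F]_2) : M 1 0 = 0 -> N 1 0 = 0 ->
  [/\ (comm M N) 0 0 = 0, (comm M N) 1 0 = 0 & (comm M N) 1 1 = 0].
Proof.
move=> M10 N10; have E01 : lift ord0 ord0 = 1 :> 'I_2 by apply/val_inj.
rewrite /comm; split; rewrite !mxE !big_ord_recl !big_ord0 ?E01 ?M10 ?N10;
  by rewrite ?(mul0r, mulr0, add0r, addr0, subr0, oppr0) // mulrC subrr.
Qed.

Lemma U_square_zero p (a b r c d : U p) : comm a b * r * comm c d = 0.
Proof.
have M10 (M : U p) : val M 1 0 = 0 by exact/eqP/(valP M).
have vcomm (M N : U p) : val (comm M N) = comm (val M) (val N) by [].
apply: val_inj; rewrite raddf0 /=; apply: strictly_upper_zero => //.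
- by have [] := comm_upper (M10 a) (M10 b).
- by have [] := comm_upper (M10 a) (M10 b).
- by have [] := comm_upper (M10 a) (M10 b).
- exact: M10.
- by have [] := comm_upper (M10 c) (M10 d).
- by have [] := comm_upper (M10 c) (M10 d).
- by have [] := comm_upper (M10 c) (M10 d).
Qed.

Lemma B_square_zero p n (pr_p : prime p) (n_gt1 : (1 < n)%N) i
  (a b r c d : B pr_p n_gt1 i) : comm a b * r * comm c d = 0.
Proof.
have M10 (M : B pr_p n_gt1 i) : val M 1 0 = 0 by case/andP: (valP M) => /eqP.
apply: val_inj; rewrite raddf0 /=; apply: strictly_upper_zero => //.
- by have [] := comm_upper (M10 a) (M10 b).
- by have [] := comm_upper (M10 a) (M10 b).
- by have [] := comm_upper (M10 a) (M10 b).
- exact: M10.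
- by have [] := comm_upper (M10 c) (M10 d).
- by have [] := comm_upper (M10 c) (M10 d).
- by have [] := comm_upper (M10 c) (M10 d).
Qed.

Lemma U_noncommutative p : noncommutative (U p).
Proof.
pose e : 'M['F_p]_2 := \matrix_(i, j) ((i == 0) && (j == 0))%:R.
pose h : 'M['F_p]_2 := \matrix_(i, j) ((i == 0) && (j == 1))%:R.
have eU : U_pred e by rewrite /U_pred mxE.
have hU : U_pred h by rewrite /U_pred mxE.
move=> /(_ (exist _ e eU) (exist _ h hU)) /(congr1 val) /= /matrixP /(_ 0 1).
rewrite !mxE !big_ord_recl !big_ord0 !mxE /= !(mul0r, mulr0, mulr1, add0r, addr0).
by move/eqP; rewrite oner_eq0.
Qed.

Lemma B_noncommutative p n (pr_p : prime p) (n_gt1 : (1 < n)%N) i :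
  (0 < i <= n - 1)%N -> noncommutative (B pr_p n_gt1 i).
Proof.
move=> /andP[i0 i_n]; pose F := GF pr_p (ltnW n_gt1).
(* The polynomial 'X^(p^i) - 'X has at most p^i roots, fewer than the p^n elements of the field. *)
have [t tp] : exists t : F, t ^+ (p ^ i) != t.
  apply: contrapT => allt.
  have pi1 : (1 < p ^ i)%N by rewrite -(exp1n i) ltn_exp2r ?prime_gt1.
  have sP : size ('X^(p ^ i) - 'X : {poly F}) = (p ^ i).+1.
    by rewrite size_polyDl ?size_polyXn // size_polyN size_polyX ltnS.
  have P0 : 'X^(p ^ i) - 'X != 0 :> {poly F} by rewrite -size_poly_gt0 sP.
  have := max_poly_roots P0 (rs := enum F).
  rewrite enum_uniq sP -cardE card_GF => /(_ _ isT).
  have -> : (p ^ n < (p ^ i).+1)%N = false.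
    rewrite ltnS leqNgt ltn_exp2l ?prime_gt1 // (leq_ltn_trans i_n) //.
    by rewrite subn1 prednK // ltnW.
  move=> h; suff: false by []; apply: h; apply/allP => a _.
  rewrite rootE !hornerE subr_eq0; apply: contrapT => /negP na.
  by apply: allt; exists a.
pose M : 'M[F]_2 := \matrix_(k, j) (if k == j then if k == 0 then t ^+ (p ^ i) else t else 0).
pose h : 'M[F]_2 := \matrix_(k, j) ((k == 0) && (j == 1))%:R.
have MB : B_pred i M by rewrite /B_pred !mxE !eqxx.
have hB : B_pred i h.
  by rewrite /B_pred !mxE /= expr0n expn_eq0 -leqn0 leqNgt prime_gt0 //= eqxx.
move=> /(_ (exist _ M MB) (exist _ h hB)) /(congr1 val) /= /matrixP /(_ 0 1).
rewrite !mxE !big_ord_recl !big_ord0 !mxE /= !(mul0r, mulr0, mulr1, mul1r, add0r, addr0).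
by move/eqP; rewrite (negPf tp).
Qed.

Lemma finite_part (S : forall s : nat, freeRing s -> Prop) :
  (exists2 p : nat, prime p & satisfies (U p) S)
   \/ (exists (p n i : nat) (pr_p : prime p) (n_gt1 : (1 < n)%N),
         (0 < i <= n - 1)%N /\ satisfies (B pr_p n_gt1 i) S)
   \/ (exists2 p : nat, prime p &
         exists A : nzRingType, in_calA p A /\ satisfies A S) ->
  exists A : finNzRingType,
     [/\ noncommutative A, satisfies A S,
         ideal_nonzero (commutator_ideal (R := A)) &
         ideal_nilpotent (commutator_ideal (R := A))].
Proof.
case=> [[p pr_p hU]|[[p [n [i [pr_p [n_gt1 [i_n hB]]]]]]|[p pr_p [A [hA AS]]]]].
- pose V : finNzRingType := U p.
  exact: (@finite_witness V S (@U_noncommutative p) hU (@U_square_zero p)).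
- pose V : finNzRingType := B pr_p n_gt1 i.
  exact: (@finite_witness V S (B_noncommutative i_n) hB (@B_square_zero _ _ _ _ _)).
have [s sA] := calA_finite pr_p hA; have [A' [f [g [fK gK]]]] := nz_finite sA.
apply: (@finite_witness A').
- case: hA => ncA _ commA'; apply: ncA => a b; apply: (can_inj fK).
  by rewrite !rmorphM commA'.
- by apply: satisfies_surj AS => u; exists (g u).
- move=> a b r c d; rewrite -(gK a) -(gK b) -(gK r) -(gK c) -(gK d).
  by rewrite -!(rmorph_commutator f) -!rmorphM (calA_square_zero hA) rmorph0.
Qed.

(** * An idempotent smallest ideal *)

(** The words X^k and, in [y_then_x], Y X^k are the ones that survive evaluations with X Y = Y Y =
    0. *)
Definition only_x (w : seq bool) : bool := all negb w.
Definition y_then_x (w : seq bool) : bool := if w is true :: w' then all negb w' else false.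

Lemma wev_annihilated (R : nzRingType) (e h : R) w : e * h = 0 -> h * h = 0 ->
  wev e h w = if only_x w then e ^+ size w
              else if y_then_x w then h * e ^+ (size w).-1 else 0.
Proof.
move=> eh hh; elim: w => [|t w IH]; first by rewrite wev_nil.
rewrite wev_cons IH /only_x; case: t => /=.
  case: ifP => // _; case: ifP => _; last by rewrite mulr0.
  by rewrite mulrA hh mul0r.
case: ifP => _; first by rewrite exprS.
by case: ifP => _; rewrite ?mulr0 // mulrA eh mul0r.
Qed.

Lemma lsum_annihilated (R : nzRingType) (e h : R) l : e * h = 0 -> h * h = 0 ->
  lsum e h l = lsum e 0 l +
    \sum_(zw <- l | y_then_x zw.2) zw.1%:~R * (h * e ^+ (size zw.2).-1).
Proof.
move=> eh hh; rewrite /lsum [X in _ + X]big_mkcond -big_split; apply: eq_bigr => -[z w] _ /=.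
rewrite !wev_annihilated ?mulr0 //.
case: ifP => [|_]; last by case: ifP => _; rewrite ?mul0r ?mulr0 ?addr0 ?add0r.
by case: w => [|[] w] //= _; rewrite addr0.
Qed.

Lemma lsum_x (R : nzRingType) (e : R) l :
  lsum e 0 l = \sum_(zw <- l | only_x zw.2) zw.1%:~R * e ^+ size zw.2.
Proof.
rewrite /lsum [RHS]big_mkcond; apply: eq_bigr => -[z w] _ /=.
rewrite wev_annihilated ?mulr0 //.
by case: ifP => // _; case: ifP => _; rewrite ?mul0r ?mulr0.
Qed.

(** An identity that fails in U_p is turned into one in two letters that fails at (e_22, e_12). Its
    value there is A0 + A1 e_22 + gamma e_12 with gamma the sum of the coefficients of the Y X^k,
    and evaluations in R force p to divide A0 and A1. *)
Lemma not_satisfies_U (R : nzRingType) (S : forall s : nat, freeRing s -> Prop)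
    (p : nat) :
  prime p -> satisfies R S -> ~ satisfies (U p) S ->
  (forall z : int, z%:~R = 0 :> R -> (p %| z)%Z) ->
  exists l : seq (int * seq bool),
  [/\ uniq (map snd l), forall a b : R, lsum a b l = 0 &
      ~~ (p %| \sum_(zw <- l | y_then_x zw.2) zw.1)%Z].
Proof.
move=> pr_p hR nU chR.
have [s [P [SP [r Pr]]]] : exists s P, S s P /\ exists r : 'I_s -> U p, peval r P <> 0.
  apply: contrapT => no; apply: nU => s P SP r; apply: contrapT => Pr; apply: no.
  by exists s, P; split=> //; exists r.
pose e : 'M['F_p]_2 := \matrix_(i, j) ((i == 1) && (j == 1))%:R.
pose h : 'M['F_p]_2 := \matrix_(i, j) ((i == 0) && (j == 1))%:R.
have eU : U_pred e by rewrite /U_pred mxE.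
have hU : U_pred h by rewrite /U_pred mxE.
pose E : U p := exist _ e eU; pose H : U p := exist _ h hU.
have E01 : lift ord0 ord0 = 1 :> 'I_2 by apply/val_inj.
have i01 (k : 'I_2) : k = 0 \/ k = 1.
  by case: k => [[|[|//]] ?]; [left|right]; apply/val_inj.
have Ueq (u v : U p) : val u 0 0 = val v 0 0 -> val u 0 1 = val v 0 1 ->
    val u 1 1 = val v 1 1 -> u = v.
  move=> u00 u01 u11; apply/val_inj/matrixP => i j.
  have u10 (t : U p) : val t 1 0 = 0 by exact/eqP/(valP t).
  by case: (i01 i) => ->; case: (i01 j) => ->; rewrite ?u10.
have EH : E * H = 0.
  by apply: Ueq; rewrite ?raddf0 /= ?mxE ?big_ord_recl ?big_ord0 ?mxE /= ?(mul0r, mulr0, addr0).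
have HH : H * H = 0.
  by apply: Ueq; rewrite ?raddf0 /= ?mxE ?big_ord_recl ?big_ord0 ?mxE /= ?(mul0r, mulr0, addr0).
have HE : H * E = H.
  by apply: Ueq; rewrite /= ?mxE ?big_ord_recl ?big_ord0 ?mxE /= ?(mul0r, mulr0, mulr1, add0r, addr0).
have EE : E * E = E.
  by apply: Ueq; rewrite /= ?mxE ?big_ord_recl ?big_ord0 ?mxE /= ?(mul0r, mulr0, mulr1, add0r, addr0).
have valz (z : int) : val (z%:~R : U p) = (z%:~R)%:M.
  by rewrite rmorph_int -(rmorph_int (scalar_mx)).
have FpE (t : 'F_p) : (t : nat)%:Z%:~R = t by rewrite -pmulrn natr_Zp.
pose al i : int := (val (r i) 0 0 : nat)%:Z.
pose be i : int := (val (r i) 1 1 : nat)%:Z.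
pose et i : int := (val (r i) 0 1 : nat)%:Z.
(* [Z i] takes the value [r i] at (E, H), because 1, E and H span U_p. *)
pose Z i : freeRing 2 := lsum varX varY [:: (al i, [::]); (be i - al i, [:: false]); (et i, [:: true])].
have evZ (A : nzRingType) (a b : A) i :
    ev2 a b (Z i) = (al i)%:~R + (be i - al i)%:~R * a + (et i)%:~R * b.
  rewrite ev2_lsum !lsum_cons lsum_nil !wev_cons wev_nil !mulr1 addr0.
  by rewrite addrA.
have [l ul lE] := ev2_list (peval Z P).
have evQ (A : nzRingType) (a b : A) : lsum a b l = peval (fun i => ev2 a b (Z i)) P.
  by rewrite -lE (peval_rmorph (ev2 a b)).
exists l; split=> // [a b|]; first by rewrite evQ; exact: hR.
have nz : lsum E H l <> 0.
  rewrite evQ (eq_peval _ (r' := r)) // => i; rewrite evZ.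
  apply: Ueq; rewrite !raddfD /= !valz !mxE ?big_ord_recl ?big_ord0 ?mxE /=;
    rewrite ?(mul0r, mulr0, mulr1, mulr1n, mulr0n, add0r, addr0) ?FpE //.
  by rewrite mulrNz FpE addrCA subrr addr0.
have zR (a : R) : lsum a 0 l = 0 by rewrite evQ; exact: hR.
have zU (z : int) : (p %| z)%Z -> z%:~R = 0 :> U p.
  move=> pz; apply/val_inj; rewrite valz raddf0.
  by move: pz; rewrite (dvdz_pcharf (pchar_Fp pr_p)) => /eqP ->; rewrite raddf0.
have Ex w : E ^+ size w = if w == [::] then 1 else E.
  by case: w => // t w /=; elim: (size w) => [|k IH]; rewrite ?expr1 // exprS IH EE.
(* The values of the identity at (0, 0) and (1, 0) in R are A0 and A0 + A1. *)
pose A0 := \sum_(zw <- l | only_x zw.2 && (zw.2 == [::])) zw.1.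
pose A1 := \sum_(zw <- l | only_x zw.2 && (zw.2 != [::])) zw.1.
have lsumE (T : nzRingType) (a : T) (b : T) : (forall w : seq bool, a ^+ size w = if w == [::] then 1 else b) ->
    lsum a 0 l = A0%:~R + A1%:~R * b.
  move=> aw; rewrite lsum_x (bigID (fun zw => zw.2 == [::])) /= !rmorph_sum mulr_suml.
  by congr (_ + _); apply: eq_bigr => zw /andP[_ zw0]; rewrite aw ?zw0 ?mulr1 // (negPf zw0).
have pA0 : (p %| A0)%Z.
  apply: chR; rewrite -(zR 0) (lsumE R 0 0) ?mulr0 ?addr0 //.
  by case=> [|t w] //=; rewrite expr0n.
have pA1 : (p %| A0 + A1)%Z.
  apply: chR; rewrite -(zR 1) (lsumE R 1 1) ?mulr1 ?intrD // => w.
  by rewrite expr1n; case: ifP.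
have pA1' : (p %| A1)%Z by rewrite -[A1](addKr A0) rpredD ?rpredN.
have HEk k : H * E ^+ k = H by elim: k => [|k IH]; rewrite ?mulr1 // exprS mulrA HE.
apply/negP => pg; apply: nz; rewrite lsum_annihilated // (lsumE _ E E) //.
rewrite !zU // mul0r !add0r.
rewrite (eq_bigr (fun zw => zw.1%:~R * H)) => [|[z w] _ /=]; last by rewrite HEk.
by rewrite -mulr_suml -rmorph_sum /= zU // mul0r.
Qed.

Definition prime_ideal_ring (R : pzRingType) (D : R -> Prop) : Prop :=
  forall a b, D a -> D b -> (forall x, D x -> a * x * b = 0) -> a = 0 \/ b = 0.

Lemma expr_annihilated (R : nzRingType) (s w : R) n : w * s = 0 ->
  (s + w) ^+ n = \sum_(i < n.+1) s ^+ i * w ^+ (n - i).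
Proof.
move=> ws; elim: n => [|n IH]; first by rewrite big_ord_recl big_ord0 addr0 mulr1.
rewrite exprS IH mulrDl [in X in X + _]mulr_sumr [RHS]big_ord_recl addrC.
congr (_ + _).
  rewrite mulr_sumr big_ord_recl big1 ?addr0 => [|i _].
    by rewrite !mul1r subn0 exprS.
  by rewrite /bump /= exprS !mulrA ws !mul0r.
by apply: eq_bigr => i _; rewrite /bump /= ?add1n subSS exprS mulrA.
Qed.

Lemma exprM_swap (R : nzRingType) (u x : R) n : u * (x * u) ^+ n = (u * x) ^+ n * u.
Proof.
elim: n => [|n IH]; first by rewrite mulr1 mul1r.
by rewrite exprSr mulrA IH exprSr !mulrA.
Qed.

(* The exponent n decreases when u is replaced by u (x u)^n. *)
Lemma levitzki (R : nzRingType) (D : R -> Prop) : is_ideal D ->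
  prime_ideal_ring D ->
  forall n u, D u -> (forall x, D x -> u * (x * u) ^+ n = 0) -> u = 0.
Proof.
move=> hD prD; elim=> [|n IH] u Du hu.
  by rewrite -[u]mulr1 -[1]/((0 * u) ^+ 0); apply: hu; exact: ideal0.
case: n IH hu => [|n] IH hu.
  have [x Dx|//|//] := prD u u Du Du.
  by rewrite -mulrA; exact: hu.
apply: contrapT => u0.
have [x0 [Dx0 v0]] : exists x0, D x0 /\ u * (x0 * u) ^+ n.+1 <> 0.
  apply: contrapT => no; apply: u0; apply: (IH u Du) => x Dx.
  by apply: contrapT => ux; apply: no; exists x.
set s := x0 * u in v0; set v := u * s ^+ n.+1 in v0.
have us : u * s ^+ n.+2 = 0 by exact: hu.
have vs : v * s = 0 by rewrite /v -mulrA -exprSr.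
have Dv : D v by apply: idealMr.
apply: v0; apply: (IH v Dv) => y Dy.
set Z := v * _; pose t := u * s ^+ n * y.
have ux0s k i : (u * x0) ^+ k * (u * s ^+ i) = u * s ^+ (k + i).
  by rewrite mulrA -exprM_swap -/s -mulrA -exprD.
(* Perturbing [x0] turns [s] into s + y v with v s = 0. After multiplication by (u x0)^n on the
   left, all but two terms of the expanded power contain u s^(n+2) = 0; the two that remain are Z
   and t Z. *)
have Zt : Z = - (t * Z).
  have Dx : D (x0 + y * u * s ^+ n * x0).
    by apply: (idealD hD) => //; apply: idealMl.
  have := hu _ Dx.
  have -> : (x0 + y * u * s ^+ n * x0) * u = s + y * v.
    by rewrite mulrDl -!mulrA -/s -exprSr.
  rewrite expr_annihilated; last by rewrite -mulrA vs mulr0.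
  move/(congr1 (fun a => (u * x0) ^+ n * a)); rewrite mulr0 !mulr_sumr.
  rewrite (eq_bigr (fun i : 'I_n.+3 => u * s ^+ (n + i) * (y * v) ^+ (n.+2 - i))) => [|i _]; last first.
    by rewrite -ux0s !mulrA.
  rewrite 2!big_ord_recl big1 => [|i _]; last first.
    rewrite /= /bump /= ?add1n.
    by rewrite !addnS -!addSn exprD [u * _]mulrA us !mul0r.
  rewrite addr0 /= /bump /= ?add1n addn0 addn1 subn0 subSS subn0 -/v -/Z.
  by rewrite [_ ^+ n.+2]exprS /t /Z !mulrA => /eqP; rewrite addrC addr_eq0 => /eqP.
(* The hypothesis at s^n y makes [t] nilpotent, and iterating Z = - t Z then gives Z = 0. *)
have tN : t ^+ n.+3 = 0.
  have -> : t = u * (s ^+ n * y) by rewrite /t mulrA.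
  rewrite exprSr mulrA -exprM_swap hu ?mul0r //.
  exact: idealMl.
have ZN k : Z = (- t) ^+ k * Z.
  elim: k => [|k IHk]; first by rewrite mul1r.
  by rewrite exprSr -mulrA mulNr -Zt.
by rewrite (ZN n.+3) exprNn tN mulr0 mul0r.
Qed.

(** * The product on a minimal ideal and its multiplication operators *)

Definition dmul (R : nzRingType) (D : R -> Prop) (hD : is_ideal D)
  (a b : ideal_type hD) : ideal_type hD := lm (val a) b.

Notation "a *i b" := (dmul a b) (at level 40, left associativity).

Section Product.
Variables (R : nzRingType) (M : minIdeal R).
Local Notation dT := (ideal_type (mi_ideal M)).
Local Notation K := (centroid M).
Implicit Types (a b d : dT) (k : K).

Lemma val_dmul a b : val (a *i b) = val a * val b. Proof. by []. Qed.

Lemma dmulA a b d : a *i (b *i d) = a *i b *i d.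
Proof. by apply/val_inj; rewrite !val_dmul mulrA. Qed.

Lemma dmulDl a b d : (a + b) *i d = a *i d + b *i d.
Proof. by apply/val_inj; rewrite !(val_dmul, raddfD) /= mulrDl. Qed.

Lemma dmulDr a b d : a *i (b + d) = a *i b + a *i d.
Proof. by apply/val_inj; rewrite !(val_dmul, raddfD) /= mulrDr. Qed.

Lemma dmul0l a : 0 *i a = 0.
Proof. by apply/val_inj; rewrite val_dmul raddf0 mul0r. Qed.

Lemma dmul0r a : a *i 0 = 0.
Proof. by apply/val_inj; rewrite val_dmul raddf0 mulr0. Qed.

Lemma dmulNl a b : (- a) *i b = - (a *i b).
Proof. by apply/val_inj; rewrite !(val_dmul, raddfN) /= mulNr. Qed.

Lemma dmulNr a b : a *i (- b) = - (a *i b).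
Proof. by apply/val_inj; rewrite !(val_dmul, raddfN) /= mulrN. Qed.

Lemma dmulBl a b d : (a - b) *i d = a *i d - b *i d.
Proof. by rewrite dmulDl dmulNl. Qed.

Lemma dmulBr a b d : a *i (b - d) = a *i b - a *i d.
Proof. by rewrite dmulDr dmulNr. Qed.

Lemma dmul_suml (I : Type) (r : seq I) (F : I -> dT) d :
  (\sum_(i <- r) F i) *i d = \sum_(i <- r) F i *i d.
Proof. by apply: (big_morph (fun a => a *i d)) => [a b|]; rewrite ?dmulDl ?dmul0l. Qed.

Lemma dmul_sumr (I : Type) (r : seq I) (F : I -> dT) d :
  d *i (\sum_(i <- r) F i) = \sum_(i <- r) d *i F i.
Proof. by apply: (big_morph (fun a => d *i a)) => [a b|]; rewrite ?dmulDr ?dmul0r. Qed.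

Lemma dscaleAl k a b : k *: (a *i b) = (k *: a) *i b.
Proof. by apply/val_inj; rewrite !val_dmul scale_val /dmul scale_lm. Qed.

Lemma dscaleAr k a b : k *: (a *i b) = a *i (k *: b).
Proof. by rewrite /dmul scale_lm. Qed.

Definition independent (I : finType) (a : I -> dT) : Prop :=
  forall k : I -> K, \sum_i k i *: a i = 0 -> forall i, k i = 0.

Section PrimeIdeal.
Hypothesis prD : prime_ideal_ring M.

Lemma dprime a b : (forall x, a *i x *i b = 0) -> a = 0 \/ b = 0.
Proof.
move=> ab; have [x Mx|a0|b0] := prD (ideal_typeP a) (ideal_typeP b).
- exact: (congr1 val (ab (to_ideal (mi_ideal M) Mx))).
- by left; apply/val_inj; rewrite raddf0.
- by right; apply/val_inj; rewrite raddf0.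
Qed.

Lemma dT_neq0 : exists d : dT, d <> 0.
Proof.
have [[x Mx x0] _] := mi_min M; exists (to_ideal (mi_ideal M) Mx) => x0'.
exact: x0 (congr1 val x0').
Qed.

(** D b D is an ideal of the whole ring, nonzero by primeness, so it is [D] by minimality. *)
Lemma generated_by b : b <> 0 -> forall d, exists l : seq (dT * dT),
  d = \sum_(xy <- l) xy.1 *i b *i xy.2.
Proof.
move=> b0 d; pose I r := exists l : seq (dT * dT),
  r = val (\sum_(xy <- l) xy.1 *i b *i xy.2).
have hI : is_ideal I.
  split.
  - by exists [::]; rewrite big_nil raddf0.
  - by move=> _ _ [l -> ] [m ->]; exists (l ++ m); rewrite big_cat raddfD.
  - move=> r _ [l ->]; exists [seq (lm r xy.1, xy.2) | xy <- l].
    rewrite big_map !raddf_sum mulr_sumr; apply: eq_bigr => xy _.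
    by rewrite /= !mulrA.
  - move=> _ r [l ->]; exists [seq (xy.1, rm xy.2 r) | xy <- l].
    rewrite big_map !raddf_sum mulr_suml; apply: eq_bigr => xy _.
    by rewrite /= !mulrA.
have IM r : I r -> M r by move=> [l ->]; exact: ideal_typeP.
have [l /val_inj dl] : I (val d); last by exists l.
apply: ((mi_min M).2 I hI IM _ _ (ideal_typeP d)); apply: contrapT => I0.
have bz x y : x *i b *i y = 0.
  apply: contrapT => xy; apply: I0; exists (val (x *i b *i y)).
    by exists [:: (x, y)]; rewrite big_seq1.
  by move=> h; apply: xy; apply/val_inj; rewrite h raddf0.
have [e e0] := dT_neq0.
have bx x : b *i x = 0.
  by have [y|//|//] := dprime (a := e) (b := b *i x); rewrite dmulA bz.
by have [x|//|//] := dprime (a := b) (b := e); rewrite bx dmul0l.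
Qed.

Section Domain.
Hypothesis dom : forall a b, a *i b = 0 -> a = 0 \/ b = 0.

Lemma dmulIl a b d : a <> 0 -> a *i b = a *i d -> b = d.
Proof.
move=> a0 /eqP; rewrite -subr_eq0 -dmulBr => /eqP /dom [//|/eqP].
by rewrite subr_eq0 => /eqP.
Qed.

Lemma dmulIr a b d : a <> 0 -> b *i a = d *i a -> b = d.
Proof.
move=> a0 /eqP; rewrite -subr_eq0 -dmulBl => /eqP /dom [/eqP|//].
by rewrite subr_eq0 => /eqP.
Qed.

(* The scalar b / b' sends x b' y to x b y. *)
Lemma scalar_of_exchange b b' : b' <> 0 ->
  (forall r, b *i r *i b' = b' *i r *i b) -> exists k : K, b = k *: b'.
Proof.
move=> b'0 ex.
have quot d : exists d', forall r, d' *i r *i b' = d *i r *i b.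
  have [l ->] := generated_by b'0 d.
  exists (\sum_(xy <- l) xy.1 *i b *i xy.2) => r.
  rewrite !dmul_suml; apply: eq_bigr => xy _.
  by rewrite -!dmulA; congr (_ *i _); rewrite !dmulA -!dmulA [xy.2 *i _]dmulA dmulA ex !dmulA.
have [f fP] := choice quot.
have f_uniq d e : (forall r, e *i r *i b' = d *i r *i b) -> f d = e.
  move=> eP; apply: (dmulIr b'0); apply: (dmulIr b'0).
  by rewrite fP eP.
have hf : bimodule_map f.
  split=> [d e|r d|d r]; apply: f_uniq => t.
  - by rewrite !dmulDl !fP.
  - have lmE (u v w : dT) : lm r u *i v *i w = lm r (u *i v *i w).
      by apply/val_inj; rewrite !val_dmul /= !mulrA.
    by rewrite !lmE fP.
  - have rmE (u v w : dT) : rm u r *i v *i w = u *i lm r v *i w.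
      by apply/val_inj; rewrite !val_dmul /= !mulrA.
    by rewrite !rmE fP.
exists (to_centroid hf); apply/esym; apply: f_uniq => r; exact: ex.
Qed.

(* A linear dependence among b's in an operator x |-> sum a_i x b_i can be used to
   shorten it without leaving a class of operators closed under the obvious
   operations: either every b_i is a scalar multiple of b_0, or some commutator
   b_i r b_0 - b_0 r b_i survives. *)
Lemma one_term_operator (C : (dT -> dT) -> Prop) :
  (forall f g, C f -> C g -> C (fun x => f x - g x)) ->
  (forall f r, C f -> C (fun x => f x *i r)) ->
  (forall f r, C f -> C (fun x => f (x *i r))) ->
  forall n (a b : 'I_n -> dT), independent a -> (exists i, b i <> 0) ->
    C (fun x => \sum_i a i *i x *i b i) ->
  exists a b, [/\ a <> 0, b <> 0 & C (fun x => a *i x *i b)].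
Proof.
move=> CB Cr Cl; elim=> [|n IH] a b ia [i0 bi0]; first by case: (i0).
have ia' : independent (fun i => a (lift ord0 i)).
  move=> k sk i; pose k' j := if unlift ord0 j is Some i then k i else 0.
  have := ia k'; rewrite big_ord_recl /k' unlift_none scale0r add0r.
  under eq_bigr => j _ do rewrite liftK.
  by move=> /(_ sk (lift ord0 i)); rewrite liftK.
have [b0|b0] := pselect (b ord0 = 0).
  move=> Cab; apply: (IH (fun i => a (lift ord0 i)) (fun i => b (lift ord0 i))) => //.
    case: (unliftP ord0 i0) bi0 => [j ->|->]; last by rewrite b0.
    by exists j.
  rewrite (_ : (fun x => _) = fun x => \sum_i a i *i x *i b i) //.
  by apply/funext => x; rewrite big_ord_recl b0 dmul0r add0r.
move=> Cab.
have [[r [i ri]]|ex] := pselect (exists r i,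
    b (lift ord0 i) *i r *i b ord0 - b ord0 *i r *i b (lift ord0 i) <> 0).
  apply: (IH (fun i => a (lift ord0 i))
             (fun i => b (lift ord0 i) *i r *i b ord0 - b ord0 *i r *i b (lift ord0 i))) => //.
    by exists i.
  (* The operator f(x) r b_0 - f(x b_0 r) has lost the term of index 0. *)
  have := CB _ _ (Cr _ (r *i b ord0) Cab) (Cl _ (b ord0 *i r) Cab).
  rewrite (_ : (fun x => _) = fun x => \sum_(i < n) a (lift ord0 i) *i x *i
    (b (lift ord0 i) *i r *i b ord0 - b ord0 *i r *i b (lift ord0 i))) //.
  apply/funext => x; rewrite !big_ord_recl dmulDl opprD addrACA !dmulA subrr add0r.
  rewrite !dmul_suml -sumrB; apply: eq_bigr => j _.
  by rewrite dmulBr !dmulA.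
have kP i : exists k : K, b (lift ord0 i) = k *: b ord0.
  apply: scalar_of_exchange => // r; apply/eqP; rewrite -subr_eq0; apply/eqP.
  by apply: contrapT => nr; apply: ex; exists r, i.
have [k kE] := choice kP.
(* All b_i are multiples of b_0, so the operator collapses to one term. Its left factor has
   coefficient 1 at a_0 and is nonzero by independence. *)
exists (a ord0 + \sum_i k i *: a (lift ord0 i)), (b ord0); split=> //.
  move=> a0; pose k' j := if unlift ord0 j is Some i then k i else 1.
  have := ia k'; rewrite big_ord_recl /k' unlift_none scale1r.
  under eq_bigr => j _ do rewrite liftK.
  by move=> /(_ a0 ord0); rewrite unlift_none => /eqP; rewrite oner_eq0.
move: Cab; rewrite (_ : (fun x => _) = fun x =>
  (a ord0 + \sum_i k i *: a (lift ord0 i)) *i x *i b ord0) //.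
apply/funext => x; rewrite big_ord_recl !dmulDl !dmul_suml; congr (_ + _).
by apply: eq_bigr => i _; rewrite kE -dscaleAr dscaleAl dscaleAl.
Qed.

(** Shortened within the class of zero operators, it would give a' x b' = 0 for all x, which fails
    in a domain at x = a'. *)
Lemma independent_operator n (a b : 'I_n -> dT) : independent a ->
  (forall x, \sum_i a i *i x *i b i = 0) -> forall i, b i = 0.
Proof.
move=> ia ab i; apply: contrapT => bi.
have [|||||a' [b' [a0 b0 ab']]] := @one_term_operator (fun f => forall x, f x = 0) _ _ _ n a b ia.
- by move=> f g f0 g0 x; rewrite f0 g0 subrr.
- by move=> f r f0 x; rewrite f0 dmul0l.
- by move=> f r f0 x.
- by exists i.
- by [].
have /dom[|//] := ab' a'; by move=> /dom[].
Qed.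

End Domain.
End PrimeIdeal.
End Product.

(** * Reduction to a domain *)

Definition finitely_many (T : eqType) : Prop := exists s : seq T, forall x, x \in s.

(** * Separating homogeneous components over an infinite field *)

Section Vandermonde.
Variables (F : fieldType) (V : lmodType F).
Hypothesis infF : ~ finitely_many F.

Lemma distinct_elements n : exists2 s : seq F, uniq s & size s = n.
Proof.
elim: n => [|n [s us sn]]; first by exists [::].
have [x xs] : exists x, x \notin s.
  apply: contrapT => h; apply: infF; exists s => x; apply: contrapT => /negP xs.
  by apply: h; exists x.
by exists (x :: s); rewrite /= ?xs ?sn.
Qed.

Lemma vandermonde n (v : 'I_n -> V) :
  (forall s : F, \sum_(i < n) s ^+ i *: v i = 0) -> forall i, v i = 0.
Proof.
move=> hv k; have [s us sn] := distinct_elements n.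
pose a : 'rV[F]_n := \row_j s`_j.
have inv : Vandermonde n a \in unitmx.
  rewrite unitmxE det_Vandermonde unitfE; apply/prodf_neq0 => i _.
  apply/prodf_neq0 => j ij; rewrite !mxE subr_eq0 nth_uniq ?sn //.
  by rewrite neq_ltn ij orbT.
pose W := invmx (Vandermonde n a).
have VW (i : 'I_n) : \sum_j a 0 j ^+ i * W j k = (i == k)%:R.
  have /matrixP/(_ i k) := mulmxV inv; rewrite !mxE => <-.
  by apply: eq_bigr => j _; rewrite !mxE.
have -> : v k = \sum_i (i == k)%:R *: v i.
  rewrite (bigD1 k) //= eqxx scale1r big1 ?addr0 // => i /negPf ->.
  by rewrite scale0r.
under eq_bigr => i _ do rewrite -VW scaler_suml.
rewrite exchange_big big1 // => j _ /=.
rewrite (eq_bigr (fun i : 'I_n => W j k *: (a 0 j ^+ i *: v i))) => [|i _].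
  by rewrite -scaler_sumr hv scaler0.
by rewrite scalerA mulrC.
Qed.

Lemma vandermonde_group (I : eqType) (l : seq I) (f : I -> nat) (v : I -> V) :
  (forall s : F, \sum_(w <- l) s ^+ f w *: v w = 0) ->
  forall i, \sum_(w <- l | f w == i) v w = 0.
Proof.
move=> hv i; pose B := (\sum_(w <- l) f w).+1.
have fB w : w \in l -> (f w < B)%N.
  by move=> wl; rewrite ltnS /B (big_rem w) //= leq_addr.
have hB s : \sum_(j < B) s ^+ j *: (\sum_(w <- l | f w == j) v w) = 0.
  rewrite -[RHS](hv s).
  under eq_bigr => j _ do rewrite scaler_sumr.
  rewrite (exchange_big_dep xpredT) //= big_seq [RHS]big_seq; apply: eq_bigr => w wl.
  by rewrite (big_pred1 (Ordinal (fB w wl))).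
have [iB|Bi] := ltnP i B; first exact: (vandermonde hB (Ordinal iB)).
rewrite big_seq_cond big1 // => w /andP[/fB wB /eqP wi].
by move: wB; rewrite wi ltnNge Bi.
Qed.

End Vandermonde.

Lemma pigeonhole_powers (F : finFieldType) (f : {poly F}) : f != 0 ->
  exists i c, (0 < c)%N /\ f %| 'X^(i + c) - 'X^i.
Proof.
move=> f0; pose N := #|{: 'rV[F]_(size f)}|.
pose r (k : 'I_N.+1) : 'rV[F]_(size f) := poly_rV ('X^k %% f).
have rK k : rVpoly (r k) = 'X^k %% f.
  by apply: poly_rV_K; apply: ltnW; rewrite ltn_modp.
have [inj|] := boolP (injectiveb r).
  by have := leq_card r (injectiveP _ inj); rewrite card_ord ltnn.
move=> /injectivePn [i [j ij rij]].
have eij : 'X^i %% f = 'X^j %% f.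
  by rewrite -[LHS]rK -[RHS]rK rij.
wlog lt_ij : i j ij {rij} eij / (i < j)%N.
  move=> h; have := ij; rewrite -val_eqE neq_ltn => /orP[/(h i j ij eij)//|].
  by apply: h; rewrite // eq_sym.
exists i, (j - i)%N; rewrite subn_gt0; split=> //.
by rewrite subnKC ?(ltnW lt_ij) // /dvdp modpD modpN eij subrr.
Qed.

(** The exponent [i * c] is a multiple of the period and, when [c] is positive, not below the
    preperiod [i]. *)
Lemma power_periodic (R : nzRingType) (t : R) i c : t ^+ (i + c) = t ^+ i ->
  t ^+ (i * c) * t ^+ (i * c) = t ^+ (i * c).
Proof.
case: c => [|c] tc; first by rewrite muln0 mulr1.
have step n : (i <= n)%N -> t ^+ (n + c.+1) = t ^+ n.
  by move=> i_n; rewrite -(subnK i_n) -addnA !exprD -[t ^+ i * _]exprD tc.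
have per n k : (i <= n)%N -> t ^+ (n + k * c.+1) = t ^+ n.
  move=> i_n; elim: k => [|k IH]; first by rewrite addn0.
  by rewrite mulSn addnCA addnC step // (leq_trans i_n) ?leq_addr.
by rewrite -exprD per // leq_pmulr.
Qed.

Section Prime.
Variables (R : nzRingType) (M : minIdeal R) (l : seq (int * seq bool)).
Local Notation dT := (ideal_type (mi_ideal M)).
Local Notation K := (centroid M).
Hypothesis prD : prime_ideal_ring M.
Hypothesis faithful : forall z : R, (forall d : dT, lm z d = 0) -> z = 0.
Hypothesis l_id : forall a b : R, lsum a b l = 0.
Hypothesis gamma_neq0 : (\sum_(zw <- l | y_then_x zw.2) zw.1)%:~R != 0 :> K.

Lemma lm_sum (I : Type) (r : seq I) (P : pred I) (F : I -> R) (d : dT) :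
  lm (\sum_(i <- r | P i) F i) d = \sum_(i <- r | P i) lm (F i) d.
Proof.
apply: (big_morph (fun z => lm z d)) => [a b|]; first by rewrite lmDl.
by apply/val_inj; exact: mul0r.
Qed.

Lemma lm_int (z : int) (a : R) (d : dT) : lm (z%:~R * a) d = (z%:~R : K) *: lm a d.
Proof. by rewrite scaler_int; apply/val_inj; rewrite raddfMz /= -mulrA mulrzl. Qed.

Lemma lm_val (e d : dT) : lm (val e) d = e *i d. Proof. by []. Qed.

Lemma lm0 (d : dT) : lm 0 d = 0.
Proof. by apply/val_inj; exact: mul0r. Qed.

Lemma lm0r (r : R) : lm r (0 : dT) = 0.
Proof. by apply/val_inj; exact: mulr0. Qed.

Let xs (w : seq bool) := count negb w.
Let ys (w : seq bool) := count id w.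

Lemma lm_wev_scale (s t : K) (e h d : dT) w :
  lm (wev (val (s *: e)) (val (t *: h)) w) d =
  s ^+ xs w *: (t ^+ ys w *: lm (wev (val e) (val h) w) d).
Proof.
have key (k k' : K) (a b : dT) : lm (val (k *: a)) (k' *: b) = (k * k') *: lm (val a) b.
  by rewrite !lm_val -dscaleAl -dscaleAr scalerA.
elim: w => [|b w IH]; first by rewrite !wev_nil !expr0 !scale1r.
rewrite !wev_cons !lmA IH /xs /ys !scalerA.
case: b => /=; rewrite add0n add1n key exprS; congr (_ *: _).
by rewrite mulrCA.
Qed.

Section InfiniteCentroid.
Hypothesis infK : ~ finitely_many K.

Lemma homogeneous_part (e h d : dT) i j :
  \sum_(zw <- l | (xs zw.2 == i) && (ys zw.2 == j))
     (zw.1%:~R : K) *: lm (wev (val e) (val h) zw.2) d = 0.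
Proof.
rewrite -big_filter_cond; apply: (vandermonde_group infK (f := fun zw => ys zw.2)) => t.
rewrite big_filter; pose v zw := t ^+ ys zw.2 *: ((zw.1%:~R : K) *: lm (wev (val e) (val h) zw.2) d).
rewrite (vandermonde_group infK (f := fun zw => xs zw.2) (v := v)) // => s.
have := congr1 (fun z => lm z d) (l_id (val (s *: e)) (val (t *: h))).
rewrite lm0 /lsum lm_sum => h0; rewrite -[RHS]h0; apply: eq_bigr => zw _.
by rewrite lm_int lm_wev_scale /v !scalerA; congr (_ *: _); rewrite mulrC mulrA.
Qed.

Lemma wev_linear (a b : R) w : ys w = 1%N ->
  wev a b w = a ^+ index true w * b * a ^+ (xs w - index true w).
Proof.
rewrite /xs /ys; elim: w => // -[] w IH /=.
  move=> [w0]; rewrite wev_cons mul1r; congr (_ * _); rewrite subn0 add0n.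
  elim: w w0 {IH} => [|[] w IHw] //= w0; rewrite ?wev_nil // wev_cons IHw //.
  by rewrite add1n exprS.
rewrite add0n wev_cons => w1; rewrite IH // add1n subSS exprS !mulrA.
by [].
Qed.

(** The nonzero sum over all words Y X^k splits according to k, so it is nonzero for some k = m. The
    component of degree m in X and 1 in Y is the identity, and [g 0] is its coefficient at Y X^m. *)
Lemma homogeneous_identity : exists m (g : nat -> K), g 0 != 0 /\
  forall e h d : dT,
    \sum_(a < m.+1) g a *: lm (val e ^+ a * val h * val e ^+ (m - a)) d = 0.
Proof.
pose g m a : K := \sum_(zw <- l | ((xs zw.2 == m) && (ys zw.2 == 1%N)) && (index true zw.2 == a)) zw.1%:~R.
have [m gm] : exists m, g m 0 != 0.
  apply: contrapT => no; case/negP: gamma_neq0; apply/eqP.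
  pose B := (\sum_(zw <- l) xs zw.2).+1.
  have xB zw : zw \in l -> (xs zw.2 < B)%N.
    by move=> zwl; rewrite ltnS /B (big_rem zw) //= leq_addr.
  rewrite (_ : _%:~R = \sum_(m < B) g m 0); last first.
    rewrite /g (exchange_big_dep (fun zw => (ys zw.2 == 1%N) && (index true zw.2 == 0%N))) /=; last first.
      by move=> m zw _ /andP[/andP[_ ->] ->].
    rewrite rmorph_sum [LHS]big_seq_cond [RHS]big_seq_cond; apply: eq_big => [[z w]|zw /andP[zwl yx]] /=.
      congr (_ && _); rewrite /ys; case: w => [|[] w] //=; last by rewrite andbF.
      by rewrite add1n eqSS andbT; elim: w => //= -[].
    have yx' : (ys zw.2 == 1%N) && (index true zw.2 == 0%N).
      case: zw yx {zwl} => z [|[] w] //=; rewrite /ys /= add1n eqSS andbT.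
      by elim: w => //= -[].
    rewrite (big_pred1 (Ordinal (xB zw zwl))) // => i /=; move/andP: yx' => [-> ->].
    by rewrite !andbT eq_sym.
  by rewrite big1 // => m _; apply: contrapT => /eqP gm; apply: no; exists (val m).
exists m, (g m); split=> // e h d.
rewrite -[RHS](homogeneous_part e h d m 1).
under eq_bigr => a _ do rewrite /g scaler_suml.
rewrite (exchange_big_dep (fun zw => (xs zw.2 == m) && (ys zw.2 == 1%N))) /=; last first.
  by move=> a zw _ /andP[-> _].
apply: eq_bigr => zw /andP[/eqP xm /eqP y1].
have im : (index true zw.2 < m.+1)%N.
  rewrite -xm; move: y1; rewrite /xs /ys; elim: (zw.2) => //= -[] w IH //=.
rewrite (big_pred1 (Ordinal im)) => [|i]; last by rewrite /= xm y1 !eqxx.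
by rewrite (wev_linear _ _ y1) xm.
Qed.

End InfiniteCentroid.
End Prime.

Lemma finite_field_pchar (F : fieldType) : finitely_many F -> exists p, p \in [pchar F].
Proof.
move=> [s0 sF0]; pose s := undup s0; have sF x : x \in s by rewrite mem_undup.
pose f (i : 'I_(size s).+1) : seq_sub s := SeqSub (sF (i : nat)%:R).
have [inj|] := boolP (injectiveb f).
  by have := leq_card f (injectiveP _ inj); rewrite card_ord card_seq_sub ?undup_uniq ?ltnn.
move=> /injectivePn [i [j ij /(congr1 val) /= fij]].
wlog lt_ij : i j ij fij / (i < j)%N.
  move=> h; have := ij; rewrite -val_eqE neq_ltn => /orP[/(h i j ij fij)//|].
  by apply: h; rewrite // eq_sym.
apply: (@natf0_pchar _ (j - i)); first by rewrite subn_gt0.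
by rewrite natrB 1?ltnW // fij subrr.
Qed.

Lemma polyev_sum (R : nzRingType) (e : R) f :
  polyev e f = \sum_(i < size f) (f`_i)%:~R * e ^+ i.
Proof.
rewrite -{1}[f]coefK poly_def rmorph_sum; apply: eq_bigr => i _ /=.
by rewrite -mul_polyC rmorphM /= polyevC rmorphXn /= polyevX.
Qed.

Lemma polyev_mod (R : nzRingType) (p : nat) (h e : R) (f g : {poly int}) :
  prime p -> p%:R * h = 0 ->
  map_poly intr f = map_poly intr g :> {poly 'F_p} ->
  h * polyev e f = h * polyev e g.
Proof.
move=> pr_p ph fg; apply/eqP; rewrite -subr_eq0 -mulrBr -(rmorphB (polyev e)) /= polyev_sum.
rewrite mulr_sumr big1 // => i _.
have /dvdzP [z ->] : (p %| (f - g)`_i)%Z.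
  rewrite (dvdz_pcharf (pchar_Fp pr_p)) -coef_map_id0 ?rmorph0 //.
  by rewrite rmorphB /= fg subrr coef0.
have ph' : p%:Z%:~R * h = 0 by exact: ph.
by rewrite mulrA commr_int intrM -[_ * h]mulrA ph' mulr0 mul0r.
Qed.

Lemma int_poly_lift (p : nat) (f : {poly 'F_p}) : exists g : {poly int}, map_poly intr g = f.
Proof.
exists (\poly_(i < size f) (nat_of_ord f`_i)%:Z); apply/polyP => i.
rewrite coef_map_id0 ?rmorph0 // coef_poly; case: ltnP => [_|h]; last by rewrite nth_default.
by rewrite -pmulrn natr_Zp.
Qed.

Section Prime.
Variables (R : nzRingType) (M : minIdeal R) (l : seq (int * seq bool)).
Local Notation dT := (ideal_type (mi_ideal M)).
Local Notation K := (centroid M).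
Hypothesis prD : prime_ideal_ring M.
Hypothesis faithful : forall z : R, (forall d : dT, lm z d = 0) -> z = 0.
Hypothesis l_id : forall a b : R, lsum a b l = 0.
Hypothesis gamma_neq0 : (\sum_(zw <- l | y_then_x zw.2) zw.1)%:~R != 0 :> K.

(** At e = r h every term with a positive left power of [e] contains h h. What remains is h (r h)^m
    = 0, the hypothesis of [levitzki]. *)
Lemma infinite_square_zero (h : R) : ~ finitely_many K -> M h -> h * h = 0 -> h = 0.
Proof.
move=> infK Mh hh; have [m [g [g0 gE]]] := homogeneous_identity l_id gamma_neq0 infK.
apply: (levitzki (mi_ideal M) prD (n := m)) => // r Mr.
apply: faithful => d.
have Me : M (r * h) by apply: (idealMr (mi_ideal M)).
have := gE (to_ideal _ Me) (to_ideal _ Mh) d; rewrite big_ord_recl big1 => [|i _].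
  rewrite addr0 /= expr0 mul1r subn0 => /eqP; rewrite scaler_eq0 (negPf g0).
  by move/eqP.
rewrite /= exprSr -[_ * h]mulrA -[r * h * h]mulrA hh !mulr0 mul0r.
by rewrite lm0 scaler0.
Qed.

(** The identity at (r h, h) becomes h G(r h) = 0, and G is nonzero modulo p because G(1) is the sum
    gamma of the coefficients of the words Y X^k. Since G divides some X^(i+c) - X^i modulo p, a
    power of r h is an idempotent eps in D h. Then 0 = eps G(eps) = gamma eps, so eps = 0 and
    [levitzki] applies. *)
Lemma finite_square_zero (h : R) : finitely_many K -> M h -> h * h = 0 -> h = 0.
Proof.
move=> /finite_field_pchar [p chp] Mh hh; have pr_p := pcharf_prime chp.
have pD r : M r -> p%:R * r = 0.
  move=> Mr; have := val_int p (to_ideal (mi_ideal M) Mr); rewrite -scaler_intl.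
  by rewrite -!pmulrn (pcharf0 chp) scale0r raddf0 => /esym.
pose G : {poly int} := \sum_(zw <- l | y_then_x zw.2) zw.1%:P * 'X^((size zw.2).-1).
have G1 : G.[1] = \sum_(zw <- l | y_then_x zw.2) zw.1.
  rewrite /G horner_sum; apply: eq_bigr => zw _.
  by rewrite hornerM hornerC hornerXn expr1n mulr1.
have hG r : M r -> h * polyev (r * h) G = 0.
  move=> Mr; have eh : r * h * h = 0 by rewrite -mulrA hh mulr0.
  have := l_id (r * h) h; rewrite lsum_annihilated // l_id add0r => <-.
  rewrite rmorph_sum mulr_sumr; apply: eq_bigr => zw _.
  rewrite rmorphM /= polyevC rmorphXn /= polyevX mulrA.
  by rewrite commr_int mulrA.
have Gp : map_poly intr G != 0 :> {poly 'F_p}.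
  apply: contraNneq gamma_neq0 => Gp; rewrite -(dvdz_pcharf chp).
  rewrite (dvdz_pcharf (pchar_Fp pr_p)) -G1.
  by rewrite -[1]/(1%:~R) -horner_map /= Gp horner0.
have [i [c [c0 /dvdpP [q qE]]]] := pigeonhole_powers Gp.
have [Q Qq] := int_poly_lift q.
have per r : M r -> (r * h) ^+ (i.+1 + c) = (r * h) ^+ i.+1.
  move=> Mr; apply/eqP; rewrite addSn !exprS -!mulrA -subr_eq0 -!mulrBr.
  have : h * polyev (r * h) ('X^(i + c) - 'X^i) = h * polyev (r * h) (G * Q).
    apply: (polyev_mod _ pr_p (pD _ Mh)).
    by rewrite rmorphB /= !map_polyXn qE rmorphM /= Qq mulrC.
  rewrite rmorphB !rmorphXn /= polyevX rmorphM mulrA hG // mul0r => ->.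
  by rewrite mulr0.
apply: (levitzki (mi_ideal M) prD (n := i.+1 * c)) => // r Mr.
have eps0 : (r * h) ^+ (i.+1 * c) = 0.
  have /power_periodic := per r Mr; set eps := _ ^+ _ => idem.
  have [r' Mr' epsE] : exists2 r', M r' & eps = r' * h.
    exists ((r * h) ^+ (i.+1 * c).-1 * r); first exact: (idealMl (mi_ideal M)).
    by rewrite -mulrA -exprSr prednK ?muln_gt0.
  have Meps : M eps by rewrite epsE; apply: (idealMr (mi_ideal M)).
  have eG : eps * polyev eps G = 0 by rewrite {1}epsE -mulrA epsE hG // mulr0.
  have := @polyev_mulr _ eps G eps 1; rewrite mulr1 eG G1 => /(_ idem).
  move=> /esym; rewrite commr_int.
  have := val_int (\sum_(zw <- l | y_then_x zw.2) zw.1) (to_ideal (mi_ideal M) Meps).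
  rewrite -scaler_intl => <- e0.
  have /eqP : (\sum_(zw <- l | y_then_x zw.2) zw.1)%:~R *: to_ideal (mi_ideal M) Meps = 0 :> dT.
    by apply/val_inj; rewrite e0 raddf0.
  rewrite scaler_eq0 (negPf gamma_neq0) => /eqP/(congr1 val).
  by rewrite raddf0.
by rewrite eps0 mulr0.
Qed.

(** If a b = 0, each b x a has square zero, hence vanishes, and primeness concludes. *)
Lemma ideal_domain (a b : dT) : a *i b = 0 -> a = 0 \/ b = 0.
Proof.
move=> ab; apply: contrapT => nab; have hprod x : b *i x *i a = 0.
  have hh : val (b *i x *i a) * val (b *i x *i a) = 0.
    by rewrite -val_dmul dmulA -[b *i x *i a *i (b *i x)]dmulA [a *i (b *i x)]dmulA ab !(dmul0l, dmul0r) raddf0.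
  have Mh := ideal_typeP (b *i x *i a).
  apply/val_inj; rewrite raddf0; have [fK|iK] := pselect (finitely_many K).
    exact: finite_square_zero.
  exact: infinite_square_zero.
by have [b0|a0] := dprime prD hprod; apply: nab; [right|left].
Qed.

End Prime.

(** * Infinite centroid *)

(* If [e, y] = u <> 0 commutes with e, then w = y u^-1 e satisfies [e, w] = e. *)
Lemma engel_division_commutative (R : nzRingType) j :
  (forall r : R, r <> 0 -> exists r', r * r' = 1) ->
  (forall e h : R, iter j (comm e) h = 0) -> forall a b : R, comm a b = 0.
Proof.
move=> inv engel e h; apply: contrapT => eh.
have invl (r r' : R) : r * r' = 1 -> r' * r = 1.
  move=> rr'; have [|r'' r''E] := inv r'.
    by move=> r'0; move: rr'; rewrite r'0 mulr0 => /esym/eqP; rewrite oner_eq0.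
  by rewrite -[r](mulr1) -r''E [r * _]mulrA rr' mul1r.
(* Climb the iterated commutators of [h] up to the last nonzero one. *)
have [y [ey eey]] : exists y, comm e y <> 0 /\ comm e (comm e y) = 0.
  elim: j h eh {engel} (engel e h) => [|k IH] h eh /=.
    by move=> h0; case: eh; rewrite h0 /comm mulr0 mul0r subrr.
  have [k0|k0] := pselect (comm e (comm e h) = 0); first by exists h.
  by rewrite -iterS iterSr; exact: IH.
set u := comm e y in ey eey.
have [u' uu'] := inv u ey; have u'u := invl _ _ uu'.
have eu : e * u = u * e by apply/eqP; rewrite -subr_eq0; apply/eqP.
have eu' : e * u' = u' * e.
  by rewrite -[e * u']mul1r -u'u -!mulrA [u * (e * _)]mulrA -eu -mulrA uu' mulr1.
pose w := y * u' * e.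
have ew : e * w - w * e = e.
  have -> : w * e = y * e * u' * e by rewrite /w -[y * u' * e]mulrA -eu' mulrA.
  by rewrite /w !mulrA -!mulrBl -[_ - _]/u uu' mul1r.
(* From [e, w] = e, commutation with [w] only changes the sign of [e], which contradicts the Engel
   identity at [(w, e)]. *)
have we k : iter k (comm w) e = (-1) ^+ k * e.
  elim: k => [|k IH]; first by rewrite mul1r.
  rewrite iterS IH exprS !mulNr mul1r -[in RHS]ew -signr_odd !mulr_sign.
  by case: odd; rewrite /comm ?mulrN ?mulNr -?opprD opprB // opprK addrC.
have /eqP := engel w e; rewrite we -signr_odd mulr_sign; case: odd; rewrite ?oppr_eq0 => /eqP e0;
  by apply: ey; rewrite /u /comm e0 mulr0 mul0r subrr.
Qed.

(** Left multiplication by [e] is the sum of [comm e] and right multiplication by [e], which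
    commute; this is the binomial formula. The bound [N] is free so that sums for different
    exponents share one range. *)
Lemma comm_iter_expr (R : nzRingType) (e h : R) a N : (a < N)%N ->
  e ^+ a * h = \sum_(j < N) iter j (comm e) h * e ^+ (a - j) *+ 'C(a, j).
Proof.
elim: a N => [|a IH] N aN.
  case: N aN => // N _; rewrite big_ord_recl big1 => [|i _]; last by rewrite bin0n mulr0n.
  by rewrite /= mulr1 mul1r mulr1n addr0.
case: N aN => // N; rewrite ltnS => aN.
have step j : e * (iter j (comm e) h * e ^+ (a - j) *+ 'C(a, j)) =
    iter j.+1 (comm e) h * e ^+ (a.+1 - j.+1) *+ 'C(a, j) +
    iter j (comm e) h * e ^+ (a.+1 - j) *+ 'C(a, j).
  have [ja|aj] := leqP j a; last by rewrite bin_small // !mulr0n mulr0 addr0.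
  rewrite -mulrnDl subSS mulrnAr mulrA; congr (_ *+ _).
  by rewrite /= /comm mulrBl subSn // exprS !mulrA subrK.
rewrite exprS -mulrA (IH N aN) mulr_sumr.
under eq_bigr => j _ do rewrite step.
rewrite big_split /= [RHS]big_ord_recl.
under [in RHS]eq_bigr => i _ do rewrite /= /bump add1n binS mulrnDr.
rewrite big_split /= addrC [RHS]addrA; congr (_ + _).
have -> : \sum_(i < N) iter i (comm e) h * e ^+ (a.+1 - i) *+ 'C(a, i) =
  \sum_(i < N.+1) iter i (comm e) h * e ^+ (a.+1 - i) *+ 'C(a, i).
  by rewrite big_ord_recr /= bin_small // mulr0n addr0.
by rewrite big_ord_recl /= !bin0.
Qed.

Lemma exprDn_widen (R : nzRingType) (x y : R) n N : x * y = y * x -> (n < N)%N ->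
  (x + y) ^+ n = \sum_(i < N) x ^+ (n - i) * y ^+ i *+ 'C(n, i).
Proof.
move=> xy nN; rewrite exprDn_comm //.
rewrite (big_ord_widen N (fun i => x ^+ (n - i) * y ^+ i *+ 'C(n, i))) // big_mkcond.
by apply: eq_bigr => i _; case: ltnP => // ni; rewrite bin_small.
Qed.

Section FullIdeal.
Variables (R : nzRingType) (M : minIdeal R).
Local Notation dT := (ideal_type (mi_ideal M)).
Local Notation K := (centroid M).
Hypothesis faithful : forall z : R, (forall d : dT, lm z d = 0) -> z = 0.
Hypothesis dom : forall a b : dT, a *i b = 0 -> a = 0 \/ b = 0.
Hypothesis onto : forall e : dT, e <> 0 -> forall d, exists d', e *i d' = d.

(** Solving e v = e and cancelling [e] makes [v] a left unit of [D]; then v - 1 kills [D], and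
    faithfulness gives v = 1. *)
Lemma ideal_unit : exists v : dT, val v = 1 /\ forall e : dT, e <> 0 -> exists d, e *i d = v.
Proof.
have [e e0] := dT_neq0 M; have [v ev] := onto e0 e.
have vv x : v *i x = x by apply: (dmulIl dom e0); rewrite dmulA ev.
exists v; split; last by move=> e' /onto.
apply/eqP; rewrite -subr_eq0; apply/eqP; apply: faithful => d.
by apply/val_inj; rewrite raddf0 val_lm mulrBl mul1r -[val v * _]/(val (v *i d)) vv subrr.
Qed.

Lemma ideal_full (r : R) : M r.
Proof.
have [v [v1 _]] := ideal_unit; rewrite -[r]mulr1 -v1.
by apply: (idealMl (mi_ideal M)); exact: ideal_typeP.
Qed.

Lemma full_inverse (r : R) : r <> 0 -> exists r', r * r' = 1.
Proof.
move=> r0; have [v [v1 inv]] := ideal_unit.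
have [|d rd] := inv (to_ideal (mi_ideal M) (ideal_full r)).
  by move=> /(congr1 val); rewrite raddf0.
by exists (val d); rewrite -v1 -rd.
Qed.

Lemma full_domain (a b : R) : a * b = 0 -> a = 0 \/ b = 0.
Proof.
move=> ab; have ab' : to_ideal (mi_ideal M) (ideal_full a) *i to_ideal _ (ideal_full b) = 0.
  by apply/val_inj; rewrite raddf0.
have [a0|b0] := dom ab'.
  by left; have := congr1 val a0; rewrite raddf0.
by right; have := congr1 val b0; rewrite raddf0.
Qed.

End FullIdeal.

Section InfiniteCentroid.
Variables (R : nzRingType) (M : minIdeal R) (l : seq (int * seq bool)).
Local Notation dT := (ideal_type (mi_ideal M)).
Local Notation K := (centroid M).
Hypothesis prD : prime_ideal_ring M.
Hypothesis faithful : forall z : R, (forall d : dT, lm z d = 0) -> z = 0.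
Hypothesis l_id : forall a b : R, lsum a b l = 0.
Hypothesis gamma_neq0 : (\sum_(zw <- l | y_then_x zw.2) zw.1)%:~R != 0 :> K.
Hypothesis infK : ~ finitely_many K.

Let dom := ideal_domain prD faithful l_id gamma_neq0.

(** Multiplied by [e] on both sides, the homogeneous identity is a vanishing operator with left
    factors the powers of [e]. Its right factor at index 0 is nonzero, so these powers are linearly
    dependent over K. *)
Lemma infinite_centroid_onto (e : dT) : e <> 0 -> forall d, exists d', e *i d' = d.
Proof.
move=> e0; have [m [g [g0 gE]]] := homogeneous_identity l_id gamma_neq0 infK.
pose pw n : dT := lm (val e ^+ n) e.
have pw_neq0 n : pw n <> 0.
  elim: n => [|n IH]; first by rewrite /pw expr0 lm1.
  by rewrite /pw exprS lmA => /dom[].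
have [k [k0 kE]] : exists k : 'I_m.+1 -> K, (exists i, k i != 0) /\ \sum_i k i *: pw i = 0.
  apply: contrapT => indep.
  have ipw : independent (fun i : 'I_m.+1 => pw i).
    move=> k kE i; apply: contrapT => /eqP ki; apply: indep.
    by exists k; split=> //; exists i.
  have := independent_operator prD dom (b := fun i => g i *: pw (m - i)%N) ipw _ ord0.
  move=> /(_ _)/eqP; rewrite scaler_eq0 (negPf g0) /= => h; apply: (@pw_neq0 (m - 0)%N).
  apply/eqP/h => x; have /(congr1 (lm (val e))) := gE e x e.
  rewrite lm0r => h0; rewrite -[RHS]h0.
  rewrite (big_morph (lm (val e)) (lmDr (hD := mi_ideal M) (val e)) (lm0r _ _)).
  apply: eq_bigr => i _; rewrite -scale_lm -dscaleAr; congr (_ *: _); apply/val_inj.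
  by rewrite /= !mulrA -exprSr exprS.
(* Cancelling the lowest power of [e] gives a relation with nonzero constant term, which expresses
   every [d] as a multiple of [e]. *)
have {k k0 kE} [n [k [k0 kE]]] : exists n (k : nat -> K), k 0 != 0 /\
    forall d, \sum_(i < n.+1) k i *: lm (val e ^+ i) d = 0.
  have {kE} kE d : \sum_(i < m.+1) k i *: lm (val e ^+ i) d = 0.
    have : e *i (\sum_(i < m.+1) k i *: lm (val e ^+ i) d) = 0.
      rewrite dmul_sumr -[RHS](dmul0l d) -[X in _ = X *i _]kE dmul_suml; apply: eq_bigr => i _.
      rewrite -dscaleAl -dscaleAr; congr (_ *: _); apply/val_inj.
      by rewrite /= !mulrA -exprSr exprS.
    by move=> /dom[].
  (* Coefficients are extended by 0 to all naturals so that they can be shifted. *)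
  case: k0 => i ki; pose k' i := if insub i is Some j then k j else 0.
  have : exists i, k' i != 0 by exists i; rewrite /k' valK.
  have : forall d, \sum_(i < m.+1) k' i *: lm (val e ^+ i) d = 0.
    by move=> d; rewrite -[RHS](kE d); apply: eq_bigr => j _; rewrite /k' valK.
  have : forall i, (m.+1 <= i)%N -> k' i = 0.
    by move=> j jm; rewrite /k' insubF // ltnNge jm.
  move: k' (m.+1) => {k kE i ki g g0 gE} k n kn kE k0.
  elim: n k kn kE k0 => [|n IH] k kn kE [i ki]; first by rewrite kn ?eqxx in ki.
  have [k0|k0] := eqVneq (k 0%N) 0; last by exists n, k.
  apply: (IH (fun i => k i.+1)) => [j jn|d|]; first exact: kn.
    have /dom[//|//] : e *i (\sum_(i < n) k i.+1 *: lm (val e ^+ i) d) = 0.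
    rewrite -[RHS](kE d) big_ord_recl k0 scale0r add0r dmul_sumr; apply: eq_bigr => j _.
    by rewrite -dscaleAr; congr (_ *: _); apply/val_inj; rewrite /= mulrA -exprS.
  by case: i ki => [|i]; [rewrite k0 eqxx|exists i].
move=> d; exists (- (k 0%N)^-1 *: \sum_(i < n) k i.+1 *: lm (val e ^+ i) d).
apply: (scalerI k0); rewrite -dscaleAr scalerA mulrN mulfV // scaleN1r dmul_sumr.
apply/eqP; rewrite eq_sym -subr_eq0 opprK; apply/eqP.
rewrite -[RHS](kE d) big_ord_recl lm1; congr (_ + _); apply: eq_bigr => j _.
by rewrite -dscaleAr; congr (_ *: _); apply/val_inj; rewrite /= mulrA -exprS.
Qed.

(** Now D is the whole division ring. The homogeneous identity is rewritten in the iterated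
    commutators [e, ..., [e, h]], which do not change when a scalar is added to [e]. Varying the
    scalar isolates one of them and yields an Engel identity. *)
Lemma infinite_centroid_commutative (a b : R) : comm a b = 0.
Proof.
have onto := infinite_centroid_onto.
have full := ideal_full faithful dom onto.
have domR := full_domain faithful dom onto.
pose un r : dT := to_ideal _ (full r); pose sg (s : K) : R := val (s *: un 1).
have sgE s (d : dT) : val (s *: d) = sg s * val d.
  by rewrite /sg scale_val /= mul1r.
have sgC s r : r * sg s = sg s * r.
  rewrite -[r in RHS]/(val (un r)) -sgE.
  have -> : un r = lm r (un 1) by apply/val_inj; rewrite /= mulr1.
  by rewrite scale_lm.
have sgX s i : sg (s ^+ i) = sg s ^+ i.
  elim: i => [|i IH]; first by rewrite /sg scale1r.
  by rewrite exprS /sg -scalerA sgE -/(sg _) IH exprS.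
have sg_eq0 s r : s != 0 -> sg s * r = 0 -> r = 0.
  move=> s0; rewrite -[r]/(val (un r)) -sgE => h.
  have /eqP : s *: un r = 0 by apply/val_inj; rewrite h raddf0.
  by rewrite scaler_eq0 (negPf s0) => /eqP/(congr1 val); rewrite raddf0.
have vdm n (v : 'I_n -> R) : (forall s, \sum_(i < n) sg s ^+ i * v i = 0) -> forall i, v i = 0.
  move=> vE i; have : un (v i) = 0.
    apply: (vandermonde infK (v := fun i => un (v i))) => s; apply/val_inj.
    rewrite raddf_sum raddf0 -[RHS](vE s); apply: eq_bigr => j _.
    by rewrite -[LHS]/(val (s ^+ j *: un (v j))) sgE sgX.
  by move=> /(congr1 val); rewrite raddf0.
have [m [g [g0 gE]]] := homogeneous_identity l_id gamma_neq0 infK.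
have {}gE e h : \sum_(i < m.+1) sg (g i) * (e ^+ i * h * e ^+ (m - i)) = 0.
  have /(congr1 val) := gE (un e) (un h) (un 1); rewrite raddf_sum raddf0 => h0.
  rewrite -[RHS]h0; apply: eq_bigr => i _.
  rewrite -[RHS]/(val (g i *: lm (e ^+ i * h * e ^+ (m - i)) (un 1))) sgE.
  by rewrite val_lm mulr1.
pose be j : K := \sum_(i < m.+1) g i *+ 'C(i, j).
pose T j (e h : R) := iter j (comm e) h.
have sg0 : sg 0 = 0 by rewrite /sg scale0r raddf0.
have beE e h : \sum_(j < m.+1) sg (be j) * (T j e h * e ^+ (m - j)) = 0.
  have sg_be j r : sg (be j) * r = \sum_(i < m.+1) sg (g i) * (r *+ 'C(i, j)).
    rewrite -[r]/(val (un r)) -sgE /be scaler_suml raddf_sum; apply: eq_bigr => i _.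
    have valMn (d : dT) n : val (d *+ n) = val d *+ n by rewrite raddfMn.
    rewrite -[LHS]/(val ((g i *+ 'C(i, j)) *: un r)) -scalerMnl valMn sgE.
    by rewrite mulrnAr.
  under eq_bigr => j _ do rewrite sg_be.
  rewrite exchange_big /= -[RHS](gE e h); apply: eq_bigr => i _.
  rewrite -mulr_sumr; congr (_ * _); rewrite (comm_iter_expr e h (ltn_ord i)) mulr_suml.
  apply: eq_bigr => j _; have [ji|ij] := leqP j i; last by rewrite bin_small // !mulr0n mul0r.
  by rewrite mulrnAl -mulrA -exprD addnC addnBA // subnK // -ltnS.
(* The matrix of binomials is triangular: at the largest [i] with [g i] nonzero, [be i] equals
   [g i]. *)
have exb : exists j, (j <= m)%N && (be j != 0).
  have exg : exists i, (i <= m)%N && (g i != 0) by exists 0%N.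
  have [i /andP[im gi] imax] := @ex_maxnP _ m exg (fun i => fun h => proj1 (andP h)).
  exists i; rewrite im /be (bigD1 (Ordinal (im : (i < m.+1)%N))) //= binn mulr1n big1 ?addr0 //.
  move=> k; rewrite -val_eqE /= neq_ltn => /orP[ki|ik]; first by rewrite bin_small.
  have := contra (imax k); rewrite -ltnNge => /(_ ik).
  by rewrite -ltnS ltn_ord /= negbK => /eqP ->; rewrite mul0rn.
have [j /andP[jm bj] jmin] := ex_minnP exb.
apply: (engel_division_commutative (j := j) (full_inverse faithful dom onto)) => e h.
have Ts s i : T i (e + sg s) h = T i e h.
  elim: i => [//|i IH]; rewrite /T !iterS -!/(T i _ h) IH /comm mulrDl mulrDr opprD addrACA.
  by rewrite sgC subrr addr0.
(* [v i] is the coefficient of s^i after replacing [e] by e + s. With [j] least, at i = m - j the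
   terms k > j have degree too small and those with k < j have [be k = 0]. *)
pose v (i : 'I_m.+1) := \sum_(k < m.+1) sg (be k) * (T k e h * e ^+ (m - k - i) *+ 'C(m - k, i)).
have v0 := vdm _ v.
have im : (m - j < m.+1)%N by rewrite ltnS leq_subr.
apply: (sg_eq0 (be j)) => //; rewrite -[RHS](v0 _ (Ordinal im)) => [|s].
  rewrite /v (bigD1 (Ordinal (jm : (j < m.+1)%N))) //= subnn binn mulr1 mulr1n.
  rewrite big1 ?addr0 // => k; rewrite -val_eqE /= neq_ltn => /orP[kj|jk].
    have := contra (jmin k); rewrite -ltnNge => /(_ kj).
    by rewrite -ltnS ltn_ord /= negbK => /eqP ->; rewrite sg0 mul0r.
  by rewrite bin_small ?mulr0n ?mulr0 // ltn_sub2l // (leq_trans jk) // -ltnS.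
rewrite -[RHS](beE (e + sg s) h) /v.
under eq_bigr => i _ do rewrite mulr_sumr.
rewrite exchange_big; apply: eq_bigr => k _ /=; rewrite Ts.
rewrite (@exprDn_widen _ e (sg s) (m - k) m.+1) ?ltnS ?leq_subr ?sgC // !mulr_sumr.
apply: eq_bigr => i _; rewrite !mulrnAr; congr (_ *+ _).
by rewrite -sgX -sgC !mulrA.
Qed.

End InfiniteCentroid.

(** * Finite centroid *)

(* B. H. Neumann's lemma on coverings by cosets, for the kernels of the f i. *)
Lemma neumann_cover (V W : zmodType) n (f : nat -> V -> W) (F : seq W) :
  (forall i, {morph f i : a b / a + b}) ->
  (forall v, exists2 i, (i < n)%N & f i v \in F) ->
  exists2 i, (i < n)%N & exists G : seq W, forall v, f i v \in G.
Proof.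
move=> fD; have f0 i : f i 0 = 0 by apply: (addrI (f i 0)); rewrite -fD !addr0.
have fB i a b : f i (a - b) = f i a - f i b.
  by apply: (addIr (f i b)); rewrite -fD !subrK.
elim: n F => [|n IH] F cover; first by have [] := cover 0.
have [all_n|] := pselect (forall v, f n v \in F); first by exists n => //; exists F.
move=> /existsNP [g /negP gF].
have pre c : exists u, (exists v, f n v = c) -> f n u = c.
  by have [[v vc]|no] := pselect (exists v, f n v = c); [exists v|exists 0].
have [u uP] := choice pre.
(* A point [v] covered by [f n] is moved into the kernel of [f n] by subtracting one of finitely
   many representatives, then translated by [g] out of reach of [f n]. Another map covers the
   result, and [F'] undoes the translation. *)
pose F' := F ++ [seq a - b | a <- F, b <- [seq f i g - f i (u c) | i <- iota 0 n, c <- F]].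
have [|i ltin fi] := IH F'; last by exists i => //; exact: ltnW.
move=> v; have [i] := cover v; rewrite ltnS leq_eqVlt => /predU1P[->|ltin] fiv.
  have [j] := cover (g + (v - u (f n v))); rewrite ltnS leq_eqVlt => /predU1P[->|ltjn].
    by rewrite fD fB uP ?subrr ?addr0 ?(negPf gF) //; exists v.
  move=> fj; exists j => //; rewrite mem_cat; apply/orP; right.
  apply/allpairsP; exists (f j (g + (v - u (f n v))), f j g - f j (u (f n v))).
  split=> //=; last by rewrite fD fB opprB -!addrA addKr addrC subrK.
  by apply/allpairsP; exists (j, f n v); split=> //; rewrite mem_iota.
by exists i => //; rewrite mem_cat fiv.
Qed.

Lemma finitely_many_ffun (I : finType) (T : choiceType) :
  finitely_many T -> exists s : seq {ffun I -> T}, forall f, f \in s.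
Proof.
move=> [s sT]; exists [seq [ffun i => ssval (g i)] | g : {ffun I -> seq_sub s}] => f.
apply/imageP; exists [ffun i => SeqSub (sT (f i))] => //.
by apply/ffunP => i; rewrite !ffunE.
Qed.

Section FiniteCentroid.
Variables (R : nzRingType) (M : minIdeal R) (l : seq (int * seq bool)).
Local Notation dT := (ideal_type (mi_ideal M)).
Local Notation K := (centroid M).
Hypothesis prD : prime_ideal_ring M.
Hypothesis dom : forall a b : dT, a *i b = 0 -> a = 0 \/ b = 0.
Hypothesis finK : finitely_many K.
Hypothesis infD : ~ finitely_many dT.

(** Shortened within the class of operators of finite image, it becomes x |-> a' x b', which is
    injective in a domain. *)
Lemma infinite_image (I : finType) (a b : I -> dT) : independent a -> (exists i, b i <> 0) ->
  ~ exists G : seq dT, forall x, \sum_i a i *i x *i b i \in G.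
Proof.
move=> ia [i0 bi0] fin.
have reix (V : nmodType) (F : I -> V) : \sum_i F i = \sum_(j < #|I|) F (enum_val j).
  by rewrite (reindex (@enum_val I I)) //=; exists enum_rank => i _; rewrite ?enum_valK ?enum_rankK.
pose C (f : dT -> dT) := exists G : seq dT, forall x, f x \in G.
have [|||k kE j|||a' [b' [a0 b0 [G GE]]]] := @one_term_operator _ M prD dom C _ _ _ #|I|
  (fun j => a (enum_val j)) (fun j => b (enum_val j)).
- move=> f g [G fG] [H gH]; exists [seq x - y | x <- G, y <- H] => x.
  by apply/allpairsP; exists (f x, g x); split; [exact: fG|exact: gH|].
- by move=> f r [G fG]; exists [seq x *i r | x <- G] => x; apply: map_f; exact: fG.
- by move=> f r [G fG]; exists G => x; exact: fG.
- rewrite -[j]enum_valK; apply: (ia (fun i => k (enum_rank i))).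
  by rewrite reix -[RHS]kE; apply: eq_bigr => i _; rewrite enum_valK.
- by exists (enum_rank i0); rewrite enum_rankK.
- by case: fin => G GE; exists G => x; rewrite -(reix _ (fun i => a i *i x *i b i)).
apply: infD.
have pre c : exists u, (exists x, a' *i x *i b' = c) -> a' *i u *i b' = c.
  by have [[v vc]|no] := pselect (exists v, a' *i v *i b' = c); [exists v|exists 0].
have [u uP] := choice pre.
exists [seq u c | c <- G] => x; apply/mapP; exists (a' *i x *i b') => //.
apply: (dmulIl dom a0); apply: (dmulIr dom b0); rewrite uP //; by exists x.
Qed.

Definition extension (I : finType) (a : I -> dT) (v : dT) (s : I + I * I) : dT :=
  match s with inl i => a i | inr ij => a ij.1 *i v *i a ij.2 end.

(** If every [v] fails, each [v] is sent into the finite span of the a_i by some nonzero combination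
    of the operators v |-> a_i v a_j. There are finitely many combinations, so by [neumann_cover]
    one has finite image, against [infinite_image]. *)
Lemma independent_extension (I : finType) (a : I -> dT) : independent a ->
  exists v, independent (extension a v).
Proof.
move=> ia; apply: contrapT => no.
have [s1 s1P] := finitely_many_ffun (I * I)%type finK.
have [s2 s2P] := finitely_many_ffun I finK.
pose s := [seq f : {ffun I * I -> K} <- s1 | f != 0].
pose op (k : {ffun I * I -> K}) v := \sum_ij k ij *: (a ij.1 *i v *i a ij.2).
pose F := [seq \sum_i f i *: a i | f : {ffun I -> K} <- s2].
have opD k : {morph op k : x y / x + y}.
  move=> x y; rewrite /op -big_split; apply: eq_bigr => ij _.
  by rewrite dmulDr dmulDl scalerDr.
have [v|i ltis [G GE]] := @neumann_cover dT dT (size s) (fun i => op (nth 0 s i)) F (fun i => opD _).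
  have [k [kE [ij kij]]] : exists k : I + I * I -> K,
      \sum_i k i *: extension a v i = 0 /\ exists i, k i != 0.
    apply: contrapT => no'; apply: no; exists v => k kE i; apply: contrapT => /eqP ki.
    by apply: no'; exists k; split=> //; exists i.
  pose k2 := [ffun ij => k (inr ij)]; move: kE; rewrite big_sumType /=.
  have -> : \sum_i k (inr i) *: (a i.1 *i v *i a i.2) = op k2 v.
    by apply: eq_bigr => t _; rewrite ffunE.
  move=> /eqP; rewrite addrC addr_eq0 => /eqP opv.
  have k2s : k2 \in s.
    rewrite mem_filter s1P andbT; apply/eqP => k20.
    have k1 i : k (inl i) = 0.
      apply: (ia (fun i => k (inl i))); apply: oppr_inj; rewrite -opv k20 oppr0.
      by apply: big1 => t _; rewrite ffunE scale0r.
    move: kij; case: ij => [i|ij]; first by rewrite k1 eqxx.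
    by have := congr1 (fun f : {ffun _ -> _} => f ij) k20; rewrite !ffunE => ->; rewrite eqxx.
  exists (index k2 s); first by rewrite index_mem.
  rewrite nth_index // opv; apply/mapP; exists [ffun i => - k (inl i)] => //.
  by rewrite -sumrN; apply: eq_bigr => i _; rewrite ffunE scaleNr.
have := mem_nth 0 ltis; move: GE; set k := nth 0 s i => GE; rewrite mem_filter => /andP[k0 _].
apply: (infinite_image (a := a) (b := fun i => \sum_j k (i, j) *: a j) ia).
  apply: contrapT => b0; case/eqP: k0; apply/ffunP => -[x y]; rewrite ffunE.
  apply: (ia (fun j => k (x, j))); apply: contrapT => bx; apply: b0; by exists x.
exists G => x; rewrite (_ : \sum_i _ = op k x) // /op.
under eq_bigr => t _ do rewrite dmul_sumr.
by rewrite pair_bigA; apply: eq_bigr => -[t j] _ /=; rewrite -dscaleAr.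
Qed.

End FiniteCentroid.

Lemma uniq_map_inj (T T' : eqType) (f : T -> T') (s : seq T) :
  uniq (map f s) -> {in s &, injective f}.
Proof.
elim: s => //= z s IH /andP[nz us] x y; rewrite !inE.
move=> /predU1P[->|xs] /predU1P[->|ys] // fxy; last exact: IH.
  by rewrite fxy map_f in nz.
by rewrite -fxy map_f in nz.
Qed.

(** * Words with indexed letters and polarization *)

Section Words.
Variable N : nat.

Fixpoint words (k : nat) : seq (seq 'I_N) :=
  if k is k'.+1 then [seq i :: s | i <- index_enum 'I_N, s <- words k'] else [:: [::]].

Lemma mem_words k s : (s \in words k) = (size s == k).
Proof.
elim: k s => [|k IH] [|i s] //=.
  by apply/allpairsP => -[[i s] [_ _]].
rewrite eqSS -IH; apply/allpairsP/idP => [[[j t] /= [_ ts [_ ->]]]//|sk].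
by exists (i, s); split=> //=; rewrite mem_index_enum.
Qed.

Lemma words_uniq k : uniq (words k).
Proof.
elim: k => //= k IH; apply: allpairs_uniq => //; first exact: index_enum_uniq.
by move=> [i s] [j t] _ _ /= [-> ->].
Qed.

(* The letter of type b (false for X, true for Y) and index i is coded by 2 i + b. *)
Definition decorate (w : seq bool) (s : seq 'I_N) : seq nat :=
  [seq (nat_of_bool bi.1 + (nat_of_ord bi.2).*2)%N | bi <- zip w s].

Lemma odd_decorate w s : size w = size s -> map odd (decorate w s) = w.
Proof.
move=> ws; rewrite /decorate -map_comp -[RHS](unzip1_zip (s := w) (t := s)) ?ws //.
by apply: eq_map => -[b i] /=; rewrite oddD odd_double addbF oddb.
Qed.

Lemma half_decorate w s : size w = size s -> map half (decorate w s) = map val s.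
Proof.
move=> ws; rewrite /decorate -map_comp -[in RHS](unzip2_zip (s := w) (t := s)) ?ws //.
by rewrite -map_comp; apply: eq_map => -[b i] /=; rewrite half_bit_double.
Qed.

Lemma decorate_uniq w s : size w = size s -> uniq s -> uniq (decorate w s).
Proof.
move=> ws us; apply: (@map_uniq _ _ half); rewrite half_decorate //.
by rewrite map_inj_uniq //; exact: val_inj.
Qed.

Lemma decorate_lt w s : all (fun j => (j < N.*2)%N) (decorate w s).
Proof.
apply/allP => _ /mapP [[b i] _ ->] /=; apply: (@leq_trans i.+1.*2).
  by rewrite doubleS; case: b.
by rewrite leq_double.
Qed.

Lemma wev_polarized (R : nzRingType) (u : nat -> R) (S : {set 'I_N}) w :
  wev (\sum_(i in S) u i.*2) (\sum_(i in S) u i.*2.+1) w =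
  \sum_(s <- words (size w) | all (mem S) s) \prod_(j <- decorate w s) u j.
Proof.
elim: w => [|b w IH] /=; first by rewrite wev_nil big_mkcond big_seq1 big_nil.
rewrite wev_cons IH [RHS]big_mkcond big_allpairs_dep /=.
have -> : (if b then \sum_(i in S) u i.*2.+1 else \sum_(i in S) u i.*2) =
    \sum_(i in S) u (b + i.*2)%N by case: b.
rewrite mulr_suml big_mkcond; apply: eq_bigr => i _; case: ifP => iS /=; last first.
  by rewrite big1.
rewrite big_mkcond mulr_sumr; apply: eq_bigr => s _.
by case: ifP => _; rewrite ?mulr0 // /decorate /= big_cons.
Qed.

End Words.

Section FiniteCentroid.
Variables (R : nzRingType) (M : minIdeal R) (l : seq (int * seq bool)).
Local Notation dT := (ideal_type (mi_ideal M)).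
Local Notation K := (centroid M).
Hypothesis prD : prime_ideal_ring M.
Hypothesis dom : forall a b : dT, a *i b = 0 -> a = 0 \/ b = 0.
Hypothesis finK : finitely_many K.
Hypothesis l_id : forall a b : R, lsum a b l = 0.
Hypothesis l_uniq : uniq (map snd l).

(* New words are t1 n t2 with t1, t2 old, so every word without repeated letters
   eventually appears. *)
Lemma independent_words (d0 : dT) n : ~ finitely_many dT -> d0 <> 0 ->
  exists u : nat -> R, exists (I : finType) (wd : I -> seq nat),
  [/\ independent (fun i => rm d0 (\prod_(j <- wd i) u j)),
      forall i, all (fun j => (j < n)%N) (wd i) &
      forall W, uniq W -> all (fun j => (j < n)%N) W -> exists i, wd i = W].
Proof.
move=> infD d00; elim: n => [|n [u [I [wd [ind wdn cov]]]]].
  exists (fun=> 0), unit, (fun=> [::]); split=> // [k kE []|[|//] _ _]; last by exists tt.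
  move: kE; rewrite (big_pred1 tt) => [|[] //]; rewrite big_nil rm1 => /eqP.
  by rewrite scaler_eq0 => /orP[/eqP|/eqP].
have [v indv] := independent_extension prD dom finK infD ind.
(* With this value d0 w1 u_n w2 is the product of d0 w1, [v] and d0 w2, as in [extension]. *)
pose u' j := if j == n then val v * val d0 else u j.
pose wd' (s : I + I * I) := match s with inl i => wd i | inr ij => wd ij.1 ++ n :: wd ij.2 end.
have prodE i : \prod_(j <- wd i) u' j = \prod_(j <- wd i) u j.
  rewrite [LHS]big_seq [RHS]big_seq; apply: eq_bigr => j ji.
  by have := allP (wdn i) j ji; rewrite /u'; case: eqP => [->|//]; rewrite ltnn.
exists u', (I + I * I)%type, wd'; split.
- rewrite (_ : (fun i => _) = extension (fun i => rm d0 (\prod_(j <- wd i) u j)) v) //.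
  apply/funext => -[i|[i j]] /=; rewrite ?big_cat ?big_cons /= !prodE //.
  by apply/val_inj; rewrite /u' eqxx /= !mulrA.
- have wdn' i : all (fun j => (j < n.+1)%N) (wd i).
    by apply: sub_all (wdn i) => j; exact: ltnW.
  by move=> [i|[i j]] //=; rewrite all_cat /= leqnn !wdn'.
- have strict W : n \notin W -> all (fun j => (j < n.+1)%N) W -> all (fun j => (j < n)%N) W.
    move=> nW /allP Wn; apply/allP => j jW; have := Wn j jW.
    by rewrite ltnS leq_eqVlt => /predU1P[jn|//]; rewrite -jn jW in nW.
  move=> W uW Wn; have [nW|nW] := boolP (n \in W); last first.
    by have [i <-] := cov W uW (strict W nW Wn); exists (inl i).
  case/splitPr: nW uW Wn => W1 W2; rewrite cat_uniq all_cat /= negb_or.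
  move=> /and3P[uW1 /andP[nW1 _] /andP[nW2 uW2]] /and3P[W1n _ W2n].
  have [i <-] := cov _ uW1 (strict _ nW1 W1n).
  by have [j <-] := cov _ uW2 (strict _ nW2 W2n); exists (inr (i, j)).
Qed.

(** Let [w0] be a word of maximal length N with coefficient [z0] nonzero in K. If [D] is infinite,
    substitute for each letter a sum of N fresh variables and keep the terms that use all N indices.
    This is a linear relation between independent monomials in which [z0] is a coefficient. *)
Lemma finite_ideal zw0 : zw0 \in l -> zw0.1%:~R != 0 :> K -> finitely_many dT.
Proof.
move=> zw0l zw00; apply: contrapT => infD; have [d0 d00] := dT_neq0 M.
pose P n := has (fun zw : int * seq bool => (zw.1%:~R != 0 :> K) && (size zw.2 == n)) l.
have exP : exists n, P n by exists (size zw0.2); apply/hasP; exists zw0; rewrite // zw00 /=.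
have bP n : P n -> (n <= \sum_(zw <- l) size zw.2)%N.
  by move=> /hasP[zw zwl /andP[_ /eqP <-]]; rewrite (big_rem zw) //= leq_addr.
have [N /hasP [[z0 w0] /= zwl /andP[z00 /eqP w0N]] maxN] := ex_maxnP exP bP.
have [u [I [wd [ind _ cov]]]] := independent_words N.*2 infD d00.
pose T (z : int) (w : seq bool) (s : seq 'I_N) : dT :=
  (z%:~R : K) *: rm d0 (\prod_(j <- decorate w s) u j).
pose h (Q : pred (seq 'I_N)) : dT :=
  \sum_(zw <- l) \sum_(s <- words N (size zw.2) | Q s) T zw.1 zw.2 s.
have rm_sum (J : Type) (r : seq J) (Q : pred J) (F : J -> R) :
    rm d0 (\sum_(i <- r | Q i) F i) = \sum_(i <- r | Q i) rm d0 (F i).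
  apply: (big_morph (rm d0)) => [a b|]; first by rewrite rmDr.
  by apply/val_inj; exact: mulr0.
have hsub (S : {set 'I_N}) : h (fun s => all (mem S) s) = 0.
  have := congr1 (rm d0) (l_id (\sum_(i in S) u i.*2) (\sum_(i in S) u i.*2.+1)).
  have -> : rm d0 0 = 0 by apply/val_inj; exact: mulr0.
  rewrite /lsum rm_sum => h0; rewrite -[RHS]h0; apply: eq_bigr => zw _.
  rewrite wev_polarized mulr_sumr rm_sum; apply: eq_bigr => s _.
  by rewrite /T scaler_intl; apply/val_inj; rewrite val_int /= !mulrA commr_int.
pose supp (s : seq 'I_N) : {set 'I_N} := [set i in s].
(* Inclusion-exclusion: the sum over index words inside [S] splits by exact index set, and the
   proper subsets vanish by induction. *)
have hsupp (S : {set 'I_N}) : h (fun s => supp s == S) = 0.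
  have [n] := ubnP #|S|; elim: n => // n IH in S *; rewrite ltnS => Sn.
  have := hsub S; rewrite /h.
  rewrite (eq_bigr (fun zw : int * seq bool => \sum_(A : {set 'I_N} | A \subset S)
    \sum_(s <- words N (size zw.2) | supp s == A) T zw.1 zw.2 s)) => [|zw _]; last first.
    rewrite (partition_big supp (fun A => A \subset S)) => [|s /allP sS] /=; last first.
      by apply/subsetP => i; rewrite inE => /sS.
    apply: eq_bigr => A AS; apply: eq_bigl => s.
    case: (supp s =P A) => [sA|]; rewrite ?andbF // andbT; apply/allP => i iS.
    by apply: (subsetP AS); rewrite -sA inE.
  rewrite exchange_big (bigD1 S) //= [X in _ + X]big1 ?addr0 // => A /andP[AS nAS].
  apply: IH; apply: leq_trans Sn; apply: proper_card.
  by rewrite properEneq nAS.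
have [idx0 _] := cov [::] isT isT.
have pre W : exists i, uniq W && all (fun j => (j < N.*2)%N) W -> wd i = W.
  have [/andP[uW Wn]|_] := boolP (_ && _); last by exists idx0.
  by have [i <-] := cov W uW Wn; exists i.
have [idx idxP] := choice pre.
(* An index word that uses all N indices and has length at most N repeats none, so its monomial
   belongs to the independent family. *)
have wd_idx zw s : zw \in l -> zw.1%:~R != 0 :> K -> s \in words N (size zw.2) ->
    supp s = setT -> wd (idx (decorate zw.2 s)) = decorate zw.2 s.
  move=> zl z_0; rewrite mem_words => /eqP sw sT; apply: idxP.
  rewrite decorate_lt andbT decorate_uniq //.
  have sN : (size s <= N)%N by rewrite sw; apply: maxN; apply/hasP; exists zw; rewrite ?z_0 /=.
  apply/card_uniqP/eqP; rewrite eqn_leq card_size.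
  have -> : #|s| = N by rewrite -[RHS]card_ord -cardsT -sT cardsE.
  exact: sN.
pose s0 := enum 'I_N; pose W0 := decorate w0 s0.
have sw0 : size w0 = size s0 by rewrite size_enum_ord.
have s0T : supp s0 = setT by apply/setP => i; rewrite !inE mem_enum.
have s0w : s0 \in words N (size w0) by rewrite mem_words sw0.
have W0E := wd_idx (z0, w0) s0 zwl z00 s0w s0T.
(* The total coefficient of each monomial in the relation; at [W0] only the pair of [w0] and [s0]
   contributes, so it is [z0]. *)
pose k (i : I) : K := \sum_(zw <- l | zw.1%:~R != 0 :> K)
  \sum_(s <- words N (size zw.2) | (supp s == setT) && (idx (decorate zw.2 s) == i)) zw.1%:~R.
have : k (idx W0) = 0.
  apply: (ind k); rewrite -[RHS](hsupp setT) /h /k.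
  under eq_bigr => i _ do rewrite scaler_suml.
  rewrite (exchange_big_dep (fun zw : int * seq bool => zw.1%:~R != 0 :> K)) //= big_mkcond.
  rewrite [LHS]big_seq [RHS]big_seq; apply: eq_bigr => zw zl; case: ifPn => [z_0|]; last first.
    by rewrite negbK => /eqP z0'; rewrite big1 // => s _; rewrite /T z0' scale0r.
  under eq_bigr => i _ do rewrite scaler_suml.
  rewrite (exchange_big_dep (fun s => supp s == setT)) /= => [|i s _ /andP[] //].
  rewrite big_seq_cond [RHS]big_seq_cond; apply: eq_bigr => s /andP[sw /eqP sT].
  rewrite (big_pred1 (idx (decorate zw.2 s))) => [|i]; last by rewrite /= sT eqxx z_0 [RHS]eq_sym.
  by rewrite /T wd_idx.
rewrite /k big_mkcond (bigD1_seq (z0, w0)) /= ?(map_uniq l_uniq) // z00.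
rewrite (big_mkcond (fun s => _)) (bigD1_seq s0) ?words_uniq //= s0T !eqxx /=.
have dec_inj zw s : zw \in l -> zw.1%:~R != 0 :> K -> s \in words N (size zw.2) ->
    (supp s == setT) && (idx (decorate zw.2 s) == idx W0) -> zw.2 = w0 /\ s = s0.
  move=> zl z_0 sw /andP[/eqP sT /eqP ii].
  have := wd_idx zw s zl z_0 sw sT; rewrite ii W0E => e.
  have ws : size zw.2 = size s by move: sw; rewrite mem_words => /eqP ->.
  split; first by rewrite -(odd_decorate ws) -e odd_decorate.
  apply: (inj_map val_inj); by rewrite -(half_decorate ws) -e half_decorate.
rewrite big_seq_cond big1 ?addr0 => [|s /andP[sw ss0]]; last first.
  case: ifP => // cond; have [_ s0E] := dec_inj (z0, w0) s zwl z00 sw cond.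
  by rewrite s0E eqxx in ss0.
rewrite big_seq_cond big1 ?addr0 => [/eqP|[z w] /andP[zl nz]]; first by rewrite (negPf z00).
case: ifP => // z_0; rewrite big_seq_cond big1 // => s /andP[sw cond].
have [/= wE _] := dec_inj (z, w) s zl z_0 sw cond.
case/negP: nz; apply/eqP.
exact: (uniq_map_inj l_uniq zl zwl wE).
Qed.

End FiniteCentroid.

(** * The theorem *)

(** The carrier is given the structure required by [finDomain_mulrC], Wedderburn's theorem. *)
Lemma finite_division_commutative (R : nzRingType) : finitely_many R ->
  (forall r : R, r <> 0 -> exists r', r * r' = 1) -> forall a b : R, comm a b = 0.
Proof.
move=> [s sR] hinv; pose e := undup s.
have eP : Finite.axiom e.
  by move=> a; rewrite count_uniq_mem ?undup_uniq // mem_undup sR.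
have idxK : pcancel (fun a => index a e) (fun n => nth None [seq Some b | b <- e] n).
  move=> a; have ae : (index a e < size e)%N by rewrite index_mem mem_undup.
  by rewrite (nth_map 0) // nth_index // mem_undup.
(* The unit ring structure wants the inverse to be the identity on non-units, hence the value at
   0. *)
have pre (r : R) : exists r', if r == 0 then r' = r else r * r' = 1.
  have [r0|/eqP r0] := eqVneq r 0; first by exists r.
  exact: hinv.
have [inv invP] := choice pre.
pose u : {pred R} := fun r => r != 0.
have mulrV : {in u, right_inverse 1 inv *%R}.
  by move=> r r0; have := invP r; rewrite (negPf r0).
have mulVr : {in u, left_inverse 1 inv *%R}.
  move=> r r0; have rV := mulrV r r0.
  have rV0 : inv r \in u.
    by apply/negP => /eqP rV0; move/eqP: rV; rewrite rV0 mulr0 eq_sym oner_eq0.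
  have rVV := mulrV _ rV0.
  have rE : r = inv (inv r) by rewrite -[LHS]mulr1 -rVV mulrA rV mul1r.
  by rewrite {2}rE.
have unitrP (r r' : R) : r' * r = 1 /\ r * r' = 1 -> u r.
  move=> [_ rr']; apply/eqP => r0; move/eqP: rr'.
  by rewrite r0 mul0r eq_sym oner_eq0.
have out : {in [predC u], inv =1 id}.
  by move=> r /negPn r0; have := invP r; rewrite r0.
pose A : finUnitRingType := HB.pack (GRing.NzRing.sort R) (PCanIsCountable idxK)
  (isFinite.Build R eP) (GRing.NzRing_hasMulInverse.Build R mulVr mulrV unitrP out).
have domA : GRing.integral_domain_axiom A.
  move=> a b ab; have [//|a0] := eqVneq a 0.
  by rewrite -[b]mul1r -(mulVr a a0) -mulrA ab mulr0 eqxx.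
by move=> a b; apply/eqP; rewrite subr_eq0; apply/eqP; exact: (finDomain_mulrC domA).
Qed.

Section Idempotent.
Variables (R : nzRingType) (S : forall s : nat, freeRing s -> Prop) (x y : R).
Hypothesis hR : satisfies R S.
Hypothesis gen : forall a, exists P, a = ev2 x y P.
Hypothesis c0 : comm x y <> 0.
Hypothesis heart : forall I : R -> Prop, is_ideal I -> ideal_nonzero I -> I (comm x y).
Hypothesis nsqz : ~ forall a b, core_ideal x y a -> core_ideal x y b -> a * b = 0.

Local Notation D := (core_ideal x y).
Local Notation hD := (core_idealP x y).
Local Notation dT := (ideal_type hD).

Lemma ideal_core (I : R -> Prop) r : is_ideal I -> I r -> r <> 0 -> forall d, D d -> I d.
Proof. by move=> hI Ir r0; apply: (core_ideal_sub hI); apply: heart => //; exists r. Qed.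

(** The annihilator of [D] is an ideal; if nonzero it would contain [D], and then D^2 = 0. *)
Lemma core_faithful_l r : (forall d, D d -> r * d = 0) -> r = 0.
Proof.
move=> rD; apply: contrapT => r0; apply: nsqz => a b Da Db.
suff hI : is_ideal (fun s => forall d, D d -> s * d = 0) by have /(_ b Db) := ideal_core hI rD r0 Da.
split=> [d _|u v uD vD d Dd|s u uD d Dd|u s uD d Dd]; first by rewrite mul0r.
- by rewrite mulrDl uD ?vD ?addr0.
- by rewrite -mulrA uD ?mulr0.
- by rewrite -mulrA uD //; exact: (idealMl hD).
Qed.

Lemma core_faithful_r r : (forall d, D d -> d * r = 0) -> r = 0.
Proof.
move=> rD; apply: contrapT => r0; apply: nsqz => a b Da Db.
suff hI : is_ideal (fun s => forall d, D d -> d * s = 0) by have /(_ a Da) := ideal_core hI rD r0 Db.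
split=> [d _|u v uD vD d Dd|s u uD d Dd|u s uD d Dd]; first by rewrite mulr0.
- by rewrite mulrDr uD ?vD ?addr0.
- by rewrite mulrA uD //; exact: (idealMr hD).
- by rewrite mulrA uD ?mul0r.
Qed.

(** The elements r with r D b = 0 form an ideal. If it contains a nonzero [a], it contains [D], and
    faithfulness used twice on D D b = 0 gives b = 0. *)
Lemma core_prime : prime_ideal_ring D.
Proof.
move=> a b Da Db aDb; have [->|/eqP a_0] := eqVneq a 0; [by left|right].
have hI : is_ideal (fun r => forall d, D d -> r * d * b = 0).
  split=> [d _|u v uD vD d Dd|s u uD d Dd|u s uD d Dd]; first by rewrite !mul0r.
  - by rewrite !mulrDl uD ?vD ?addr0.
  - by rewrite -!mulrA [u * _]mulrA uD ?mulr0.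
  - by rewrite -[u * _ * d]mulrA uD //; exact: (idealMl hD).
apply: core_faithful_r => d Dd; apply: core_faithful_r => d' Dd'.
by rewrite mulrA; exact: (ideal_core hI aDb a_0).
Qed.

Lemma core_square d : D d -> set_mul D D d.
Proof.
have hDD : is_ideal (set_mul D D) by apply: set_mul_ideal; [exact: (idealMl hD)|exact: (idealMr hD)].
apply: contrapT => /not_implyP [Dd nd]; apply: nsqz => a b Da Db.
apply: contrapT => ab; apply: nd; apply: (ideal_core hDD _ ab) => //.
exact: set_mul_base.
Qed.

(** On a product a b one map can act on [a] and the other on [b], in either order, and D^2 = D. *)
Lemma core_bimodule_comm (f g : dT -> dT) : bimodule_map f -> bimodule_map g ->
  forall d, f (g d) = g (f d).
Proof.
move=> [fD fl fr] [gD gl gr].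
have f0 : f 0 = 0 by apply: (addrI (f 0)); rewrite -fD !addr0.
have g0 : g 0 = 0 by apply: (addrI (g 0)); rewrite -gD !addr0.
have fN u : f (- u) = - f u by apply: (addrI (f u)); rewrite -fD !subrr.
have gN u : g (- u) = - g u by apply: (addrI (g u)); rewrite -gD !subrr.
have key r : set_mul D D r -> exists2 d : dT, val d = r & f (g d) = g (f d).
  elim=> [a b Da Db||u v _ [a <- fga] _ [b <- fgb]|u _ [a <- fga]].
  - pose a' := to_ideal hD Da; pose b' := to_ideal hD Db.
    have lr (s t : dT) : lm (val s) t = rm s (val t) by apply/val_inj.
    exists (lm (val a') b') => //.
    by rewrite gl (lr a' (g b')) fr (lr a' b') fr -!(lr (f a')) gl.
  - by exists 0; rewrite ?f0 ?g0 ?f0.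
  - by exists (a + b); rewrite ?raddfD // gD !fD gD fga fgb.
  - by exists (- a); rewrite ?raddfN // gN !fN gN fga.
move=> d; have [d' /val_inj <- //] := key _ (core_square (ideal_typeP d)).
Qed.

Definition core_min_ideal : minIdeal R :=
  MinIdeal (core_ideal_min c0 heart) core_bimodule_comm.

Lemma idempotent_case : exists2 p : nat, prime p & satisfies (U p) S.
Proof.
apply: contrapT => noU; pose K := centroid core_min_ideal.
(* The characteristic of [K]; in characteristic 0 any prime serves, and 2 is taken. *)
have [p pr_p pK] : exists2 p, prime p & forall z : int, z%:~R = 0 :> K -> (p %| z)%Z.
  have [[p chp]|no] := pselect (exists p, p \in [pchar K]).
    exists p; first exact: pcharf_prime chp.
    by move=> z z0; rewrite (dvdz_pcharf chp) z0.
  exists 2%N => // z z0; have [->|zn0] := eqVneq z 0; first exact: dvdz0.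
  case: no; apply: (@natf0_pchar _ `|z|%N); first by rewrite absz_gt0.
  case: z z0 {zn0} => n z0; apply/eqP; first exact: z0.
  by apply: oppr_inj; rewrite oppr0; exact: z0.
have intD (z : int) : z%:~R = 0 :> R -> z%:~R = 0 :> K.
  move=> z0; have [d d0] := dT_neq0 core_min_ideal.
  have /eqP : (z%:~R : K) *: d = 0.
    by rewrite scaler_intl; apply/val_inj; rewrite val_int z0 mul0r raddf0.
  by rewrite scaler_eq0 => /orP[/eqP|/eqP].
have [||l [ul l_id gl]] := not_satisfies_U pr_p hR.
- by move=> hU; apply: noU; exists p.
- by move=> z /intD; exact: pK.
have gamma : (\sum_(zw <- l | y_then_x zw.2) zw.1)%:~R != 0 :> K.
  by apply: contra gl => /eqP; exact: pK.
have faithful (r : R) : (forall d : ideal_type (mi_ideal core_min_ideal), lm r d = 0) -> r = 0.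
  move=> rd; apply: core_faithful_l => d Dd.
  by have /(congr1 val) := rd (to_ideal hD Dd); rewrite raddf0.
have prD : prime_ideal_ring core_min_ideal by exact: core_prime.
have [finK|infK] := pselect (finitely_many K); last first.
  exact: c0 (infinite_centroid_commutative prD faithful l_id gamma infK x y).
have dom := ideal_domain prD faithful l_id gamma.
have [zw0 zwl zw00] : exists2 zw, zw \in l & zw.1%:~R != 0 :> K.
  apply: contrapT => no; case/eqP: gamma.
  rewrite rmorph_sum big_seq_cond big1 // => zw /andP[zwl _].
  by apply: contrapT => /eqP zw0; apply: no; exists zw.
have [s sD] := finite_ideal prD dom finK l_id ul zwl zw00.
(* In a finite domain left multiplication by [e] is injective, hence onto. *)
have onto (e : ideal_type (mi_ideal core_min_ideal)) : e <> 0 -> forall d, exists d', e *i d' = d.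
  move=> e0 d; pose s' := undup s.
  have us : uniq (map (dmul e) s').
    by rewrite map_inj_uniq ?undup_uniq // => a b; exact: (dmulIl dom).
  have [||_ eqi] := uniq_min_size us (s2 := s').
  - by move=> a _; rewrite mem_undup.
  - by rewrite size_map.
  have : d \in s' by rewrite mem_undup.
  by rewrite -eqi => /mapP[d' _ ->]; exists d'.
have full := ideal_full faithful dom onto.
apply: c0; apply: finite_division_commutative; last exact: full_inverse faithful dom onto.
exists (map val s) => r; apply/mapP.
by exists (to_ideal (mi_ideal core_min_ideal) (full r)).
Qed.

End Idempotent.

Local Close Scope ring_scope.

Theorem theorem2p5 (S : forall s : nat, freeRing s -> Prop)
    (R : nzRingType) (hR : noncommutative R) (hRS : satisfies R S) :
  ((exists2 p : nat, prime p & satisfies (U p) S)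
   \/ (exists (p n i : nat) (pr_p : prime p) (n_gt1 : 1 < n),
         0 < i <= n - 1 /\ satisfies (B pr_p n_gt1 i) S)
   \/ (exists2 p : nat, prime p &
         exists A : nzRingType, in_calA p A /\ satisfies A S))
  /\
  (exists A : finNzRingType,
     [/\ noncommutative A,
         satisfies A S,
         ideal_nonzero (commutator_ideal (R := A)) &
         ideal_nilpotent (commutator_ideal (R := A))]).
Proof.
suff disj : (exists2 p : nat, prime p & satisfies (U p) S)
   \/ (exists (p n i : nat) (pr_p : prime p) (n_gt1 : 1 < n),
         0 < i <= n - 1 /\ satisfies (B pr_p n_gt1 i) S)
   \/ (exists2 p : nat, prime p &
         exists A : nzRingType, in_calA p A /\ satisfies A S).
  by split=> //; exact: finite_part.
have [A [x [y [hA gen c0 heart]]]] := two_generated_core hR hRS.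
have [sqz|nsqz] := pselect (forall a b : A, core_ideal x y a -> core_ideal x y b ->
  a * b = 0)%R.
  exact: square_zero_case hA gen c0 heart sqz.
left; exact: idempotent_case hA c0 heart nsqz.
Qed.
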